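(* Let $k\ge1$ be an integer and $r>0$. Assume that the families $\mathcal{Q}^*_n$, $n\ge1$, of admissible noise distributions satisfy $\mathcal{Q}^*_n\subset\mathcal{P}^*_n$ and $Q_0\in\mathcal{Q}^*_n$. Then $$\liminf_{n\to\infty}\,n^{2k/(2k+1)}\,\frac{1}{R^*_{k,n}}\,\inf_{\widetilde S_n\in\Pi_n}\ \sup_{S\in W^k_r}\mathcal{R}^*_n(\widetilde S_n,S)\ge1 .$$
   Context: **Model.** For each integer $n\ge1$ one observes $(y_t)_{0\le t\le n}$ with $dy_t=S(t)\,dt+d\xi_t$, where $S:\mathbb{R}\to\mathbb{R}$ is an unknown 1-periodic function, $S\in L_2[0,1]$, and $\xi$ is a semimartingale noise with càdlàg (Skorohod space) paths and distribution $Q$. Write $\|f\|^2=\int_0^1 f^2(x)\,dx$, $\mathbf{E}_Q$ for expectation under $Q$, and $\mathbf{E}_{Q,S}$ for expectation when the noise has distribution $Q$ and the regression function is $S$. $[x]$ denotes the integer part of $x$. **Noise classes.** Let $(\sigma^*_n)_{n\ge1}$ be positive constants with $0<\liminf_n\sigma^*_n\le\limsup_n\sigma^*_n<\infty$. Regard $Q$ as the law of a semimartingale $(\xi_t)_{t\ge0}$ for which the integrals $I_m(f)=\int_0^m f_s\,d\xi_s$, $f\in L_2[0,m]$, are well defined. $\mathcal{P}_n$ is the class of all such $Q$ with $\mathbf{E}_Q I_n(f)=0$ and $\mathbf{E}_Q I_n^2(f)\le\sigma^*_n\int_0^n f_s^2\,ds$ for all $f\in L_2[0,n]$. $Q_0$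 is the law of $\xi_t=\sqrt{\sigma^*_n}\,w_t$, with $w$ a standard Brownian motion. Let $(\phi_j)_{j\ge1}$ be the trigonometric basis: $\phi_1=1$ and, for $j\ge2$, $\phi_j(x)=\sqrt2\cos(2\pi[j/2]x)$ for $j$ even, $\phi_j(x)=\sqrt2\sin(2\pi[j/2]x)$ for $j$ odd. Put $\xi_{j,m}=m^{-1/2}I_m(\phi_j)$, $\sigma(Q)=\limsup_{m\to\infty}\max_{1\le j\le m}\mathbf{E}_Q\xi_{j,m}^2$, $\widetilde\xi_{j,n}=\xi_{j,n}^2-\mathbf{E}_Q\xi_{j,n}^2$, $$\mathbf{L}_{1,n}(Q)=\sup_{x\in[-1,1]^\infty,\ \#(x)\le n}\Big|\sum_{j\ge1}x_j\big(\mathbf{E}_Q\xi_{j,n}^2-\sigma(Q)\big)\Big|,\qquad \mathbf{L}_{2,n}(Q)=\sup_{|x|\le1,\ \#(x)\le n}\mathbf{E}_Q\Big(\sum_{j\ge1}x_j\widetilde\xi_{j,n}\Big)^2,$$ where $|x|^2=\sum_j x_j^2$ and $\#(x)$ is the number of nonzero coordinates of $x$. Let $(l_n)$ be a positive sequence with $l_n\to\infty$ increasing and $l_n/n^\delta\to0$ for every $\delta>0$. Put $\mathcal{P}^*_n=\{Q\in\mathcal{P}_n:\mathbf{L}_{1,n}(Q)+\mathbf{L}_{2,n}(Q)\le l_n\}$. **Robust risk.** $\mathcal{R}^*_n(\widetilde S,S)=\sup_{Q\in\mathcal{Q}^*_n}\mathbf{E}_{Q,S}\|\widetilde S-S\|^2$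 for an estimator $\widetilde S$. $\Pi_n$ is the set of all estimators $\widetilde S_n$ of $S$ measurable with respect to $\sigma\{y_t,\,0\le t\le n\}$. **Function class.** $W^k_r$ is the set of $k$ times continuously differentiable $f:[0,1]\to\mathbb{R}$ with $f^{(i)}(0)=f^{(i)}(1)$ for $0\le i\le k$ and $\sum_{j=0}^k\|f^{(j)}\|^2\le r$ (extended 1-periodically to $\mathbb{R}$). **Normalizing constant.** $$R^*_{k,n}=\big((2k+1)r\big)^{1/(2k+1)}\Big(\frac{\sigma^*_n k}{(k+1)\pi}\Big)^{2k/(2k+1)}.$$ *)

(* Defs.v *)
From HB Require Import structures.
From mathcomp Require Import all_boot all_order all_algebra.
From mathcomp Require Import all_classical all_reals all_analysis.
Set Implicit Arguments.
Unset Strict Implicit.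
Unset Printing Implicit Defensive.
Import Order.TTheory GRing.Theory Num.Theory.
Import numFieldNormedType.Exports.

Local Open Scope classical_set_scope.
Local Open Scope card_scope.
Local Open Scope ring_scope.

Definition cadlag (R : realType) (x : R -> R) : Prop :=
  (forall t, 0 <= t -> x s @[s --> t^'+] --> x t) /\
  (forall t, 0 < t -> cvg (x s @[s --> t^'-])).

(* The Skorohod space D[0, +oo[: a path indexed by [0, +oo[ is encoded as a
   function on R that vanishes on negative times. *)
Record skorohod (R : realType) := Skorohod {
  path_val :> R -> R ;
  path_cadlag : cadlag path_val ;
  path_neg : forall t, t < 0 -> path_val t = 0 }.

Lemma cadlag_zero (R : realType) : cadlag (fun _ : R => 0 : R).
Proof.
by split=> t _; [exact: cvg_cst | apply/cvg_ex; exists 0; exact: cvg_cst].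
Qed.

HB.instance Definition _ (R : realType) := gen_eqMixin (skorohod R).
HB.instance Definition _ (R : realType) := gen_choiceMixin (skorohod R).
HB.instance Definition _ (R : realType) :=
  isPointed.Build (skorohod R)
    (Skorohod (@cadlag_zero R) (fun (t : R) (_ : t < 0) => erefl 0)).

(* The coordinate maps generate the Borel sets of the Skorohod topology. *)
Definition skorohod_cylinders (R : realType) : set (set (skorohod R)) :=
  [set A | exists2 t : R, 0 <= t &
     exists2 B : set R, measurable B & A = (fun x : skorohod R => x t) @^-1` B].

Definition path_space (R : realType) := g_sigma_algebraType (@skorohod_cylinders R).

(* The type of noise distributions. *)
Definition noise_law (R : realType) := probability (path_space R) R.

Definition xi (R : realType) (t : R) (x : path_space R) : R := path_val x t.

Section semimartingales.
Context (d : measure_display) (T : measurableType d) (R : realType).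
Variables (P : probability T R).
Implicit Types (F : R -> set (set T)) (X M A : R -> T -> R).

Definition filtration F : Prop :=
  [/\ forall t, 0 <= t -> sigma_algebra setT (F t),
      forall t, 0 <= t -> F t `<=` measurable &
      forall s t, 0 <= s -> s <= t -> F s `<=` F t].

Definition adapted F X : Prop :=
  forall t, 0 <= t -> forall B : set R, measurable B -> F t (X t @^-1` B).

(* The last clause is E(M t | F s) = M s, unfolded. *)
Definition martingale F M : Prop :=
  [/\ adapted F M,
      forall t, 0 <= t -> P.-integrable setT (EFin \o M t) &
      forall s t, 0 <= s -> s <= t -> forall E, F s E ->
        (\int[P]_(w in E) (M t w)%:E = \int[P]_(w in E) (M s w)%:E)%E].

Definition stopping_time F (tau : T -> \bar R) : Prop :=
  (forall w, (0 <= tau w)%E) /\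
  (forall t, 0 <= t -> F t [set w | (tau w <= t%:E)%E]).

Definition stopped X (tau : T -> \bar R) : R -> T -> R :=
  fun t w => X (fine (mine t%:E (tau w))) w.

Definition local_martingale F M : Prop :=
  [/\ adapted F M,
      {ae P, forall w, cadlag (M ^~ w)} &
      exists tau : nat -> T -> \bar R,
        [/\ forall k, stopping_time F (tau k),
            {ae P, forall w, {homo tau ^~ w : i j / (i <= j)%N >-> (i <= j)%E} /\
                             tau k w @[k --> \oo] --> +oo%E} &
            forall k, martingale F (stopped M (tau k))]].

Definition finite_variation F A : Prop :=
  [/\ adapted F A,
      {ae P, forall w, cadlag (A ^~ w)} &
      {ae P, forall w, forall t, 0 <= t -> bounded_variation 0 t (A ^~ w)}].

(* Since X is adapted to F, it is then also a semimartingale for its own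
   filtration (Stricker), so being a semimartingale depends on the law of X
   only. *)
Definition semimartingale X : Prop :=
  exists F M A,
    [/\ filtration F, adapted F X, local_martingale F M, finite_variation F A &
        {ae P, forall w, [/\ cadlag (X ^~ w), M 0 w = 0, A 0 w = 0 &
           forall t, 0 <= t -> X t w = X 0 w + M t w + A t w]}].

Definition cvg_in_probability (Y : nat -> T -> R) (Z : T -> R) : Prop :=
  forall e, 0 < e ->
    P [set w | e <= `|Y k w - Z w|] @[k --> \oo] --> 0%E.

(* Standard Brownian motion, defined by its independent Gaussian increments;
   normal_prob takes the standard deviation as second parameter. *)
Definition standard_brownian (w : R -> T -> R) : Prop :=
  [/\ forall t, 0 <= t -> measurable_fun setT (w t),
      {ae P, forall o, w 0 o = 0 /\ {within `[0, +oo[, continuous (w ^~ o)}},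
      forall s t, 0 <= s -> s < t -> forall B : set R, measurable B ->
        P ((fun o => w t o - w s o) @^-1` B) = normal_prob 0 (Num.sqrt (t - s)) B &
      forall (p : nat) (t : nat -> R) (B : nat -> set R),
        0 <= t 0%N -> {homo t : i j / (i <= j)%N >-> i <= j} ->
        (forall i, measurable (B i)) ->
        P [set o | forall i, (i < p)%N -> B i (w (t i.+1) o - w (t i) o)] =
        (\prod_(i < p) P ((fun o => w (t i.+1) o - w (t i) o)%R @^-1` B i))%E].

End semimartingales.

Section noise.
Context {R : realType}.
Implicit Types (Q : noise_law R) (n m j : nat) (sigma l : nat -> R).
Local Notation mu := (@lebesgue_measure R).

Definition sqint (a : R) (f : R -> R) : \bar R :=
  (\int[mu]_(x in `[0%R, a]) ((f x) ^+ 2)%:E)%E.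

Definition L2 (a : R) : set (R -> R) :=
  [set f | measurable_fun `[0, a] f /\ (sqint a f < +oo)%E].

(* I is f |-> \int_(0, m] f d(xi) on L2[0, m] under Q: linear, equal to
   the increments of xi on indicators of intervals, and satisfying the dominated
   convergence theorem of stochastic integration.  By a monotone class argument
   these properties determine every I f up to a Q-null set; when xi is a
   semimartingale for which all f in L2[0, m] are integrable, the stochastic
   integral has them. *)
Definition is_stochastic_integral Q m (I : (R -> R) -> path_space R -> R) : Prop :=
  [/\ forall f, L2 m%:R f -> measurable_fun setT (I f),
      forall s t, 0 <= s -> s <= t -> t <= m%:R ->
        {ae Q, forall x, I (\1_(`]s, t])) x = xi t x - xi s x},
      forall a f g, L2 m%:R f -> L2 m%:R g ->
        {ae Q, forall x, I (fun u => a * f u + g u) x = a * I f x + I g x} &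
      forall (f : nat -> R -> R) (g h : R -> R),
        (forall k, L2 m%:R (f k)) -> L2 m%:R g -> L2 m%:R h ->
        (forall k u, 0 < u <= m%:R -> `|f k u| <= g u) ->
        (forall u, 0 < u <= m%:R -> f k u @[k --> \oo] --> h u) ->
        cvg_in_probability Q (fun k => I (f k)) (I h)].

Definition stochastic_integral Q m : (R -> R) -> path_space R -> R :=
  xget (fun _ _ => 0) [set I | is_stochastic_integral Q m I].

Definition admissible_semimartingale Q : Prop :=
  semimartingale Q (@xi R) /\
  forall m, (0 < m)%N -> exists I, is_stochastic_integral Q m I.

Definition noise_class sigma n : set (noise_law R) :=
  [set Q | admissible_semimartingale Q /\
     forall f, L2 n%:R f ->
       ('E_Q[stochastic_integral Q n f] = 0)%E /\
       ('E_Q[(fun x => (stochastic_integral Q n f x) ^+ 2)%R] <=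
          (sigma n)%:E * sqint n%:R f)%E].

(* The law of xi_t = sqrt s * w_t, with w a standard Brownian motion. *)
Definition brownian_law (s : R) : set (noise_law R) :=
  [set Q | exists w : R -> path_space R -> R, standard_brownian Q w /\
     forall t x, 0 <= t -> xi t x = Num.sqrt s * w t x].

(* Indexed by j >= 1; the value at j = 0 is not used. *)
Definition trig_basis j (x : R) : R :=
  if j == 1%N then 1
  else if odd j then Num.sqrt 2 * sin (2 * pi * (j./2)%:R * x)
  else Num.sqrt 2 * cos (2 * pi * (j./2)%:R * x).

Definition fourier_noise Q j m (x : path_space R) : R :=
  (Num.sqrt m%:R)^-1 * stochastic_integral Q m (trig_basis j) x.

Definition fourier_variance Q j m : \bar R :=
  ('E_Q[(fun x => (fourier_noise Q j m x) ^+ 2)%R])%E.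

Definition limit_variance Q : \bar R :=
  limn_esup (fun m => \big[maxe/-oo%E]_(1 <= j < m.+1) fourier_variance Q j m).

Definition fourier_noise_sq Q j n (x : path_space R) : R :=
  (fourier_noise Q j n x) ^+ 2 - fine (fourier_variance Q j n).

(* Sequences are indexed by j >= 1: the value u 0 is ignored. *)
Definition nz_coord (u : nat -> R) : set nat := [set j | (0 < j)%N /\ u j != 0].

Definition L1n Q n : \bar R :=
  ereal_sup [set (`| \sum_(j \in nz_coord u)
                       ((u j)%:E * (fourier_variance Q j n - limit_variance Q)) |)%E
            | u in [set u : nat -> R | (forall j, (0 < j)%N -> -1 <= u j <= 1) /\
                                       nz_coord u #<= `I_n]].

Definition L2n Q n : \bar R :=
  ereal_sup [set ('E_Q[(fun x => (\sum_(j \in nz_coord u)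
                                     (u j * fourier_noise_sq Q j n x)) ^+ 2)%R])%E
            | u in [set u : nat -> R | nz_coord u #<= `I_n /\
                                       \sum_(j \in nz_coord u) (u j) ^+ 2 <= 1]].

Definition noise_class_star sigma l n : set (noise_law R) :=
  [set Q | noise_class sigma n Q /\ (L1n Q n + L2n Q n <= (l n)%:E)%E].

End noise.

Section estimation.
Context {R : realType}.
Implicit Types (S : R -> R) (n k : nat).
Local Notation mu := (@lebesgue_measure R).

(* y_t = \int_0^t S(s) ds + xi_t *)
Definition observation S (x : path_space R) : R -> R :=
  fun t => (\int[mu]_(s in `[0, t]) S s) + xi t x.

Definition observation_cylinders n : set (set (R -> R)) :=
  [set A | exists2 t : R, 0 <= t <= n%:R &
     exists2 B : set R, measurable B & A = (fun y : R -> R => y t) @^-1` B].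

(* Estimators are functionals (y, x) |-> Shat(y)(x), jointly measurable for
   sigma{y_t, 0 <= t <= n} and the Borel sets of [0, 1]. *)
Definition estimators n : set ((R -> R) -> R -> R) :=
  [set Shat | @measurable_fun _ _
     (g_sigma_algebraType (observation_cylinders n) * measurableTypeR R)%type
     (measurableTypeR R) (setT `*` `[0, 1]) (fun p => Shat p.1 p.2)].

Definition risk (Q : noise_law R) (Shat : (R -> R) -> R -> R) S : \bar R :=
  (\int[Q]_x sqint 1 (fun u => Shat (observation S x) u - S u)%R)%E.

Definition robust_risk (Qs : set (noise_law R)) (Shat : (R -> R) -> R -> R) S
    : \bar R :=
  ereal_sup [set risk Q Shat S | Q in Qs].

(* f 0, ..., f k are the successive derivatives on [0, 1] (one-sided at the
   endpoints) of S. *)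
Definition sobolev_ball k (r : R) : set (R -> R) :=
  [set S | (forall x, S (x + 1) = S x) /\
     exists f : nat -> R -> R,
       [/\ forall x, x \in `[0, 1] -> f 0%N x = S x,
           forall i x, (i < k)%N -> x \in `[0, 1] ->
             (f i y - f i x) / (y - x) @[y --> within `[0, 1] x^'] --> f i.+1 x,
           forall i, (i <= k)%N -> {within `[0, 1], continuous (f i)},
           forall i, (i <= k)%N -> f i 0 = f i 1 &
           (\sum_(j < k.+1) sqint 1 (f j) <= r%:E)%E]].

Definition minimax_risk n (Qs : set (noise_law R)) (W : set (R -> R)) : \bar R :=
  ereal_inf [set ereal_sup [set robust_risk Qs Shat S | S in W]
            | Shat in estimators n].

Definition pinsker_constant k (r s : R) : R :=
  ((2 * k + 1)%:R * r) `^ ((2 * k + 1)%:R)^-1 *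
  (s * k%:R / ((k + 1)%:R * pi)) `^ ((2 * k)%:R / (2 * k + 1)%:R).

End estimation.

(* Main.v *)
(** The minimax risk is bounded below by the Bayes risk, under the Brownian law
    [Q0], of a prior on trigonometric polynomials that charges [sobolev_ball k r]
    up to a small probability.  The Fourier coefficients of a random signal are
    independent, that of frequency [m] being [h_m] times a sum of [L]
    Rademacher signs, which approximates a Gaussian of variance [s_m^2 = L h_m^2]
    while staying bounded.

    For a single coefficient, summation by parts on the hypercube plays the
    role of the van Trees inequality and gives the bound
    [e^(-4 tau / L) s^2 / (1 + tau)] with [tau = s^2 n / sigma].  The
    Cameron-Martin formula is only needed for finitely many observation times:
    a functional of the whole path is first approximated in [L^2] by one that
    depends on a finite grid of times, and the energy of the discretised shift
    is at most that of the continuous one.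

    With Pinsker's variances [s_m^2 = (1 - eta) (sigma / n) ((N / m)^k - 1)] the
    expected Sobolev energy is below [r], Chebyshev's inequality bounds the
    probability of leaving the ball by [O(1 / N)], and summing the
    one-dimensional bounds over [m <= N] gives Pinsker's constant as
    [N -> oo], then [L -> oo] and [eta -> 0]. *)
Require Import Defs.
From HB Require Import structures.
From mathcomp Require Import all_boot all_order all_algebra.
From mathcomp Require Import all_classical all_reals all_analysis.
From mathcomp Require Import ring lra.
Set Implicit Arguments.
Unset Strict Implicit.
Unset Printing Implicit Defensive.
Import Order.TTheory GRing.Theory Num.Theory.
Import numFieldNormedType.Exports.
Local Open Scope classical_set_scope.
Local Open Scope ring_scope.
Import measurable_realfun.

(** * One-dimensional Bayes risk with a hypercube prior *)

(** The prior is uniform on a finite set, so no measure on signals is ever built, and conditioning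
    on all coefficients but one is a rearrangement of a finite sum. It is also bounded, so
    coefficient estimates may be truncated to the range of the coefficient. Boundedness is what
    permits the approximation by finitely many observation times, and it keeps the loss outside the
    ball finite. The price is the factor [e^(-4 tau / L)]: one sign flip moves the amplitude by
    [2 h], and the ratio of the likelihoods of two such amplitudes has second moment [e^(4 h^2 v)],
    where [v = n / sigma] is the information, so that [4 h^2 v = 4 tau / L]. For this factor to be
    uniformly close to 1, [L] must be fixed before [N], while Pinsker's variances grow like
    [(N / m)^k] at low frequencies. The frequencies up to [N / q] are therefore left out, at the
    cost of a share of order [1 / q] of the bound. Outside the ball a trivial loss [O(N sigma / n)]
    meets a probability [O(1 / N)]; the product [O(sigma / n)] is negligible against the main term,
    of order [N sigma / n]. *)

Section hypercube.
Context {R : realType} {L : nat}.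
Implicit Types (w : {ffun 'I_L -> bool}) (i : 'I_L).

Definition walk w : R := \sum_i (-1) ^+ w i.

Definition flip i w : {ffun 'I_L -> bool} :=
  [ffun j => if j == i then ~~ w j else w j].

Lemma flipK i : involutive (flip i).
Proof.
by move=> w; apply/ffunP => j; rewrite !ffunE; case: eqP => // _; rewrite negbK.
Qed.

Lemma walk_flip i w : walk (flip i w) = walk w - 2 * (-1) ^+ w i.
Proof.
rewrite /walk (bigD1 i)//= [in RHS](bigD1 i)//= ffunE eqxx.
rewrite (eq_bigr (fun j => (-1) ^+ w j)); last first.
  by move=> j ji; rewrite ffunE (negbTE ji).
by case: (w i); rewrite /= ?expr0 ?expr1; ring.
Qed.

Lemma sum_sign_flip i (F : {ffun 'I_L -> bool} -> R) :
  \sum_(w : {ffun 'I_L -> bool}) (-1) ^+ w i * F (flip i w) =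
  - \sum_(w : {ffun 'I_L -> bool}) (-1) ^+ w i * F w.
Proof.
rewrite (reindex_inj (inv_inj (flipK i)))/= -sumrN; apply: eq_bigr => w _.
by rewrite flipK ffunE eqxx; case: (w i); rewrite /= ?expr0 ?expr1; ring.
Qed.

(* The discrete analogue of [E (X f X) = Var X * E (f' X)]: the law of [walk] is
   close to a centred Gaussian of variance [L]. *)
Lemma walk_stein (f : R -> R) :
  \sum_(w : {ffun 'I_L -> bool}) (walk w * f (walk w) + (L%:R + walk w) / 2 * f (walk w - 2)
          - (L%:R - walk w) / 2 * f (walk w + 2)) = 0.
Proof.
transitivity (\sum_(w : {ffun 'I_L -> bool}) \sum_i ((-1) ^+ w i * f (walk w) +
                             (-1) ^+ w i * f (walk (flip i w)))).
  apply: eq_bigr => w _; rewrite big_split/= -mulr_suml -/(walk w).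
  rewrite -[LHS]addrA; congr +%R.
  (* [(1 + (-1) ^+ w i) / 2] is the indicator of a plus sign. There are [(L + walk w) / 2] plus
     signs, and flipping one lowers the walk by 2. *)
  transitivity (\sum_i ((1 + (-1) ^+ w i) / 2 * f (walk w - 2)
                        - (1 - (-1) ^+ w i) / 2 * f (walk w + 2))).
    rewrite sumrB -!mulr_suml big_split/= sumrB -/(walk w).
    by rewrite sumr_const card_ord.
  apply: eq_bigr => i _; rewrite walk_flip; case: (w i) => /=.
    rewrite expr1 (_ : walk w - 2 * -1 = walk w + 2); last by ring.
    by field.
  by rewrite expr0 mulr1; field.
rewrite exchange_big/= big1// => i _; rewrite big_split/=.
by rewrite (sum_sign_flip i (f \o walk))/= subrr.
Qed.

Lemma card_cube : #|{ffun 'I_L -> bool}| = (2 ^ L)%N.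
Proof. by rewrite card_ffun card_bool card_ord. Qed.

Lemma sum_walk_sqr : \sum_(w : {ffun 'I_L -> bool}) walk w ^+ 2 = (2 ^ L)%:R * L%:R.
Proof.
have := walk_stein id; rewrite (eq_bigr (fun w => 2 * walk w ^+ 2 - 2 * L%:R)).
  rewrite sumrB -mulr_sumr sumr_const card_cube -[_ *+ (2 ^ L)]mulr_natl.
  by move=> /subr0_eq; rewrite mulrCA => /(mulfI _) ->//; rewrite pnatr_eq0.
by move=> w _; field.
Qed.

End hypercube.

Section discrete_bayes.
Context {R : realType} (L : nat) (h v : R).
Implicit Types (z u t x : R).

(** Likelihood ratio of amplitude [t] against amplitude 0 in a Gaussian experiment with Fisher
    information [v]; under amplitude 0 the score [z] is centred with variance [v]. *)
Definition gauss_lr t z : R := expR (t * z - t ^+ 2 * v / 2).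

Let Lam := gauss_lr.

(** The summand of [walk_stein] for [f x = Lam (h * x) z], which therefore sums to 0 over the cube.
    It plays the part of the derivative of the joint density in the van Trees inequality. *)
Let Psi x z : R := x * Lam (h * x) z + (L%:R + x) / 2 * Lam (h * (x - 2)) z
                   - (L%:R - x) / 2 * Lam (h * (x + 2)) z.

(** [gauss_lrM] for amplitudes [2 h] away from [h * x]: squares of neighbours produce [expR delta],
    the product of the two opposite neighbours [expR (- delta)]. *)
Let delta := 4 * h ^+ 2 * v.

Let gauss_lrM a b c z :
  Lam a z * Lam b z / Lam c z = expR (v * (a - c) * (b - c)) * Lam (a + b - c) z.
Proof. by rewrite /Lam /gauss_lr -expRN -!expRD; congr expR; field. Qed.

(* [2 t h x Psi - t^2 Psi^2 / Lam] as a linear combination [\sum q.1 * Lam q.2] of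
   likelihood ratios: these all have mean [1], so its mean is [\sum q.1]. *)
Definition bayes_terms t x : seq (R * R) := [::
  (2 * t * h * x * x, h * x);
  (2 * t * h * x * ((L%:R + x) / 2), h * (x - 2));
  (- (2 * t * h * x * ((L%:R - x) / 2)), h * (x + 2));
  (- (t ^+ 2 * x ^+ 2), h * x);
  (- (t ^+ 2 * ((L%:R + x) / 2) ^+ 2 * expR delta), h * (x - 4));
  (- (t ^+ 2 * ((L%:R - x) / 2) ^+ 2 * expR delta), h * (x + 4));
  (- (t ^+ 2 * x * (L%:R + x)), h * (x - 2));
  (t ^+ 2 * x * (L%:R - x), h * (x + 2));
  (t ^+ 2 * (L%:R + x) * (L%:R - x) / 2 * expR (- delta), h * x)].

Let bayes_termsE t x z : \sum_(q <- bayes_terms t x) q.1 * Lam q.2 z =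
  2 * t * (h * x) * Psi x z - t ^+ 2 * (Psi x z ^+ 2 / Lam (h * x) z).
Proof.
rewrite /bayes_terms !big_cons big_nil /= addr0.
pose a := Lam (h * x) z; pose b := Lam (h * (x - 2)) z.
pose c := Lam (h * (x + 2)) z.
have a0 : a != 0 by rewrite /a /Lam /gauss_lr gt_eqF ?expR_gt0.
have E1 : expR delta * Lam (h * (x - 4)) z = b * b / a.
  by rewrite /a /b gauss_lrM; congr (expR _ * Lam _ _); rewrite /delta; ring.
have E2 : expR delta * Lam (h * (x + 4)) z = c * c / a.
  by rewrite /a /c gauss_lrM; congr (expR _ * Lam _ _); rewrite /delta; ring.
have E3 : expR (- delta) * Lam (h * x) z = b * c / a.
  by rewrite /a /b /c gauss_lrM; congr (expR _ * Lam _ _); rewrite /delta; ring.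
rewrite !mulNr -!(mulrA _ (expR _)) E1 E2 E3 /Psi -/a -/b -/c.
by field.
Qed.

(** Completing the square: [a * (u - h * x + t * p / a) ^+ 2 >= 0], with [a] the likelihood ratio
    and [p] the value of [Psi]. The cross term in [u] sums to 0 because the estimate [u] does not
    depend on [w]. Optimising over the free multiplier [t] replaces the Cauchy-Schwarz
    inequality. *)
Lemma bayes_pointwise t u z :
  \sum_(w : {ffun 'I_L -> bool}) \sum_(q <- bayes_terms t (walk w)) q.1 * gauss_lr q.2 z
  <= \sum_(w : {ffun 'I_L -> bool}) (u - h * walk w) ^+ 2 * gauss_lr (h * walk w) z.
Proof.
have S0 : \sum_(w : {ffun 'I_L -> bool}) 2 * t * u * Psi (walk w) z = 0.
  by rewrite -mulr_sumr (@walk_stein R L (fun x => Lam (h * x) z)) mulr0.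
rewrite -[leRHS]addr0 -[X in _ <= _ + X]S0 -big_split/=.
apply: ler_sum => w _; rewrite bayes_termsE.
set x := walk w; set p := Psi x z; set a := Lam (h * x) z.
have a0 : 0 < a by rewrite /a /Lam /gauss_lr expR_gt0.
rewrite -subr_ge0 -/(Lam (h * x) z) -/a (_ : _ - _ = a * (u - h * x + t * p / a) ^+ 2).
  by rewrite mulr_ge0 ?sqr_ge0// ltW.
by field; rewrite gt_eqF.
Qed.

Lemma sum_bayes_terms t :
  \sum_(w : {ffun 'I_L -> bool}) \sum_(q <- bayes_terms t (walk w)) q.1 =
  (2 ^ L)%:R * (4 * t * h * L%:R - t ^+ 2 * (3 * L%:R +
    (expR delta * (L%:R ^+ 2 + L%:R) - expR (- delta) * (L%:R ^+ 2 - L%:R)) / 2)).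
Proof.
(* The odd powers of [walk w] cancel, so only the second moment of the walk is needed. *)
rewrite (eq_bigr (fun w : {ffun 'I_L -> bool} =>
   (4 * t * h - t ^+ 2 * (3 + (expR delta + expR (- delta)) / 2)) * walk w ^+ 2
   - t ^+ 2 * ((expR delta - expR (- delta)) / 2 * L%:R ^+ 2))).
  rewrite sumrB -mulr_sumr sum_walk_sqr sumr_const card_cube -[_ *+ (2 ^ L)]mulr_natl.
  by field.
by move=> w _; rewrite /bayes_terms !big_cons big_nil /=; field.
Qed.

(** The left-hand side is [3 L + L cosh delta + L^2 sinh delta], which for small [delta] is close to
    [4 L + L^2 delta = 4 L (1 + L h^2 v)], the sum of the information in the prior and in the data.
    The factor [expR delta] covers the difference. *)
Lemma bayes_information : 0 <= v ->
  3 * L%:R + (expR delta * (L%:R ^+ 2 + L%:R) - expR (- delta) * (L%:R ^+ 2 - L%:R)) / 2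
  <= 4 * L%:R * expR delta * (1 + L%:R * h ^+ 2 * v).
Proof.
move=> v0; have d0 : 0 <= delta by rewrite /delta; have := sqr_ge0 h; nra.
have e1 : 1 <= expR delta by rewrite -expR0 ler_expR.
have e2 : expR delta - expR (- delta) <= 2 * delta * expR delta.
  have := expR_ge1Dx (- (2 * delta)).
  have -> : expR (- delta) = expR (- (2 * delta)) * expR delta.
    by rewrite -expRD; congr expR; ring.
  by have := expR_gt0 delta; nra.
have l2 : 0 <= L%:R ^+ 2 - L%:R :> R.
  rewrite subr_ge0 -natrX ler_nat; case: (L) => // m.
  by rewrite -{1}(expn1 m.+1) leq_pexp2l.
have H : 4 * L%:R * (L%:R * h ^+ 2 * v) = L%:R ^+ 2 * delta by rewrite /delta; ring.
rewrite [leRHS](_ : _ = 4 * L%:R * expR delta + L%:R ^+ 2 * delta * expR delta); last first.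
  by rewrite -H; ring.
move: (delta) d0 e1 e2 => d d0 e1 e2.
have e3 : (L%:R ^+ 2 - L%:R) * (expR d - expR (- d)) <=
          (L%:R ^+ 2 - L%:R) * (2 * d * expR d) by exact: ler_wpM2l.
have e4 : 0 <= L%:R * d * expR d by rewrite !mulr_ge0 ?expR_ge0.
have e5 : L%:R * 1 <= L%:R * expR d by exact: ler_wpM2l.
nra.
Qed.

End discrete_bayes.

(** * Integrals of non-negative functions, and the Bayes bound in integrated form *)

Section integral_helpers.
Context d (T : measurableType d) (R : realType) (mu : {measure set T -> \bar R}).
Local Open Scope ereal_scope.

(** The integral of [g] may be infinite, so the Bayes bound needs no integrability of the squared
    error. *)
Lemma le_integral_ge0r (f g : T -> \bar R) :
  mu.-integrable setT f -> measurable_fun setT g -> (forall x, 0 <= g x) ->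
  (forall x, f x <= g x) -> \int[mu]_x f x <= \int[mu]_x g x.
Proof.
move=> intf mg g0 fg; have [goo|] := ltP (\int[mu]_x g x) +oo; last first.
  by rewrite leye_eq => /eqP ->; exact: leey.
apply: le_integral => //; apply/integrableP; split => //.
by under eq_integral do rewrite gee0_abs//.
Qed.

Import HBNNSimple.

(** [nu] is the image under [phi] of the measure with density [h]. Simple functions and monotone
    convergence carry the identity from sets to functions. With [h = 1] this is a change of
    variables, with [phi = id] integration against a density. *)
Lemma ge0_integral_density d' (T' : measurableType d')
    (nu : {measure set T' -> \bar R}) (phi : T -> T') (h : T -> R) :
  measurable_fun setT phi -> measurable_fun setT h -> (forall x, (0 <= h x)%R) ->
  (forall B, measurable B -> nu B = \int[mu]_(x in phi @^-1` B) (h x)%:E) ->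
  forall g : T' -> \bar R, measurable_fun setT g -> (forall y, 0 <= g y) ->
  \int[nu]_y g y = \int[mu]_x (g (phi x) * (h x)%:E).
Proof.
move=> mphi mh h0 nuE g mg g0.
pose g_ := nnsfun_approx measurableT mg.
have mgphi n : measurable_fun setT (fun x => (g_ n (phi x))%:E * (h x)%:E).
  apply: emeasurable_funM => //; apply/measurable_EFinP => //.
  exact: measurableT_comp.
have gcvg y : EFin \o g_ ^~ y @ \oo --> g y by exact: cvg_nnsfun_approx.
transitivity (limn (fun n => \int[nu]_y (g_ n y)%:E)).
  rewrite -monotone_convergence//=.
  - by apply: eq_integral => y _; apply/esym/cvg_lim => //; exact: gcvg.
  - by move=> n; exact/measurable_EFinP.
  - by move=> n y _; rewrite lee_fin.
  - by move=> y _ m n mn; rewrite lee_fin; exact/lefP/nd_nnsfun_approx.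
transitivity (limn (fun n => \int[mu]_x ((g_ n (phi x))%:E * (h x)%:E))); last first.
  rewrite -monotone_convergence//=.
  - apply: eq_integral => x _; apply/cvg_lim => //.
    exact: cvgeZr (gcvg (phi x)).
  - by move=> n x _; rewrite mule_ge0// lee_fin.
  - move=> x _ m n mn; rewrite lee_wpmul2r// lee_fin//; exact/lefP/nd_nnsfun_approx.
congr (limn _); apply/funext => n.
have mpre (r : R) : measurable (phi @^-1` (g_ n @^-1` [set r])).
  by rewrite -[X in measurable X]setTI; exact: mphi.
rewrite integralT_nnsfun sintegralE.
under [RHS]eq_integral => x _.
  rewrite fimfunE -fsumEFin// ge0_mule_fsuml; last first.
    move=> r; rewrite lee_fin; exact: nnfun_muleindic_ge0.
  over.
rewrite ge0_integral_fsum//=; last 2 first.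
  - move=> r; apply: emeasurable_funM; apply/measurable_EFinP => //.
    apply: measurable_funM => //.
    apply: (measurableT_comp (f := (\1_(g_ n @^-1` [set r]) : T' -> R)) _ mphi).
    exact: measurable_indic.
  - move=> r x _; apply: mule_ge0; last by rewrite lee_fin.
    by rewrite EFinM; exact: nnfun_muleindic_ge0.
apply: eq_fsbigr => r /set_mem [y _ <-].
rewrite nuE// integral_mkcond.
rewrite -ge0_integralZl//=; last 3 first.
  - apply/(measurable_restrictT _ _).1 => //.
    by apply/measurable_funTS/measurable_EFinP.
  - by move=> x _; rewrite erestrict_ge0// => x' _; rewrite lee_fin.
  - by rewrite lee_fin.
apply: eq_integral => x _; rewrite EFinM -muleA; congr (_ * _).
rewrite patchE indicE.
have -> : (phi x \in g_ n @^-1` [set g_ n y]) =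
          (x \in phi @^-1` (g_ n @^-1` [set g_ n y])).
  by apply/idP/idP => /set_mem H; apply/mem_set.
by case: ifP => _; rewrite ?mul1e ?mul0e.
Qed.

End integral_helpers.

Section bayes_bound.
Context d (T : measurableType d) (R : realType) (P : probability T R).
Variables (Z : T -> R) (v : R).
Hypothesis mZ : measurable_fun setT Z.
Hypothesis v0 : 0 <= v.
Hypothesis EZ : forall t, (\int[P]_x (gauss_lr v t (Z x))%:E = 1)%E.

Let m_lr t : measurable_fun setT (fun x => gauss_lr v t (Z x)).
Proof.
rewrite /gauss_lr; apply: (measurableT_comp (f := expR)) => //.
by apply: measurable_funB => //; apply: measurable_funM.
Qed.

Let int_lr t : P.-integrable setT (fun x => (gauss_lr v t (Z x))%:E).
Proof.
apply/integrableP; split; first exact/measurable_EFinP.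
under eq_integral do rewrite gee0_abs ?lee_fin ?expR_ge0//.
by rewrite EZ ltry.
Qed.

Lemma integral_lr_sum (I : Type) (s : seq I) (F : I -> seq (R * R)) :
  P.-integrable setT
    (fun x => (\sum_(i <- s) \sum_(q <- F i) q.1 * gauss_lr v q.2 (Z x))%:E) /\
  (\int[P]_x (\sum_(i <- s) \sum_(q <- F i) q.1 * gauss_lr v q.2 (Z x))%:E
   = (\sum_(i <- s) \sum_(q <- F i) q.1)%:E)%E.
Proof.
have int1 (q : R * R) : P.-integrable setT (fun x => (q.1 * gauss_lr v q.2 (Z x))%:E).
  by under eq_fun do rewrite EFinM; exact: integrableZl.
have int2 i : P.-integrable setT
    (fun x => (\sum_(q <- F i) q.1 * gauss_lr v q.2 (Z x))%:E).
  by under eq_fun do rewrite -sumEFin; exact: integrable_sum.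
split; first by under eq_fun do rewrite -sumEFin; exact: integrable_sum.
under eq_integral do rewrite -sumEFin.
rewrite integral_sum// -sumEFin; apply: eq_bigr => i _.
under eq_integral do rewrite -sumEFin.
rewrite integral_sum// -sumEFin; apply: eq_bigr => q _.
under eq_integral do rewrite EFinM.
by rewrite integralZl// EZ mule1.
Qed.

Lemma bayes_integral (L : nat) (h : R) (U : T -> R) : (0 < L)%N ->
  measurable_fun setT U ->
  (((2 ^ L)%:R * (h ^+ 2 * L%:R * expR (- (4 * h ^+ 2 * v))
                    / (1 + L%:R * h ^+ 2 * v)))%:E <=
   \sum_(w : {ffun 'I_L -> bool})
     \int[P]_x ((U x - h * walk w) ^+ 2 * gauss_lr v (h * walk w) (Z x))%:E)%E.
Proof.
move=> L0 mU.
have mF (w : {ffun 'I_L -> bool}) : measurable_fun setT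
   (fun x => ((U x - h * walk w) ^+ 2 * gauss_lr v (h * walk w) (Z x))%:E).
  apply/measurable_EFinP/measurable_funM => //.
  by apply: measurable_funX; apply: measurable_funB.
have F0 (w : {ffun 'I_L -> bool}) x :
   (0 <= ((U x - h * walk w) ^+ 2 * gauss_lr v (h * walk w) (Z x))%:E)%E.
  by rewrite lee_fin mulr_ge0 ?sqr_ge0 ?expR_ge0.
rewrite -ge0_integral_sum//=.
pose V := 4 * L%:R * expR (4 * h ^+ 2 * v) * (1 + L%:R * h ^+ 2 * v).
have A0 : 0 < 1 + L%:R * h ^+ 2 * v.
  by rewrite ltr_pwDl// mulr_ge0// mulr_ge0// sqr_ge0.
have V0 : 0 < V by rewrite /V !mulr_gt0// ?expR_gt0// ltr0n.
(* The maximiser of [4 * t * h * L%:R - t ^+ 2 * V]. *)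
pose t := 2 * h * L%:R / V.
have [iG EG] := integral_lr_sum (index_enum {ffun 'I_L -> bool})
  (fun w => bayes_terms L h v t (walk w)).
apply: (@le_trans _ _ (\int[P]_x (\sum_(w : {ffun 'I_L -> bool})
   \sum_(q <- bayes_terms L h v t (walk w)) q.1 * gauss_lr v q.2 (Z x))%:E)%E).
  rewrite EG lee_fin sum_bayes_terms ler_pM2l; last first.
    by rewrite ltr0n expn_gt0.
  have := bayes_information L h v0; rewrite -/V.
  set W := (3 * L%:R + _) => WV.
  have : t ^+ 2 * W <= t ^+ 2 * V by rewrite ler_wpM2l// sqr_ge0.
  suff -> : h ^+ 2 * L%:R * expR (- (4 * h ^+ 2 * v)) / (1 + L%:R * h ^+ 2 * v)
     = 4 * t * h * L%:R - t ^+ 2 * V by lra.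
  have L0' : 0 < L%:R :> R by rewrite ltr0n.
  rewrite /t expRN (_ : _ / (1 + _) = 4 * h ^+ 2 * L%:R ^+ 2 / V).
    by field; rewrite gt_eqF.
  by rewrite /V; field; rewrite !gt_eqF ?expR_gt0.
apply: le_integral_ge0r => //.
- by apply: emeasurable_sum.
- by move=> x; exact: sume_ge0.
- by move=> x; rewrite sumEFin lee_fin bayes_pointwise.
Qed.

End bayes_bound.

Definition mfun_of d d' (T : measurableType d) (T' : measurableType d')
    (f : T -> T') (mf : measurable_fun setT f) : {mfun T >-> T'} :=
  HB.pack f (isMeasurableFun.Build _ _ _ _ f mf).

(** * Expectation of a product of functions of independent variables *)

Section independence.
Context d (T : measurableType d) (R : realType) (P : probability T R).
Variables (p : nat) (X : nat -> T -> R).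
Hypothesis mX : forall i, measurable_fun setT (X i).
Hypothesis indepX : forall B : nat -> set R, (forall i, measurable (B i)) ->
  P [set x | forall i, (i < p)%N -> B i (X i x)] =
  (\prod_(i < p) P (X i @^-1` B i))%E.

Let measurable_prod_comp (f : nat -> R -> R) (Q : pred 'I_p) :
  (forall i, measurable_fun setT (f i)) ->
  measurable_fun setT (fun x => \prod_(i < p | Q i) f i (X i x)).
Proof.
move=> mf; under eq_fun do rewrite -big_filter.
apply: measurable_prod => i _.
exact: measurableT_comp.
Qed.

(** Independence is given on rectangles only; the factors are upgraded one at a time from indicators
    to arbitrary non-negative functions. *)
Lemma indep_integral (f : nat -> R -> R) (e : nat -> R) :
  (forall i, measurable_fun setT (f i)) -> (forall i x, 0 <= f i x) ->
  (forall i, (i < p)%N -> (\int[P]_x (f i (X i x))%:E = (e i)%:E)%E) ->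
  (\int[P]_x (\prod_(i < p) f i (X i x))%:E = (\prod_(i < p) e i)%:E)%E.
Proof.
have indic (B : set R) i : measurable B ->
    (\int[P]_x (\1_B (X i x))%:E = P (X i @^-1` B))%E.
  move=> mB; rewrite -[X in P X]setIT -integral_indic//.
  by rewrite -[X in measurable X]setTI; exact: mX.
(* Only the first [q] factors are arbitrary, the others being indicators: [q = 0] is the
   independence hypothesis, [q = p] the claim. *)
suff main q : forall (f : nat -> R -> R) (e : nat -> R),
  (forall i, measurable_fun setT (f i)) -> (forall i x, 0 <= f i x) ->
  (forall i, (i < p)%N -> (\int[P]_x (f i (X i x))%:E = (e i)%:E)%E) ->
  (forall i, (q <= i < p)%N -> exists2 B, measurable B & f i = \1_B) ->
  (\int[P]_x (\prod_(i < p) f i (X i x))%:E = (\prod_(i < p) e i)%:E)%E.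
  move=> mf f0 fe; apply: (main p) => // i /andP[pi ip].
  by move: (leq_ltn_trans pi ip); rewrite ltnn.
elim: q => [|q IH] {}f {}e mf f0 fe find.
  have {find} /boolp.choice[B BE] : forall i, exists B : set R,
      measurable B /\ ((i < p)%N -> f i = \1_B).
    move=> i; have [ip|_] := ltnP i p; last by exists setT.
    by have [B mB fB] := find i ip; exists B.
  have eB (i : 'I_p) : (e i)%:E = P (X i @^-1` B i).
    by rewrite -fe// (BE i).2// indic//; exact: (BE i).1.
  rewrite -prodEFin (eq_bigr (fun i : 'I_p => P (X i @^-1` B i)))//.
  rewrite -indepX; last by move=> i; exact: (BE i).1.
  set A := [set x | _].
  have mA : measurable A.
    rewrite (_ : A = \bigcap_(i < p) (X i @^-1` B i)).
      apply: bigcap_measurableType => // i _.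
      by rewrite -[X in measurable X]setTI; apply: mX => //; exact: (BE i).1.
    by apply/seteqP; split => x.
  rewrite -[X in P X]setIT -integral_indic//; apply: eq_integral => x _.
  congr EFin; rewrite indicE; case: (boolP (x \in A)) => [/set_mem Ax|/negP xA].
    rewrite big1// => i _; rewrite (BE i).2// indicE mem_set//.
    exact: (Ax i (ltn_ord i)).
  apply/eqP; rewrite prodf_seq_eq0; apply/hasP.
  have [i] : exists i : 'I_p, ~ B i (X i x).
    apply/existsNP => h; apply: xA; apply/mem_set => i ip.
    exact: (h (Ordinal ip)).
  move=> BX; exists i; first by rewrite mem_index_enum.
  by rewrite (BE i).2// indicE memNset//= eqxx.
have [qp|pq] := ltnP q p; last first.
  apply: IH => // i /andP[qi ip].
  by move: (leq_ltn_trans (leq_trans pq qi) ip); rewrite ltnn.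
pose oq := Ordinal qp.
pose H x := \prod_(i < p | i != oq) f i (X i x).
pose c := \prod_(i < p | i != oq) e i.
have e0 (i : 'I_p) : 0 <= e i.
  by rewrite -lee_fin -fe//; apply: integral_ge0 => x _; rewrite lee_fin.
have c0 : 0 <= c by apply: prodr_ge0.
have HB B : measurable B ->
    (c%:E * P (X q @^-1` B) = \int[P]_(x in X q @^-1` B) (H x)%:E)%E.
  move=> mB; pose f' i := if i == q then \1_B else f i.
  pose e' i := if i == q then fine (P (X q @^-1` B)) else e i.
  have Pfin : P (X q @^-1` B) \is a fin_num.
    by apply: fin_num_measure; rewrite -[X in measurable X]setTI; exact: mX.
  transitivity (\prod_(i < p) e' i)%:E.
    rewrite (bigD1 oq)//= {1}/e' eqxx EFinM fineK// muleC; congr (_ * _%:E)%E.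
    by apply: eq_bigr => i iq; rewrite /e' -[(i : nat) == q]/(i == oq) (negbTE iq).
  rewrite -(IH f' e').
  - rewrite [RHS]integral_mkcond; apply: eq_integral => x _.
    rewrite (bigD1 oq)//= {1}/f' eqxx patchE.
    have -> : \prod_(i < p | i != oq) f' i (X i x) = H x.
      by apply: eq_bigr => i iq; rewrite /f' -[(i : nat) == q]/(i == oq) (negbTE iq).
    rewrite indicE; have -> : (x \in X q @^-1` B) = (X q x \in B).
      by apply/idP/idP => /set_mem ?; apply/mem_set.
    by case: ifP; rewrite ?mul1r ?mul0r.
  - by move=> i; rewrite /f'; case: ifP => _; [exact: measurable_indic|].
  - by move=> i x; rewrite /f'; case: ifP => // _; rewrite indicE.
  - by move=> i ip; rewrite /f' /e'; case: eqP => [->|_]; [rewrite indic// fineK|exact: fe].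
  - move=> i /andP[qi ip]; rewrite /f'; case: eqP => [_|/eqP iq]; first by exists B.
    by apply: find; rewrite ltn_neqAle eq_sym iq qi.
(* By the induction hypothesis, with an indicator as factor [q], this measure is also the image
   under [X q] of the measure with density [H]. Integrating [f q] against it in both forms gives the
   step. *)
pose nu := mscale (NngNum c0) (distribution P (mfun_of (mX q))).
have nuE g : measurable_fun setT g -> (forall y, (0 <= g y)%E) ->
    (\int[nu]_y g y = \int[P]_x (g (X q x) * (H x)%:E))%E.
  move=> mg g0; apply: ge0_integral_density => //.
  - exact: measurable_prod_comp.
  - by move=> x; apply: prodr_ge0.
have := nuE (EFin \o f q).
rewrite /nu ge0_integral_mscale//=; last 2 first.
- exact/measurable_EFinP.
- by move=> x _; rewrite lee_fin.
rewrite ge0_integral_distribution//=; last 2 first.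
- exact/measurable_EFinP.
- by move=> x; rewrite lee_fin.
rewrite fe// => E.
rewrite (bigD1 oq)//= mulrC EFinM E; last 2 first.
- exact/measurable_EFinP.
- by move=> x; rewrite lee_fin.
by apply: eq_integral => x _; rewrite (bigD1 oq)//= EFinM.
Qed.

End independence.

(** * Translation of a normal law *)

Section normal_shift.
Context {R : realType}.
Local Notation mu := (@lebesgue_measure R).

Lemma lebesgue_measure_shift (c : R) (A : set R) : measurable A ->
  pushforward mu ((fun x => x + c) : _ -> measurableTypeR R) A = mu A.
Proof.
move=> mA; apply/esym/lebesgue_measure_unique => //=.
  exact: measurable_funD.
move=> _ _ [[a b]] _ <-.
rewrite /pushforward (_ : _ @^-1` _ = `]a - c, b - c]%classic); last first.
  by apply/seteqP; split => x /=; rewrite !in_itv/= ltrBlDr lerBrDr.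
rewrite !lebesgue_measure_itv/= !lte_fin ltrD2r; case: ifP => // _.
by rewrite -!EFinD; congr EFin; ring.
Qed.

Lemma ge0_integral_shift (c : R) (f : R -> \bar R) :
  measurable_fun setT f -> (forall x, (0 <= f x)%E) ->
  (\int[mu]_x f (x + c)%R = \int[mu]_x f x)%E.
Proof.
move=> mf f0.
have mc : measurable_fun setT (fun x : R => x + c) by exact: measurable_funD.
rewrite [RHS](@ge0_integral_density _ _ _ mu _ _ mu (fun x : R => x + c) (cst 1))//.
- by apply: eq_integral => x _; rewrite mule1.
- move=> B mB; rewrite [RHS](integral_cst mu _ 1%E)//; last by rewrite -[X in measurable X]setTI; exact: mc.
  by rewrite mul1e; apply/esym/lebesgue_measure_shift.
Qed.

Lemma normal_pdf_shift (a m x : R) : normal_pdf m a (x + m) = normal_pdf 0 a x \/ a = 0.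
Proof.
have [->|a0] := eqVneq a 0; first by right.
by left; rewrite !normal_pdfE// /normal_fun addrK subr0.
Qed.

(** The one-dimensional Cameron-Martin formula: the exponential is the ratio of the normal densities
    with means [m] and 0. *)
Lemma normal_prob_tilt (a m : R) (B : set R) : 0 < a -> measurable B ->
  (normal_prob 0 a [set u | B (u + m)%R] =
   \int[normal_prob 0 a]_u (\1_B u * expR (m * u / a ^+ 2 - m ^+ 2 / (2 * a ^+ 2)))%:E)%E.
Proof.
move=> a0 mB; have a0' : a != 0 by rewrite gt_eqF.
have mid : measurable_fun setT (@id R) by exact: measurable_id.
have mm : measurable_fun setT (fun x : R => x + m) by exact: measurable_funD.
rewrite (@ge0_integral_density _ _ _ mu _ _ (normal_prob 0 a) id (normal_pdf 0 a))//.
- transitivity (\int[mu]_x (\1_B (x + m) * normal_pdf m a (x + m))%:E)%E.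
    rewrite [LHS]integral_mkcond; apply: eq_integral => x _; rewrite patchE indicE.
    have -> : (x \in [set u | B (u + m)]) = (x + m \in B).
      by apply/idP/idP => /set_mem ?; apply/mem_set.
    case: ifP => _; last by rewrite mul0r.
    by rewrite mul1r; have [->|a0''] := normal_pdf_shift a m x; last by move: a0'; rewrite a0'' eqxx.
  rewrite (@ge0_integral_shift m (fun x => (\1_B x * normal_pdf m a x)%:E)).
  - apply: eq_integral => x _; rewrite -EFinM; congr EFin.
    rewrite -[RHS]mulrA; congr *%R.
    rewrite !normal_pdfE// mulrCA; congr *%R.
    by rewrite /normal_fun -expRD; congr expR; field.
  - apply/measurable_EFinP; apply: measurable_funM; first exact: measurable_indic.
    exact: measurable_normal_pdf.
  - by move=> x; rewrite lee_fin mulr_ge0 ?normal_pdf_ge0// indicE.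
- exact: measurable_normal_pdf.
- exact: normal_pdf_ge0.
- apply/measurable_EFinP; apply: measurable_funM; first exact: measurable_indic.
  apply: (measurableT_comp (f := expR)) => //; apply: measurable_funB => //.
  by apply: measurable_funM => //; apply: measurable_funM.
Qed.

End normal_shift.

(** * The Cameron-Martin formula on a finite grid of times *)

Section image_density.
Context d (T : measurableType d) (R : realType) (mu : {measure set T -> \bar R}).
Context d' (T' : measurableType d') (phi : T -> T') (h : T -> R).

(** The proofs are arguments of the definition so that the measure structure declared below can be
    inferred from the term alone. *)
Definition image_density of measurable_fun setT phi & measurable_fun setT h &
    (forall x, 0 <= h x) := fun A : set T' => (\int[mu]_(x in phi @^-1` A) (h x)%:E)%E.

Variables (mphi : measurable_fun setT phi) (mh : measurable_fun setT h)
  (h0 : forall x, 0 <= h x).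

Let nu := image_density mphi mh h0.

Let nu0 : nu set0 = 0%E.
Proof. by rewrite /nu /image_density preimage_set0 integral_set0. Qed.

Let nu_ge0 A : (0 <= nu A)%E.
Proof. by apply: integral_ge0 => x _; rewrite lee_fin. Qed.

Let nu_sigma_additive : semi_sigma_additive nu.
Proof.
move=> F mF tF mUF; rewrite /nu /image_density preimage_bigcup.
have mpre i : measurable (phi @^-1` F i).
  by rewrite -[X in measurable X]setTI; exact: mphi.
rewrite ge0_integral_bigcup//=.
- by apply: is_cvg_ereal_nneg_natsum_cond => i _ _; exact: nu_ge0.
- by apply/measurable_EFinP; exact: measurable_funTS.
- by move=> x _; rewrite lee_fin.
- apply/trivIsetP => i j _ _ ij; rewrite -preimage_setI.
  by move/trivIsetP : tF => /(_ _ _ Logic.I Logic.I ij) ->; rewrite preimage_set0.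
Qed.

HB.instance Definition _ := isMeasure.Build _ _ _
  (image_density mphi mh h0) nu0 nu_ge0 nu_sigma_additive.

End image_density.

Definition time_cylinders {R : realType} (D : set R) : set (set (R -> R)) :=
  [set A | exists2 t : R, D t &
     exists2 B : set R, measurable B & A = (fun y : R -> R => y t) @^-1` B].

Definition shifted_path {R : realType} (g : R -> R) (x : path_space R) : R -> R :=
  fun u => g u + xi u x.

Section grid.
Context {R : realType} (Q : noise_law R) (s : R) (w : R -> path_space R -> R).
Hypothesis s0 : 0 < s.
Hypothesis wB : standard_brownian Q w.
Hypothesis xiE : forall t x, 0 <= t -> xi t x = Num.sqrt s * w t x.
Variables (p : nat) (t : nat -> R) (Phi : R -> R).
Hypothesis t0 : t 0%N = 0.
Hypothesis tS : forall i, (i < p)%N -> t i < t i.+1.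
Hypothesis tH : {homo t : i j / (i <= j)%N >-> i <= j}.
Hypothesis Phi0 : Phi 0 = 0.

(** Rectangles in the increments rather than in the values, because the increments are independent.
    They form a pi-system generating the sigma-algebra of the grid. *)
Definition grid_rectangles : set (set (R -> R)) :=
  [set A | exists2 B0 : set R, measurable B0 & exists2 B : nat -> set R,
     forall i, measurable (B i) &
     A = [set y : R -> R | B0 (y (t 0%N)) /\
            forall i, (i < p)%N -> B i (y (t i.+1) - y (t i))]].

Let a i := Num.sqrt (t i.+1 - t i).
Let m i := (Phi (t i.+1) - Phi (t i)) / Num.sqrt s.
Let incr i x := w (t i.+1) x - w (t i) x.

(** The log-likelihood of the shift [theta * Phi] seen on the grid is [theta * grid_score - theta ^+
    2 * grid_energy / 2], see [lrE]; the score is linear in the data and the energy is its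
    variance. *)
Definition grid_score x := \sum_(i < p) m i / a i ^+ 2 * incr i x.

Definition grid_energy :=
  \sum_(i < p) (Phi (t i.+1) - Phi (t i)) ^+ 2 / (s * (t i.+1 - t i)).

Let t_ge0 i : 0 <= t i. Proof. by rewrite -t0 tH. Qed.

Let a_gt0 i : (i < p)%N -> 0 < a i.
Proof. by move=> ip; rewrite sqrtr_gt0 subr_gt0 tS. Qed.

Let sqa i : (i < p)%N -> a i ^+ 2 = t i.+1 - t i.
Proof. by move=> ip; rewrite sqr_sqrtr// subr_ge0 ltW// tS. Qed.

Let sqs0 : 0 < Num.sqrt s. Proof. by rewrite sqrtr_gt0. Qed.

Let m_incr i : measurable_fun setT (incr i).
Proof. by case: wB => mw _ _ _; apply: measurable_funB; exact: mw. Qed.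

Lemma measurable_grid_score : measurable_fun setT grid_score.
Proof. by apply: measurable_sum => i; exact: measurable_funM. Qed.

Let step theta i u := expR (theta * m i * u / a i ^+ 2 - (theta * m i) ^+ 2 / (2 * a i ^+ 2)).

Let lrE theta x :
  gauss_lr grid_energy theta (grid_score x) = \prod_(i < p) step theta i (incr i x).
Proof.
rewrite -expR_sum; congr expR; rewrite sumrB; congr (_ - _).
  by rewrite mulr_sumr; apply: eq_bigr => i _; field; rewrite gt_eqF ?a_gt0.
rewrite mulr_sumr mulr_suml; apply: eq_bigr => i _.
have := sqa (ltn_ord i); have := a_gt0 (ltn_ord i).
rewrite /m; have := sqr_sqrtr (ltW s0); have := sqs0.
move: (Num.sqrt s) (a i) => rs ai rs0 <- ai0 <-.
by field; rewrite !gt_eqF.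
Qed.

Let m_step theta i : measurable_fun setT (step theta i).
Proof.
apply: (measurableT_comp (f := expR)) => //; apply: measurable_funB => //.
by apply: measurable_funM => //; apply: measurable_funM.
Qed.

(** On a rectangle both sides factor over the increments, and each factor is an instance of
    [normal_prob_tilt]. *)
Lemma rectangle_tilt (theta : R) A : grid_rectangles A ->
  (Q [set x | A (shifted_path (fun u => theta * Phi u)%R x)] =
   \int[Q]_(x in [set x | A (fun u => xi u x)]) (gauss_lr grid_energy theta (grid_score x))%:E)%E.
Proof.
case: wB => mw w0 wN wI.
move=> [B0 mB0 [B mB ->]].
pose C i := [set u : R | B i (Num.sqrt s * u)].
have mC i : measurable (C i).
  rewrite -[C i]setTI; apply: (measurable_funM (f := cst (Num.sqrt s)) (g := id)) => //.
pose C' i := [set u : R | C i (u + theta * m i)].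
have mC' i : measurable (C' i).
  rewrite -[C' i]setTI; apply: (measurable_funD (f := id) (g := cst (theta * m i))) => //.
pose f i u : R := \1_(C i) u * step theta i u.
pose e i : R := fine (Q (incr i @^-1` C' i)).
have mf i : measurable_fun setT (f i) by apply: measurable_funM => //; exact: measurable_indic.
have f0 i u : 0 <= f i u by rewrite mulr_ge0 ?expR_ge0// indicE.
have mpre i (D : set R) : measurable D -> measurable (incr i @^-1` D).
  by move=> mD; rewrite -[X in measurable X]setTI; exact: m_incr.
have Efin i D : measurable D -> (fine (Q (incr i @^-1` D)))%:E = Q (incr i @^-1` D).
  by move=> mD; rewrite fineK// fin_num_measure//; exact: mpre.
have fe i : (i < p)%N -> (\int[Q]_x (f i (incr i x))%:E = (e i)%:E)%E.
  move=> ip; have tt : t i < t i.+1 := tS ip.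
  rewrite /e Efin// wN//.
  rewrite (normal_prob_tilt (theta * m i) (a_gt0 ip))//.
  have mi : measurable_fun setT (incr i : path_space R -> measurableTypeR R) := m_incr i.
  transitivity (\int[distribution Q (mfun_of mi)]_u (f i u)%:E)%E; last first.
    by apply: eq_measure_integral => D mD _; exact: (wN _ _ (t_ge0 i) tt D mD).
  rewrite ge0_integral_distribution//=.
  - by apply/measurable_EFinP; have := mf i.
  - by move=> y; rewrite lee_fin f0.
have indepI D : (forall i, measurable (D i)) ->
    Q [set x | forall i, (i < p)%N -> D i (incr i x)] =
    (\prod_(i < p) Q (incr i @^-1` D i))%E.
  by move=> mD; apply: (wI p t D) => //; rewrite t0.
have key := indep_integral m_incr indepI mf f0 fe.
have mxi u : 0 <= u -> measurable_fun setT (xi u : path_space R -> R).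
  move=> u0; rewrite (_ : xi u = fun x => Num.sqrt s * w u x); last first.
    by apply/funext => x; rewrite xiE.
  by apply: measurable_funM => //; exact: mw.
have incE theta' i x : (theta' * Phi (t i.+1) + xi (t i.+1) x) - (theta' * Phi (t i) + xi (t i) x)
   = Num.sqrt s * (incr i x + theta' * m i).
  by rewrite !xiE// /incr /m; field; rewrite gt_eqF.
pose G : set (path_space R) := [set x | forall i, (i < p)%N -> C' i (incr i x)].
have mG : measurable G.
  rewrite (_ : G = \bigcap_(i < p) (incr i @^-1` C' i)).
    by apply: bigcap_measurableType => i _; exact: mpre.
  by apply/seteqP; split => x.
have B00 : 0 <= \1_B0 (0 : R) :> R by rewrite indicE.
have mf_prod : measurable_fun setT (fun x => \prod_(i < p) f i (incr i x)).
  by apply: measurable_prod => i _; exact: measurableT_comp.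
have m_pre (g : R -> R) u (D : set R) : 0 <= u -> measurable D ->
    measurable [set x | D (shifted_path g x u)].
  move=> u0 mD; rewrite -[X in measurable X]setTI.
  by apply: (measurable_funD (f := cst (g u)) (g := xi u)) => //; exact: mxi.
have m_rect g : measurable [set x | B0 (shifted_path g x (t 0%N)) /\
    forall i, (i < p)%N -> B i (shifted_path g x (t i.+1) - shifted_path g x (t i))].
  apply: measurableI; first exact: m_pre.
  rewrite [X in measurable X](_ : _ = \bigcap_(i < p)
    [set x | B i (shifted_path g x (t i.+1) - shifted_path g x (t i))]); last first.
    by apply/seteqP; split => x.
  apply: bigcap_measurableType => i _; rewrite -[X in measurable X]setTI.
  by apply: measurable_funB => //; apply: measurable_funD => //; exact: mxi.
(* The path starts at 0 almost surely and [Phi 0 = 0], so the constraint [B0] is deterministic and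
   leaves a constant factor. *)
transitivity (\int[Q]_x (\1_B0 (0 : R) * \1_G x)%:E)%E.
  set S := (X in Q X); have mS : measurable S := m_rect _.
  rewrite -[X in Q X]setIT -integral_indic//.
  apply: ge0_ae_eq_integral => //.
  - by apply/measurable_EFinP; exact: measurable_indic.
  - by apply/measurable_EFinP; apply: measurable_funM => //; exact: measurable_indic.
  apply: filterS w0 => x [wx0 _] _; congr EFin.
  have SE : S x <-> B0 0 /\ G x.
    rewrite /S /shifted_path /= t0 Phi0 mulr0 add0r xiE// wx0 mulr0.
    by split=> -[? BE]; split=> // i ip; have := BE i ip; rewrite /C' /C /= incE.
  rewrite !indicE; case: (boolP (x \in S)) => [/set_mem/SE[b g]|/negP xS].
    by rewrite !mem_set// mulr1.
  have [b|b] := boolP (0 \in B0); last by rewrite mul0r.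
  have [g|g] := boolP (x \in G); last by rewrite mulr0.
  by exfalso; apply: xS; apply/mem_set/SE; split; exact/set_mem.
transitivity (\int[Q]_x (\1_B0 (0 : R) * \prod_(i < p) f i (incr i x))%:E)%E.
  under eq_integral do rewrite EFinM; under [RHS]eq_integral do rewrite EFinM.
  rewrite !ge0_integralZl_EFin//=; first last.
  - by apply/measurable_EFinP; exact: measurable_indic.
  - exact/measurable_EFinP.
  - by move=> x _; rewrite lee_fin prodr_ge0.
  congr (_ * _)%E; rewrite key integral_indic// setIT.
  rewrite [LHS](indepI C' mC') -prodEFin.
  by apply: eq_bigr => i _; rewrite /e Efin.
rewrite [RHS]integral_mkcond; apply: ge0_ae_eq_integral => //.
- by apply/measurable_EFinP; exact: measurable_funM.
- apply/(measurable_restrictT _ _).1.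
    have := m_rect (cst 0); congr measurable; apply/seteqP; split => x /=;
      by rewrite /shifted_path /= !add0r => -[? h]; split => // i /h; rewrite !add0r.
  apply/measurable_EFinP/measurable_funTS; under eq_fun do rewrite lrE.
  by apply: measurable_prod => i _; exact: measurableT_comp.
- by move=> x _; rewrite lee_fin mulr_ge0// prodr_ge0.
- by move=> x _; apply: erestrict_ge0 => y _; rewrite lee_fin expR_ge0.
apply: filterS w0 => x [wx0 _] _; rewrite patchE.
set S := [set x | _]; have SE : S x <-> B0 0 /\ forall i, (i < p)%N -> C i (incr i x).
  rewrite /S /= t0 xiE// wx0 mulr0.
  have E i : xi (t i.+1) x - xi (t i) x = Num.sqrt s * incr i x.
    by rewrite !xiE// /incr mulrBr.
  by split=> -[? BE]; split=> // i ip; have := BE i ip; rewrite /C /= E.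
case: (boolP (x \in S)) => [/set_mem/SE[b c]|/negP xS]; last first.
  congr EFin; have [b|b] := boolP (0 \in B0); last by rewrite indicE (negbTE b) mul0r.
  rewrite [X in _ * X](_ : _ = 0) ?mulr0//.
  have [i] : exists i : 'I_p, ~ C i (incr i x).
    apply/existsNP => h; apply: xS; apply/mem_set/SE; split; first exact/set_mem.
    by move=> i ip; exact: (h (Ordinal ip)).
  move=> nC; apply/eqP; rewrite prodf_seq_eq0; apply/hasP; exists i.
    by rewrite mem_index_enum.
  by rewrite /f indicE memNset//= mul0r.
rewrite lrE indicE mem_set// mul1r; congr EFin; apply: eq_bigr => i _.
by rewrite /f indicE mem_set ?mul1r//; exact: c.
Qed.

Definition grid_times : set R := [set u | exists2 i, (i <= p)%N & u = t i].

Local Notation gridType := (g_sigma_algebraType (time_cylinders grid_times)).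

Let measurable_coord i : (i <= p)%N ->
  measurable_fun setT (fun y : gridType => y (t i)).
Proof.
move=> ip _ B mB; rewrite setTI; apply: sub_sigma_algebra.
by exists (t i); [exists i|exists B].
Qed.

Let measurable_grid_rectangles : grid_rectangles `<=` <<s time_cylinders grid_times >>.
Proof.
move=> _ [B0 mB0 [B mB ->]].
have coordB i : (i < p)%N -> measurable [set y : gridType | B i (y (t i.+1) - y (t i))].
  move=> ip; rewrite -[X in measurable X]setTI.
  by apply: (measurable_funB (measurable_coord ip) (measurable_coord (ltnW ip))).
have -> : [set y : R -> R | B0 (y (t 0%N)) /\
            forall i, (i < p)%N -> B i (y (t i.+1) - y (t i))] =
  [set y : gridType | B0 (y (t 0%N))] `&`
    \bigcap_(i < p) [set y : gridType | B i (y (t i.+1) - y (t i))].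
  by apply/seteqP; split => y.
apply: (@measurableI _ gridType).
  by rewrite -[X in measurable X]setTI; exact: measurable_coord.
by apply: bigcap_measurableType => i ip; exact: coordB.
Qed.

(** A value on the grid is the initial value plus a sum of increments. *)
Let grid_rectangles_generate :
  <<s time_cylinders grid_times >> = <<s grid_rectangles >>.
Proof.
apply/seteqP; split; apply: smallest_sub; try exact: smallest_sigma_algebra.
  pose rectType := g_sigma_algebraType grid_rectangles.
  have coord i : (i <= p)%N -> measurable_fun setT (fun y : rectType => y (t i)).
    elim: i => [_ _ B mB|i IH ip].
      rewrite setTI; apply: sub_sigma_algebra; exists B => //; exists (fun=> setT) => //.
      by apply/seteqP; split => y //= [].
    rewrite (_ : (fun y : rectType => y (t i.+1)) =
      (fun y : rectType => y (t i) + (y (t i.+1) - y (t i)))); last first.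
      by apply/funext => y; rewrite addrC subrK.
    apply: measurable_funD; first exact: IH (ltnW ip).
    move=> _ B mB; rewrite setTI; apply: sub_sigma_algebra.
    exists setT => //; exists (fun j => if j == i then B else setT) => [j|].
      by case: ifP.
    apply/seteqP; split => y /=.
      by move=> By; split=> // k _; case: eqP => [->|].
    by move=> [_ /(_ i ip)]; rewrite eqxx.
  move=> _ [_ [i ip ->] [B mB ->]]; rewrite -[X in _ X]setTI.
  exact: (coord i ip measurableT B mB).
exact: measurable_grid_rectangles.
Qed.

Let grid_rectanglesI : setI_closed grid_rectangles.
Proof.
move=> _ _ [B0 mB0 [B mB ->]] [C0 mC0 [C mC ->]].
exists (B0 `&` C0); first exact: measurableI.
exists (fun i => B i `&` C i) => [i|]; first exact: measurableI.
apply/seteqP; split => y /=.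
  by move=> [[b bi] [c ci]]; split => // j jp; split; [exact: bi|exact: ci].
by move=> [[b c] bc]; split; split => // j /bc[].
Qed.

Lemma measurable_shifted_path (D : set R) (g : R -> R) :
  (forall u, D u -> 0 <= u) ->
  measurable_fun setT
    (shifted_path g : path_space R -> g_sigma_algebraType (time_cylinders D)).
Proof.
move=> D0; apply: (@measurability _ _ (path_space R) (g_sigma_algebraType (time_cylinders D)) setT
  (shifted_path g) (time_cylinders D) erefl).
move=> _ [_ [u Du [B mB ->]] <-]; rewrite setTI.
rewrite -[X in measurable X]setTI.
apply: (measurable_funD (f := cst (g u)) (g := xi u)) => //.
move=> _ C mC; rewrite setTI; apply: sub_sigma_algebra.
by exists u; [exact: D0|exists C].
Qed.

(** [rectangle_tilt] identifies two finite measures on a generating pi-system, hence everywhere;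
    [ge0_integral_density] then passes to functions. *)
Lemma grid_cameron_martin (theta : R) (g : (R -> R) -> \bar R) :
  measurable_fun setT (g : gridType -> \bar R) -> (forall y, (0 <= g y)%E) ->
  (\int[Q]_x g (shifted_path (fun u => theta * Phi u)%R x) =
   \int[Q]_x (g (fun u => xi u x) *
              (gauss_lr grid_energy theta (grid_score x))%:E))%E.
Proof.
move=> mg g0.
have D0 u : grid_times u -> 0 <= u by move=> [i _ ->].
have mphi := measurable_shifted_path (fun u => theta * Phi u) D0.
have mxi : measurable_fun setT (fun x : path_space R => (fun u => xi u x) : gridType).
  have := measurable_shifted_path (fun=> 0) D0; congr measurable_fun.
  by apply/funext => x; apply/funext => u; rewrite /shifted_path add0r.
have mlr : measurable_fun setT (fun x => gauss_lr grid_energy theta (grid_score x)).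
  under eq_fun do rewrite lrE.
  by apply: measurable_prod => i _; exact: measurableT_comp.
have lr0 x : 0 <= gauss_lr grid_energy theta (grid_score x) by exact: expR_ge0.
pose m1 := distribution Q (mfun_of mphi).
pose m2 := image_density Q mxi mlr lr0.
have m12 A : measurable A -> m1 A = m2 A.
  have gT : grid_rectangles setT.
    exists setT => //; exists (fun=> setT) => //.
    by apply/seteqP; split.
  move=> mA; apply: (@measure_unique _ R gridType grid_rectangles (fun=> setT)
    grid_rectangles_generate grid_rectanglesI (fun=> gT) _ m1 m2) => //.
  - by rewrite bigcup_const//; exists 0%N.
  - by move=> B /(rectangle_tilt theta) E; exact: E.
  - by move=> _; rewrite [X in (X < _)%E](@probability_setT _ gridType R m1) ltry.
have <- : (\int[m1]_y g y = \int[Q]_x g (shifted_path (fun u => theta * Phi u)%R x))%E.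
  by rewrite ge0_integral_distribution.
exact: (@ge0_integral_density _ _ _ Q _ _ m1 _ _ mxi mlr lr0 m12 g mg g0).
Qed.

End grid.

(** * Approximation by functionals of finitely many observations *)

Section approximation.
Context {R : realType} (D : set R) (I : finType).
Local Notation obsType := (g_sigma_algebraType (time_cylinders D)).
Variable P : I -> probability obsType R.

Definition sampled (s : seq R) : set (set (R -> R)) := <<s time_cylinders [set` s] >>.

Lemma sampled_sub (s s' : seq R) : {subset s <= s'} -> sampled s `<=` sampled s'.
Proof.
move=> ss; apply: smallest_sub; first exact: smallest_sigma_algebra.
by move=> _ [t ts [B mB ->]]; apply: sub_sigma_algebra; exists t; [exact: ss|exists B].
Qed.

Lemma sampled_measurable (s : seq R) : (forall u, u \in s -> D u) ->
  sampled s `<=` (@measurable _ obsType).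
Proof.
move=> sD; apply: smallest_sub; first exact: smallest_sigma_algebra.
by move=> _ [t ts [B mB ->]]; apply: sub_sigma_algebra; exists t; [exact: sD|exists B].
Qed.

(** One finite sample and one set [A'] must serve all the laws [P i] at once: what approximates an
    estimator may not depend on the unknown parameter. *)
Definition sample_approx (A : set (R -> R)) : Prop :=
  measurable (A : set obsType) /\
  forall e : R, 0 < e -> exists2 s : seq R, (forall u, u \in s -> D u) &
    exists2 A', sampled s A' & forall i, (P i (A `+` A') < e%:E)%E.

Let mY (A B : set obsType) : measurable A -> measurable B -> measurable (A `+` B).
Proof. by move=> mA mB; apply: measurableU; exact: measurableD. Qed.

Let sample_approxU A B : sample_approx A -> sample_approx B -> sample_approx (A `|` B).
Proof.
move=> [mA hA] [mB hB]; split; first exact: (@measurableU _ obsType).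
move=> e e0; have e20 : 0 < e / 2 by rewrite divr_gt0.
have [s sD [A' sA' AA']] := hA _ e20; have [s' sD' [B' sB' BB']] := hB _ e20.
have sDD u : u \in s ++ s' -> D u by rewrite mem_cat => /orP[/sD|/sD'].
have hA' : sampled (s ++ s') A'.
  by apply: sampled_sub sA' => u us; rewrite mem_cat us.
have hB' : sampled (s ++ s') B'.
  by apply: sampled_sub sB' => u us; rewrite mem_cat us orbT.
have mA' := sampled_measurable sDD hA'; have mB' := sampled_measurable sDD hB'.
exists (s ++ s') => //; exists (A' `|` B') => [|i].
  exact: (@measurableU _ (g_sigma_algebraType (time_cylinders [set` s ++ s']))).
apply: (@le_lt_trans _ _ (P i (A `+` A') + P i (B `+` B'))%E).
  apply: le_trans; last by apply: measureU2; exact: mY.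
  apply: le_measure; rewrite ?inE.
  - by apply: mY; exact: (@measurableU _ obsType).
  - by apply: (@measurableU _ obsType); exact: mY.
  - move=> y [[[Ay|By] /not_orP[nA nB]]|[[Ay|By] /not_orP[nA nB]]].
    + by left; left.
    + by right; left.
    + by left; right.
    + by right; right.
rewrite [e]splitr EFinD; exact: lteD (AA' i) (BB' i).
Qed.

Let sample_approx0 : sample_approx set0.
Proof.
split; first exact: (@measurable0 _ obsType).
move=> e e0; exists [::] => //; exists set0; first exact: sigma_algebra0.
by move=> i; rewrite setY0 measure0 lte_fin.
Qed.

(** The approximable sets form a sigma-algebra that contains the cylinders. *)
Lemma measurable_sample_approx (A : set obsType) : measurable A -> sample_approx A.
Proof.
move: A; apply: smallest_sub.
  split.
  - exact: sample_approx0.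
  - move=> A [mA hA]; split; first exact: (@measurableD _ obsType).
    move=> e e0; have [s sD [A' sA' AA']] := hA _ e0.
    exists s => //; exists (~` A') => [|i].
      rewrite -setTD; exact: sigma_algebraCD.
    rewrite (_ : _ `+` _ = A `+` A')//; rewrite setTD.
    apply/seteqP; split => y.
      by move=> [[nA /contrapT A'y]|[nA' /contrapT Ay]]; [right|left].
    by move=> [[Ay nA'y]|[A'y nAy]]; [right; split => // h|left; split => // h].
  - move=> F hF.
    have mF i : measurable (F i : set obsType) := (hF i).1.
    have mbF : measurable (\bigcup_i F i : set obsType) by exact: (@bigcupT_measurable _ obsType).
    split => // e e0; have e20 : 0 < e / 2 by rewrite divr_gt0.
    (* What is lost when the union is cut after [N] terms; it decreases to the empty set. *)
    pose G N := \bigcup_i F i `\` \big[setU/set0]_(i < N) F i.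
    have mG N : measurable (G N : set obsType).
      apply: (@measurableD _ obsType) => //.
      by apply: (@bigsetU_measurable _ obsType) => i _.
    have G0 : \bigcap_N G N = set0.
      apply/seteqP; split => y //= Gy.
      have [[i _ Fiy] _] := Gy 0%N Logic.I.
      have [_] := Gy i.+1 Logic.I; apply.
      by rewrite big_ord_recr/=; right.
    have cvgG i : P i (G N) @[N --> \oo] --> 0%E.
      rewrite -(measure0 (P i)) -G0; apply: nonincreasing_cvg_mu => //.
      - by apply: le_lt_trans (ltry 1); exact: probability_le1.
      - by rewrite G0; exact: (@measurable0 _ obsType).
      - move=> m n mn; apply/subsetPset => y [Fy nFy]; split => // h; apply: nFy.
        by apply: subset_bigsetU h.
    (* A common [N] exists because there are finitely many laws. *)
    have : \forall N \near \oo, forall i, (P i (G N) < (e / 2)%:E)%E.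
      apply: filter_forall => i; have /fine_cvgP[fG cG] := cvgG i.
      have fG2 : \forall N \near \oo, fine (P i (G N)) < e / 2.
        by apply: (cvgr_lt 0 cG).
      by apply: filterS2 fG fG2 => N fin; rewrite -lte_fin fineK.
    move=> [N _ /(_ _ (leqnn N)) GN].
    have : sample_approx (\big[setU/set0]_(i < N) F i).
      by elim/big_rec : _ => [|i A _ hA]; [exact: sample_approx0|exact: sample_approxU].
    move=> [mU /(_ _ e20)[s sD [A' sA' UA']]].
    exists s => //; exists A' => // i; have mA' := sampled_measurable sD sA'.
    apply: (@le_lt_trans _ _ (P i (G N) + P i (\big[setU/set0]_(i < N) F i `+` A'))%E).
      apply: le_trans; last by apply: measureU2 => //; exact: mY.
      apply: le_measure; rewrite ?inE.
      + exact: mY.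
      + by apply: (@measurableU _ obsType) => //; exact: mY.
      + move=> y [[Fy nA]|[A'y nF]].
          have [Uy|nUy] := pselect ((\big[setU/set0]_(i < N) F i) y).
            by right; left.
          by left.
        right; right; split => // h; apply: nF.
        by have := @bigsetU_bigcup _ F N; apply.
    by rewrite [e]splitr EFinD; exact: lteD (GN i) (UA' i).
move=> _ [t Dt [B mB ->]]; split; first by apply: sub_sigma_algebra; exists t => //; exists B.
move=> e e0; exists [:: t] => [u|]; first by rewrite inE => /eqP ->.
exists ((fun y : R -> R => y t) @^-1` B) => [|i].
  by apply: sub_sigma_algebra; exists t; [rewrite /= inE|exists B].
by rewrite setYK measure0 lte_fin.
Qed.

End approximation.

(** Rounding down to a multiple of [eta], written as a sum over superlevels: approximating a bounded
    function reduces to approximating [K] sets. *)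
Lemma layer_approx (R : realType) (K : nat) (eta x : R) : 0 < eta ->
  0 <= x <= K%:R * eta ->
  0 <= x - eta * \sum_(k < K) (k.+1%:R * eta <= x)%R%:R <= eta.
Proof.
move=> eta0; elim: K => [|K IH] /andP[x0 xK].
  by rewrite big_ord0 mulr0 subr0 x0 (le_trans xK)// mul0r ltW.
rewrite big_ord_recr/=; have [xK'|xK'] := lerP x (K%:R * eta).
  rewrite (_ : (K.+1%:R * eta <= x) = false) ?addr0; first by apply: IH; rewrite x0.
  apply/negbTE; rewrite -ltNge (le_lt_trans xK')// ltr_pM2r//.
  by rewrite ltr_nat.
rewrite (eq_bigr (fun=> 1)); last first.
  move=> k _; rewrite (_ : (_ <= x) = true)//; rewrite (le_trans _ (ltW xK'))//.
  by rewrite ler_pM2r// ler_nat.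
rewrite sumr_const card_ord.
move: xK xK'; rewrite -(natr1 K) => xK xK'.
case: (lerP ((K%:R + 1) * eta) x) => h /=; apply/andP; split; nra.
Qed.

Section function_approximation.
Context {R : realType} (D : set R) (I : finType).
Local Notation obsType := (g_sigma_algebraType (time_cylinders D)).
Variable P : I -> probability obsType R.

Lemma bounded_sample_approx (T : (R -> R) -> R) (M e : R) :
  measurable_fun setT (T : obsType -> R) -> (forall y, `|T y| <= M) -> 0 < e ->
  exists2 s : seq R, (forall u, u \in s -> D u) & exists T' : (R -> R) -> R,
    [/\ measurable_fun setT (T' : g_sigma_algebraType (time_cylinders [set` s]) -> R),
        measurable_fun setT (T' : obsType -> R) &
        forall i, (\int[P i]_y ((T y - T' y) ^+ 2)%:E <= e%:E)%E].
Proof.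
move=> mT TM e0.
(* Rounding and replacing the superlevel sets each cost [2 * eta ^+ 2]; from [eta <= 1] and
   [eta <= e / 4] the total is at most [e]. *)
pose eta := Num.min 1 (e / 4).
have eta0 : 0 < eta by rewrite lt_min ltr01 divr_gt0.
have eta1 : eta <= 1 by rewrite ge_min lexx.
have etae : 4 * eta ^+ 2 <= e.
  have : eta <= e / 4 by rewrite ge_min lexx orbT.
  nra.
pose K := (Num.truncn (2 * M / eta)).+1.
have KM : 2 * M <= K%:R * eta.
  by rewrite -ler_pdivrMr// ltW// truncnS_gt.
pose A k := [set y : obsType | k.+1%:R * eta <= T y + M].
have mA k : measurable (A k : set obsType).
  rewrite -[X in measurable X]setTI; pose f (y : obsType) := T y + M.
  have mf : measurable_fun setT f by exact: measurable_funD.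
  have := mf measurableT `[k.+1%:R * eta, +oo[%classic (measurable_itv _).
  by congr (measurable (_ `&` _)); apply/seteqP; split => y /=; rewrite /f in_itv/= andbT.
(* [dif] counts the sets in error and [dif ^+ 2 <= K * dif]; since [dif] has mean at most [K * e'],
   this choice bounds the mean of [dif ^+ 2] by 1. *)
pose e' : R := ((K * K)%:R)^-1.
have e'0 : 0 < e' by rewrite invr_gt0 ltr0n muln_gt0.
have /boolp.choice[sA hsA] : forall k, exists sA : seq R * set (R -> R),
    [/\ forall u, u \in sA.1 -> D u, sampled sA.1 sA.2 &
        forall i, (P i (A k `+` sA.2) < e'%:E)%E].
  move=> k; have [_ /(_ _ e'0)[s sD [A' sA' AA']]] := measurable_sample_approx P (mA k).
  by exists (s, A').
pose s := flatten [seq (sA k).1 | k <- iota 0 K].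
have sD u : u \in s -> D u.
  by move=> /flattenP[_ /mapP[k _ ->]]; have [h _ _] := hsA k; exact: h.
have sS k : (k < K)%N -> sampled s (sA k).2.
  move=> kK; have [_ h _] := hsA k; apply: sampled_sub h => u us.
  by apply/flattenP; exists (sA k).1 => //; apply/mapP; exists k => //; rewrite mem_iota.
have mA' k : (k < K)%N -> measurable ((sA k).2 : set obsType).
  by move=> kK; exact: sampled_measurable (sS k kK).
exists s => //; exists (fun y => - M + eta * \sum_(k < K) \1_((sA k).2) y); split.
- apply: measurable_funD => //; apply: measurable_funM => //.
  apply: measurable_sum => k; apply: measurable_indic; exact: (sS k).
- apply: measurable_funD => //; apply: measurable_funM => //.
  by apply: measurable_sum => k; apply: measurable_indic; exact: mA'.
move=> i.
pose dif y : R := \sum_(k < K) \1_(A k `+` (sA k).2) y.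
have mdif k : (k < K)%N -> measurable (A k `+` (sA k).2 : set obsType).
  by move=> kK; apply: measurableU; apply: measurableD => //; exact: mA'.
have dif0 y : 0 <= dif y by apply: sumr_ge0 => k _; rewrite indicE.
have difK y : dif y <= K%:R.
  rewrite -[K in leRHS]card_ord -sumr_const; apply: ler_sum => k _.
  by rewrite indicE lern1 leq_b1.
have pw y : (T y - (- M + eta * \sum_(k < K) \1_((sA k).2) y)) ^+ 2 <=
    2 * eta ^+ 2 + 2 * eta ^+ 2 * K%:R * dif y.
  have /andP[l1 l2] : 0 <= T y + M - eta * \sum_(k < K) (k.+1%:R * eta <= T y + M)%R%:R <= eta.
    apply: layer_approx => //; have := TM y; rewrite ler_norml => /andP[? ?].
    by apply/andP; split; lra.
  have : `|\sum_(k < K) (k.+1%:R * eta <= T y + M)%R%:R - \sum_(k < K) \1_((sA k).2) y| <= dif y.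
    rewrite -sumrB (le_trans (ler_norm_sum _ _ _))//; apply: ler_sum => k _.
    rewrite !indicE.
    have -> : (k.+1%:R * eta <= T y + M) = (y \in A k) by rewrite /A mem_setE.
    have [Ay|Ay] := boolP (y \in A k); have [A'y|A'y] := boolP (y \in (sA k).2).
    - by rewrite subrr normr0.
    - by rewrite subr0 normr1 mem_set//; left; split; [exact/set_mem|move=> h; case/negP: A'y; exact/mem_set].
    - by rewrite sub0r normrN1 mem_set//; right; split; [exact/set_mem|move=> h; case/negP: Ay; exact/mem_set].
    - by rewrite subrr normr0.
  move: l1 l2; set a := \sum_(k < K) _; set b := \sum_(k < K) _ => l1 l2.
  rewrite ler_norml => /andP[ab1 ab2].
  have difsq : dif y ^+ 2 <= K%:R * dif y by rewrite expr2 ler_wpM2r.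
  have absq : (a - b) ^+ 2 <= K%:R * dif y by apply: le_trans difsq; nra.
  have e2 : 0 <= eta ^+ 2 by exact: sqr_ge0.
  rewrite (_ : T y - _ = (T y + M - eta * a) + eta * (a - b)); last by ring.
  set c := T y + M - eta * a in l1 l2 *.
  have c2 : c ^+ 2 <= eta ^+ 2 by nra.
  have : eta ^+ 2 * (a - b) ^+ 2 <= eta ^+ 2 * (K%:R * dif y) by exact: ler_wpM2l.
  have := sqr_ge0 (c - eta * (a - b)).
  nra.
have mdiff : measurable_fun setT (dif : obsType -> R).
  by apply: measurable_sum => k; apply: measurable_indic; exact: mdif.
apply: (@le_trans _ _ (\int[P i]_y ((2 * eta ^+ 2)%:E + (2 * eta ^+ 2 * K%:R)%:E * (dif y)%:E))%E).
  apply: ge0_le_integral => //.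
  - by move=> y _; rewrite lee_fin sqr_ge0.
  - apply/measurable_EFinP; apply: measurable_funX; apply: measurable_funB => //.
    apply: measurable_funD => //; apply: measurable_funM => //.
    by apply: measurable_sum => k; apply: measurable_indic; exact: mA'.
  - apply: emeasurable_funD => //; apply: emeasurable_funM => //.
    exact/measurable_EFinP.
  - by move=> y _; rewrite -EFinM -EFinD lee_fin pw.
have c0 : 0 <= 2 * eta ^+ 2 * K%:R by rewrite mulr_ge0// mulr_ge0// sqr_ge0.
rewrite ge0_integralD//=; last 3 first.
- by move=> y _; rewrite lee_fin mulr_ge0// sqr_ge0.
- by move=> y _; rewrite -EFinM lee_fin mulr_ge0.
- by apply: emeasurable_funM => //; exact/measurable_EFinP.
rewrite integral_cst//.
rewrite [X in (_ * X + _)%E](_ : _ = 1%E); last exact: probability_setT.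
rewrite mule1 ge0_integralZl_EFin//; last 2 first.
- by move=> y _; rewrite lee_fin.
- exact/measurable_EFinP.
under eq_integral do rewrite -sumEFin.
rewrite ge0_integral_sum//=; last first.
  by move=> k; apply/measurable_EFinP; apply: measurable_indic; exact: mdif.
apply: (@le_trans _ _ ((2 * eta ^+ 2)%:E + (2 * eta ^+ 2 * K%:R)%:E * (K%:R * e')%:E)%E).
  apply: leeD2l; apply: lee_wpmul2l; first by rewrite lee_fin.
  rewrite (_ : (K%:R * e')%:E = \sum_(k < K) e'%:E)%E; last first.
    by rewrite sumEFin sumr_const card_ord mulr_natl.
  apply: lee_sum => k _; rewrite integral_indic//; last exact: mdif.
  by rewrite setIT ltW//; have [_ _ h] := hsA k; exact: h.
rewrite -EFinM -EFinD lee_fin /e' natrM.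
rewrite (_ : _ + _ = 4 * eta ^+ 2)//.
by field; rewrite pnatr_eq0.
Qed.

End function_approximation.

Lemma exists_grid (R : realType) (N : R) (s : seq R) :
  0 <= N -> (forall u, u \in s -> 0 <= u <= N) ->
  exists (p : nat) (t : nat -> R),
    [/\ t 0%N = 0, forall i, (i < p)%N -> t i < t i.+1,
        {homo t : i j / (i <= j)%N >-> i <= j}, forall i, t i <= N &
        forall u, u \in s -> exists2 i, (i <= p)%N & u = t i].
Proof.
move=> N0 sN; pose s' := sort <=%R (undup (0 :: s)).
have s'E u : (u \in s') = (u \in 0 :: s) by rewrite mem_sort mem_undup.
have s's : sorted <%R s' by rewrite lt_sorted_uniq_le sort_uniq undup_uniq sort_le_sorted.
have s'0 : (0 < size s')%N.
  by have : 0 \in s' by [rewrite s'E inE eqxx]; case: (s').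
pose p := (size s').-1.
have pS : p.+1 = size s' by rewrite prednK.
have lp i : (minn i p < size s')%N by rewrite -pS ltnS geq_minr.
(* Constant beyond [p], so that [t] is monotone on all indices. *)
pose t i := nth 0 s' (minn i p).
have tin i : t i \in s' by apply: mem_nth.
have t0N i : 0 <= t i <= N.
  have := tin i; rewrite s'E inE => /predU1P[->|/sN//]; by rewrite lexx.
have tH : {homo t : i j / (i <= j)%N >-> i <= j}.
  move=> i j ij; rewrite /t (lt_sorted_leq_nth 0 s's) ?inE//.
  by rewrite leq_min geq_minr andbT (leq_trans (geq_minl _ _)).
exists p, t; split=> //.
- apply/eqP; rewrite eq_le; have /andP[-> _] := t0N 0%N; rewrite andbT.
  have [i ip <-] : exists2 i, (i < size s')%N & nth 0 s' i = 0 by apply/nthP; rewrite s'E inE eqxx.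
  by rewrite /t min0n (lt_sorted_leq_nth 0 s's) ?inE.
- move=> i ip; rewrite /t (minn_idPl (ltnW ip)) (minn_idPl ip).
  by rewrite (lt_sorted_ltn_nth 0 s's) ?inE// -pS ltnS// ltnW.
- by move=> i; have /andP[] := t0N i.
- move=> u us; have /nthP - /(_ 0)[i ip <-] : u \in s' by rewrite s'E inE us orbT.
  have ip' : (i <= p)%N by rewrite -ltnS pS.
  by exists i => //; rewrite /t (minn_idPl ip').
Qed.

(** * Bayes risk for the amplitude of a known signal *)

Section one_dimensional_bound.
Context {R : realType} (Q : noise_law R) (s : R) (n : nat).
Variables (Phi V : R -> R) (K : R).
Hypothesis s0 : 0 < s.
Hypothesis QB : brownian_law s Q.
Hypothesis Phi0 : Phi 0 = 0.
Hypothesis PhiV : forall a b, 0 <= a -> a <= b -> b <= n%:R ->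
  (Phi b - Phi a) ^+ 2 <= (b - a) * (V b - V a).
Hypothesis VK : V n%:R - V 0 <= K.

(** [PhiV] is the Cauchy-Schwarz inequality for a signal with primitive [Phi] and cumulated energy
    [V]; summed over the steps it telescopes, whatever the grid. *)
Lemma grid_energy_le p (t : nat -> R) :
  t 0%N = 0 -> (forall i, (i < p)%N -> t i < t i.+1) ->
  {homo t : i j / (i <= j)%N >-> i <= j} -> (forall i, t i <= n%:R) ->
  grid_energy s p t Phi <= K / s.
Proof.
move=> t0 tS tH tn.
have t_ge0 i : 0 <= t i by rewrite -t0 tH.
apply: (@le_trans _ _ ((V (t p) - V (t 0%N)) / s)).
  rewrite -(telescope_sumr (fun i => V (t i)) (leq0n p)) mulr_suml big_mkord.
  apply: ler_sum => i _; have ti := tS i (ltn_ord i).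
  have d0 : 0 < t i.+1 - t i by rewrite subr_gt0.
  rewrite invfM mulrA mulrAC ler_pM2r ?invr_gt0// ler_pdivrMr// mulrC.
  by apply: PhiV => //; exact: ltW.
rewrite ler_pM2r ?invr_gt0// (le_trans _ VK)// t0 lerB//.
(* That [V] does not decrease from [t p] to [n] comes from [PhiV], whose left-hand side is a
   square. *)
have [->//|tpn] := eqVneq (t p) n%:R.
have tpn' : t p < n%:R by rewrite lt_neqAle tpn tn.
have := PhiV (t_ge0 p) (tn p) (lexx _).
move=> /(le_trans (sqr_ge0 _)); rewrite pmulr_rge0 ?subr_gt0//.
by rewrite subr_ge0.
Qed.

Let times : set R := [set u | 0 <= u <= n%:R].

(* For [L] large this is the Bayes risk [s^2 / (1 + s^2 v)] of a Gaussian prior of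
   variance [s^2 = L h^2] when the observation carries information [v]. *)
Definition bayes_level (L : nat) (h v : R) : R :=
  h ^+ 2 * L%:R * expR (- (4 * h ^+ 2 * v)) / (1 + L%:R * h ^+ 2 * v).

(** A grid carries at most the information of the whole path, so this gives a bound that is the same
    for all grids. *)
Lemma bayes_level_le L h v v' : 0 <= v -> v <= v' ->
  bayes_level L h v' <= bayes_level L h v.
Proof.
move=> v0 vv; have A0 : 0 <= L%:R * h ^+ 2 by rewrite mulr_ge0// sqr_ge0.
have h20 : 0 <= 4 * h ^+ 2 by rewrite mulr_ge0// sqr_ge0.
have p1 x : 0 <= x -> 0 < 1 + L%:R * h ^+ 2 * x.
  by move=> x0; rewrite ltr_pwDl// mulr_ge0.
have v'0 : 0 <= v' by exact: le_trans vv.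
apply: ler_pM.
- by rewrite mulr_ge0 ?expR_ge0// mulr_ge0// sqr_ge0.
- by rewrite invr_ge0 ltW// p1.
- apply: ler_wpM2l; first by rewrite mulr_ge0// sqr_ge0.
  by rewrite ler_expR lerN2 ler_wpM2l.
- by rewrite lef_pV2 ?posrE ?p1// lerD2l ler_wpM2l.
Qed.

Lemma sampled_bound (L : nat) (h : R) (us : seq R) (T : (R -> R) -> R) :
  (0 < L)%N -> (forall u, u \in us -> times u) ->
  measurable_fun setT (T : g_sigma_algebraType (time_cylinders [set` us]) -> R) ->
  (((2 ^ L)%:R * bayes_level L h (K / s))%:E <=
   \sum_(v : {ffun 'I_L -> bool}) \int[Q]_x
     ((T (shifted_path (fun u => h * walk v * Phi u)%R x) - h * walk v) ^+ 2)%:E)%E.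
Proof.
move=> L0 ust mT; have [w [wB xiE]] := QB.
have [p [t [t0 tS tH tn tus]]] := exists_grid (ler0n _ n) ust.
have D0 u : grid_times p t u -> 0 <= u by move=> [i _ ->]; rewrite -t0 tH.
have mT' : measurable_fun setT (T : g_sigma_algebraType (time_cylinders (grid_times p t)) -> R).
  move=> _ B mB; have := mT measurableT B mB; rewrite !setTI.
  apply: smallest_sub; first exact: smallest_sigma_algebra.
  move=> _ [u uus [C mC ->]]; apply: sub_sigma_algebra; exists u; last by exists C.
  by have [i ip ->] := tus u uus; exists i.
pose v := grid_energy s p t Phi.
pose Z := grid_score s w p t Phi.
have vK : v <= K / s by exact: grid_energy_le.
have v0 : 0 <= v.
  apply: sumr_ge0 => i _; rewrite mulr_ge0 ?sqr_ge0// invr_ge0 mulr_ge0 ?(ltW s0)//.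
  by rewrite subr_ge0 ltW// tS.
have CM theta g := @grid_cameron_martin R Q s w s0 wB xiE p t Phi t0 tS tH Phi0 theta g.
(* The Cameron-Martin formula for the constant functional 1. *)
have EZ theta : (\int[Q]_x (gauss_lr v theta (Z x))%:E = 1)%E.
  have := CM theta (fun=> 1%E) (measurable_cst _) (fun=> lee01).
  under [X in _ = X -> _]eq_integral do rewrite mul1e.
  by move=> <-; rewrite integral_cst// mul1e; exact: probability_setT.
have mZ : measurable_fun setT Z by exact: (measurable_grid_score s wB p Phi t0 tH).
have mU : measurable_fun setT (fun x : path_space R => T (fun u => xi u x)).
  apply: (measurableT_comp mT').
  have := measurable_shifted_path (fun=> 0) D0; congr measurable_fun.
  by apply/funext => x; apply/funext => u; rewrite /shifted_path add0r.
apply: (@le_trans _ _ ((2 ^ L)%:R * bayes_level L h v)%:E).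
  by rewrite lee_fin ler_pM2l ?ltr0n ?expn_gt0// bayes_level_le.
apply: (le_trans (bayes_integral mZ v0 EZ h L0 mU)).
apply: lee_sum => e _.
rewrite (CM _ (fun y => ((T y - h * walk e) ^+ 2)%:E)); last 2 first.
- by apply/measurable_EFinP; apply: measurable_funX; exact: measurable_funB.
- by move=> y; rewrite lee_fin sqr_ge0.
by under [leLHS]eq_integral do rewrite EFinM.
Qed.

End one_dimensional_bound.

Section bayes_lower_bound.
Context {R : realType} (Q : noise_law R) (s : R) (n : nat).
Variables (Phi V : R -> R) (K : R).
Hypothesis s0 : 0 < s.
Hypothesis QB : brownian_law s Q.
Hypothesis Phi0 : Phi 0 = 0.
Hypothesis PhiV : forall a b, 0 <= a -> a <= b -> b <= n%:R ->
  (Phi b - Phi a) ^+ 2 <= (b - a) * (V b - V a).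
Hypothesis VK : V n%:R - V 0 <= K.

Local Notation obsType := (g_sigma_algebraType (observation_cylinders n)).

Lemma measurable_translate (g : R -> R) :
  measurable_fun setT ((fun y => fun u => g u + y u) : obsType -> obsType).
Proof.
apply: (@measurability _ _ obsType obsType setT _ (observation_cylinders n) erefl).
move=> _ [_ [u un [B mB ->]] <-]; rewrite setTI.
rewrite -[X in measurable X]setTI.
apply: (measurable_funD (f := cst (g u)) (g := fun y : obsType => y u)) => //.
move=> _ C mC; rewrite setTI; apply: sub_sigma_algebra.
by exists u => //; exists C.
Qed.

Lemma limit_le (B r : R) : 0 <= r ->
  (forall k, 0 < k -> B <= (1 + k) * r + (k + k ^+ 2)) -> B <= r.
Proof.
move=> r0 H; rewrite leNgt; apply/negP => rB.
(* For [k <= 1] the assumed bound is at most [r + k * (r + 2)], here at most the midpoint of [r] and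
   [B]. *)
pose k := Num.min 1 ((B - r) / (2 * (r + 2))).
have d0 : 0 < 2 * (r + 2) by rewrite mulr_gt0// ltr_wpDl.
have k0 : 0 < k by rewrite lt_min ltr01 divr_gt0// subr_gt0.
have k1 : k <= 1 by rewrite ge_min lexx.
have kB : k * (2 * (r + 2)) <= B - r.
  by rewrite -ler_pdivlMr// ge_min lexx orbT.
have := H k k0; nra.
Qed.

(** [g] is the drift due to the other coefficients, known once they are fixed; it is absorbed into
    the functional. *)
Lemma bayes_lower_bound (L : nat) (h : R) (g : R -> R) (T : (R -> R) -> R) (M : R) :
  (0 < L)%N -> measurable_fun setT (T : obsType -> R) -> (forall y, `|T y| <= M) ->
  (((2 ^ L)%:R * bayes_level L h (K / s))%:E <=
   \sum_(v : {ffun 'I_L -> bool}) \int[Q]_x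
     ((T (shifted_path (fun u => g u + h * walk v * Phi u)%R x) - h * walk v) ^+ 2)%:E)%E.
Proof.
move=> L0 mT0 TM0.
pose T1 (y : R -> R) := T (fun u => g u + y u).
have mT : measurable_fun setT (T1 : obsType -> R).
  exact: (measurableT_comp mT0 (measurable_translate g)).
have TM y : `|T1 y| <= M by exact: TM0.
have TE v x : T (shifted_path (fun u => g u + h * walk v * Phi u) x) =
              T1 (shifted_path (fun u => h * walk v * Phi u) x).
  by rewrite /T1; congr T; apply/funext => u; rewrite /shifted_path addrA.
under eq_bigr do under eq_integral do rewrite TE.
move: T1 mT TM {TE TM0 mT0} => {}T mT TM.
pose theta (v : {ffun 'I_L -> bool}) := h * walk v.
have D0 u : [set u : R | 0 <= u <= n%:R] u -> 0 <= u by move=> /andP[].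
have mpath v : measurable_fun setT
    (shifted_path (fun u => theta v * Phi u) : path_space R -> obsType).
  exact: (measurable_shifted_path (D := [set u : R | 0 <= u <= n%:R]) _ D0).
pose P v : probability obsType R := distribution Q (mfun_of (mpath v)).
pose risk := (\sum_v \int[Q]_x ((T (shifted_path (fun u => theta v * Phi u)%R x) - theta v) ^+ 2)%:E)%E.
rewrite -/risk.
have risk0 : (0 <= risk)%E.
  by apply: sume_ge0 => v _; apply: integral_ge0 => x _; rewrite lee_fin sqr_ge0.
have [->|] := eqVneq risk +oo%E; first by rewrite leey.
rewrite -ltey => riskfin.
have rE : risk = (fine risk)%:E by rewrite fineK// ge0_fin_numE.
rewrite rE lee_fin; apply: limit_le; first exact: fine_ge0.
(* The inequality [(a + b)^2 <= (1 + k) a^2 + (1 + 1/k) b^2] separates the risk of [T] from the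
   approximation error. With error [e] under each of the [2 ^ L] laws the second part totals
   [(1 + 1/k) k^2 = k + k^2], the slack in [limit_le]. *)
move=> k k0; pose e := k ^+ 2 / (2 ^ L)%:R.
have L20 : 0 < (2 ^ L)%:R :> R by rewrite ltr0n expn_gt0.
have e0 : 0 < e by rewrite divr_gt0// exprn_gt0.
have [us usD [T' [mT' mT'o T'e]]] := bounded_sample_approx P mT TM e0.
rewrite -lee_fin.
apply: (le_trans (sampled_bound s0 QB Phi0 PhiV VK h L0 usD mT')).
rewrite EFinD EFinM -rE /risk.
have -> : (k + k ^+ 2 = \sum_(v : {ffun 'I_L -> bool}) (1 + k^-1) * e).
  rewrite sumr_const card_cube -[_ *+ (2 ^ L)]mulr_natl /e.
  by field; rewrite (gt_eqF k0)/= gt_eqF.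
rewrite -sumEFin ge0_sume_distrr; last first.
  by move=> v _; apply: integral_ge0 => x _; rewrite lee_fin sqr_ge0.
rewrite -big_split/=; apply: lee_sum => v _.
have mTp (U : (R -> R) -> R) : measurable_fun setT (U : obsType -> R) ->
    measurable_fun setT (fun x => U (shifted_path (fun u => theta v * Phi u) x)).
  by move=> mU; exact: (measurableT_comp mU (mpath v)).
have m1 : measurable_fun setT (fun x =>
    (((T (shifted_path (fun u => theta v * Phi u) x) - theta v) ^+ 2)%:E)).
  apply/measurable_EFinP; apply: measurable_funX; apply: measurable_funB => //.
  exact: mTp.
have m2 : measurable_fun setT (fun x =>
    (((T (shifted_path (fun u => theta v * Phi u) x) -
       T' (shifted_path (fun u => theta v * Phi u) x)) ^+ 2)%:E)).
  by apply/measurable_EFinP; apply: measurable_funX; apply: measurable_funB; exact: mTp.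
have k1 : 0 <= 1 + k by rewrite addr_ge0// ltW.
have kV : 0 <= 1 + k^-1 by rewrite addr_ge0// invr_ge0 ltW.
have T'v : (\int[Q]_x ((T (shifted_path (fun u => theta v * Phi u)%R x) -
       T' (shifted_path (fun u => theta v * Phi u)%R x)) ^+ 2)%:E <= e%:E)%E.
  apply: le_trans (T'e v); rewrite ge0_integral_distribution//=.
  - by apply/measurable_EFinP; apply: measurable_funX; exact: measurable_funB.
  - by move=> y; rewrite lee_fin sqr_ge0.
apply: (@le_trans _ _ ((1 + k)%:E * \int[Q]_x ((T (shifted_path (fun u => theta v * Phi u)%R x) - theta v) ^+ 2)%:E
   + (1 + k^-1)%:E * \int[Q]_x ((T (shifted_path (fun u => theta v * Phi u)%R x) -
       T' (shifted_path (fun u => theta v * Phi u)%R x)) ^+ 2)%:E)%E); last first.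
  by apply: leeD2l; rewrite EFinM; apply: lee_wpmul2l.
rewrite -!ge0_integralZl_EFin//; last 2 first.
- by move=> x _; rewrite lee_fin sqr_ge0.
- by move=> x _; rewrite lee_fin sqr_ge0.
rewrite -ge0_integralD//=; last 4 first.
- by move=> x _; rewrite mule_ge0// lee_fin sqr_ge0.
- exact: emeasurable_funM.
- by move=> x _; rewrite mule_ge0// lee_fin sqr_ge0.
- exact: emeasurable_funM.
apply: ge0_le_integral => //.
- by move=> x _; rewrite lee_fin sqr_ge0.
- apply/measurable_EFinP; apply: measurable_funX; apply: measurable_funB => //.
  exact: mTp.
- by apply: emeasurable_funD; exact: emeasurable_funM.
move=> x _; rewrite -!EFinM -EFinD lee_fin -/(theta v).
set a := T _; set b := T' _; set c := theta v.
rewrite -subr_ge0 (_ : _ - _ = (k * (a - c) + (a - b)) ^+ 2 / k).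
  by rewrite divr_ge0 ?sqr_ge0// ltW.
by field; rewrite gt_eqF.
Qed.

End bayes_lower_bound.

(** * Trigonometric polynomials *)

Section interval_integrals.
Context {R : realType}.
Local Notation mu := (@lebesgue_measure R).

Lemma continuous_itv_integrable (f : R -> R) (a b : R) :
  continuous f -> mu.-integrable `[a, b] (EFin \o f).
Proof.
move=> cf; apply: continuous_compact_integrable; first exact: segment_compact.
exact: continuous_subspaceT.
Qed.

Lemma Rintegral_antiderivative (F f : R -> R) (a b : R) : a <= b ->
  (forall x : R, is_derive x 1 F (f x)) -> continuous f ->
  \int[mu]_(x in `[a, b]) f x = F b - F a.
Proof.
move=> ab dF cf; move: ab; rewrite le_eqVlt => /predU1P[->|ab].
  by rewrite set_itv1 Rintegral_set1 subrr.
have cF : continuous F.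
  by move=> x; apply: differentiable_continuous; apply/derivable1_diffP; exact: ex_derive.
rewrite /Rintegral (continuous_FTC2 ab (F := F))//.
- exact: continuous_subspaceT.
- by split => [x _| |]; [exact: ex_derive|exact/cvg_at_right_filter/cF|exact/cvg_at_left_filter/cF].
- by move=> x _; rewrite derive1E; exact: derive_val.
Qed.

Lemma Rintegral_sum (I : Type) (s : seq I) (D : set R) (f : I -> R -> R) :
  measurable D -> (forall i, mu.-integrable D (EFin \o f i)) ->
  \int[mu]_(x in D) (\sum_(i <- s) f i x) = \sum_(i <- s) \int[mu]_(x in D) f i x.
Proof.
move=> mD intf; elim: s => [|i s IH].
  under eq_Rintegral do rewrite big_nil.
  by rewrite big_nil /Rintegral integral0.
under eq_Rintegral do rewrite big_cons.
rewrite RintegralD// ?IH ?big_cons//.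
rewrite (_ : EFin \o _ = (fun x => \sum_(j <- s) (f j x)%:E)%E).
  have := @integrable_sum _ (measurableTypeR R) R mu D mD _ s xpredT (fun i => EFin \o f i).
  by apply => j _; exact: intf.
by apply/funext => x /=; rewrite sumEFin.
Qed.

End interval_integrals.

Section trigonometric_basis.
Context {R : realType}.
Local Notation mu := (@lebesgue_measure R).
Implicit Types (b : bool) (m : nat) (x : R).

Definition freq m : R := 2 * pi * m%:R.

Definition trig b m x : R :=
  Num.sqrt 2 * (if b then cos (freq m * x) else sin (freq m * x)).

Definition dsign b : R := if b then -1 else 1.

Lemma freq_gt0 m : (0 < m)%N -> 0 < freq m.
Proof. by move=> m0; rewrite !mulr_gt0 ?pi_gt0 ?ltr0n. Qed.

Lemma is_derive_trig b m x :
  is_derive x 1 (trig b m) (dsign b * freq m * trig (~~ b) m x).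
Proof.
rewrite /trig /dsign; case: b => /=.
- apply: is_derive_eq; rewrite /GRing.scale /=; ring.
- apply: is_derive_eq; rewrite /GRing.scale /=; ring.
Qed.

Lemma continuous_trig b m : continuous (trig b m).
Proof.
move=> x; apply: differentiable_continuous; apply/derivable1_diffP.
by case: (is_derive_trig b m x).
Qed.

Lemma trigD1 b m x : trig b m (x + 1) = trig b m x.
Proof.
rewrite /trig /freq mulrDr mulr1.
have -> : 2 * pi * m%:R = (pi *+ 2) *+ m :> R by ring.
by case: b; rewrite ?(periodicn (@cosD2pi R)) ?(periodicn (@sinD2pi R)).
Qed.

Lemma trig_nat b m n : trig b m n%:R = trig b m 0.
Proof. by elim: n => // n IH; rewrite -natr1 trigD1. Qed.

Lemma trig_sqr_sum m x : trig true m x ^+ 2 + trig false m x ^+ 2 = 2.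
Proof. by rewrite /trig !exprMn sqr_sqrtr// -mulrDr cos2Dsin2 mulr1. Qed.

Lemma trig_orthonormal b b' m m' n : (0 < m)%N -> (0 < m')%N ->
  \int[mu]_(x in `[0, n%:R]) (trig b m x * trig b' m' x) =
  n%:R * ((b == b') && (m == m'))%:R.
Proof.
move=> m0 m'0.
have cc c m1 c' m2 : continuous (fun x => trig c m1 x * trig c' m2 x).
  by move=> x; apply: cvgM; exact: continuous_trig.
have dt c k x : is_derive x 1 (trig c k) (dsign c * freq k * trig (~~ c) k x) :=
  is_derive_trig c k x.
have fm := freq_gt0 m0; have fm' := freq_gt0 m'0.
have [mm|mm] := eqVneq m m'; last first.
  have ff : freq m' ^+ 2 - freq m ^+ 2 != 0.
    rewrite subr_sqr mulf_neq0//; last by rewrite gt_eqF// addr_gt0.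
    rewrite subr_eq0 /freq; apply: contra mm => /eqP /mulfI h.
    by apply/eqP/esym/(mulrIn (@oner_neq0 R)); rewrite h// mulf_neq0// gt_eqF// pi_gt0.
  rewrite andbF mulr0.
  (* For [u], [v] the two functions, [u' v - u v'] has derivative
     [(freq m' ^+ 2 - freq m ^+ 2) * u * v]. *)
  pose F x := (freq m' ^+ 2 - freq m ^+ 2)^-1 *
    (dsign b * freq m * (trig (~~ b) m x * trig b' m' x) -
     dsign b' * freq m' * (trig b m x * trig (~~ b') m' x)).
  have dF x : is_derive x 1 F (trig b m x * trig b' m' x).
    apply: is_derive_eq; rewrite /GRing.scale /=.
    by clear F; rewrite /dsign; case: b; case: b' => /=; field.
  by rewrite (Rintegral_antiderivative _ dF)// /F !trig_nat subrr.
move: mm m'0 fm' => <- _ _; rewrite andbT.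
have [bb|bb] := eqVneq b b'; last first.
  rewrite mulr0.
  pose F x := (2 * freq m)^-1 * (trig false m x * trig false m x).
  have dF x : is_derive x 1 F (trig b m x * trig b' m x).
    apply: is_derive_eq; rewrite /GRing.scale /=.
    by clear F; case: b b' bb => [] [] //= _; rewrite /dsign; field; rewrite gt_eqF.
  by rewrite (Rintegral_antiderivative _ dF)// /F !trig_nat subrr.
move: bb => <-; rewrite mulr1.
pose F x := x - dsign b * ((2 * freq m)^-1 * (trig true m x * trig false m x)).
have dF x : is_derive x 1 F (trig b m x * trig b m x).
  apply: is_derive_eq; rewrite /GRing.scale /=.
  clear F; have := trig_sqr_sum m x; rewrite /dsign; case: b => /= h.
  - transitivity (1 + (trig true m x ^+ 2 - trig false m x ^+ 2) / 2).
      by field; rewrite gt_eqF.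
    by move: h; set a := trig _ _ _; set c := trig _ _ _ => h; lra.
  - transitivity (1 - (trig true m x ^+ 2 - trig false m x ^+ 2) / 2).
      by field; rewrite gt_eqF.
    by move: h; set a := trig _ _ _; set c := trig _ _ _ => h; lra.
by rewrite (Rintegral_antiderivative _ dF)// /F !trig_nat; ring.
Qed.

End trigonometric_basis.

Section primitives.
Context {R : realType} (phi : R -> R).
Hypothesis cphi : continuous phi.
Local Notation mu := (@lebesgue_measure R).

Lemma Rintegral_cauchy_schwarz (a b : R) : 0 <= a -> a <= b ->
  (\int[mu]_(x in `[0, b]) phi x - \int[mu]_(x in `[0, a]) phi x) ^+ 2 <=
  (b - a) * (\int[mu]_(x in `[0, b]) (phi x * phi x) -
             \int[mu]_(x in `[0, a]) (phi x * phi x)).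
Proof.
move=> a0 ab.
have cphi2 : continuous (fun x => phi x * phi x) by move=> x; apply: cvgM; exact: cphi.
move: ab; rewrite le_eqVlt => /predU1P[->|ab]; first by rewrite !subrr expr0n mul0r.
have BE (f : R -> R) : continuous f ->
  \int[mu]_(x in `[0, b]) f x - \int[mu]_(x in `[0, a]) f x = \int[mu]_(x in `]a, b]) f x.
  by move=> cf; apply: Rintegral_itvB; rewrite ?bnd_simp ?(ltW ab)//; exact: continuous_itv_integrable.
have int (f : R -> R) : continuous f -> mu.-integrable `]a, b] (EFin \o f).
  move=> cf; apply: (@integrableS _ _ _ mu `[a, b]%classic) => //.
    exact: subset_itv_oc_cc.
  exact: continuous_itv_integrable.
rewrite !BE//; set P := \int[mu]_(x in _) phi x; set W := \int[mu]_(x in _) _.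
have ba : 0 < b - a by rewrite subr_gt0.
(* The mean of [phi]; the inequality is the non-negativity of the integral of [(phi - c) ^+ 2]. *)
pose c := P / (b - a).
have ccst (k : R) : continuous (fun _ : R => k) by move=> x; exact: cvg_cst.
have clin : continuous (fun x => - (2 * c) * phi x).
  by move=> x; apply: cvgM; [exact: cvg_cst|exact: cphi].
have : 0 <= \int[mu]_(x in `]a, b]) ((phi x * phi x + - (2 * c) * phi x) + c ^+ 2).
  apply: Rintegral_ge0 => x _.
  by rewrite (_ : _ + _ = (phi x - c) ^+ 2) ?sqr_ge0//; ring.
rewrite RintegralD//; last 2 first.
- by apply: int => x; apply: cvgD; [exact: cphi2|exact: clin].
- exact: int.
rewrite RintegralD//; [|exact: int|exact: int].
rewrite RintegralZl//; last exact: int.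
rewrite Rintegral_cst//= lebesgue_measure_itv/= lte_fin ab -EFinD/= -/P -/W.
have PE : P = c * (b - a) by rewrite /c divfK// gt_eqF.
rewrite PE; nra.
Qed.

End primitives.

Section trigonometric_polynomials.
Context {R : realType} (N : nat).
Local Notation mu := (@lebesgue_measure R).
Implicit Types (c : 'I_N * bool -> R).

(* The index [(i, b)] stands for the frequency [i + 1], with the cosine or the sine
   according to [b]; frequency 0 is not used. *)
Definition tpoly c (x : R) : R := \sum_j c j * trig j.2 j.1.+1 x.

(** Differentiation acting on coefficients, so that the successive derivatives are the polynomials
    with coefficients [iter i dcoef c]. *)
Definition dcoef c (j : 'I_N * bool) : R :=
  dsign (~~ j.2) * freq j.1.+1 * c (j.1, ~~ j.2).

Lemma sum_pair_bool (f : 'I_N * bool -> R) :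
  \sum_j f j = \sum_(m < N) (f (m, true) + f (m, false)).
Proof.
rewrite (eq_bigr (fun j => f (j.1, j.2))); last by case.
rewrite -(pair_bigA _ (fun m b => f (m, b)))/=.
by apply: eq_bigr => m _; rewrite big_bool.
Qed.

Lemma is_derive_tpoly c (x : R) : is_derive x 1 (tpoly c) (tpoly (dcoef c) x).
Proof.
have -> : tpoly (dcoef c) x =
    \sum_j c j * (dsign j.2 * freq j.1.+1 * trig (~~ j.2) j.1.+1 x).
  rewrite /tpoly !sum_pair_bool; apply: eq_bigr => m _.
  by rewrite /dcoef /= /dsign; ring.
have -> : tpoly c = \sum_j (fun x => c j * trig j.2 j.1.+1 x).
  by apply/funext => y; rewrite fct_sumE.
elim/big_ind2 : _ => [|F dF G dG hF hG|j _]; [exact: is_derive_cst|exact: is_deriveD|].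
have := is_derive_trig j.2 j.1.+1 x => d.
by apply: is_derive_eq; rewrite /GRing.scale.
Qed.

Lemma continuous_tpoly c : continuous (tpoly c).
Proof.
move=> x; apply: differentiable_continuous; apply/derivable1_diffP.
by case: (is_derive_tpoly c x).
Qed.

Lemma tpolyD1 c (x : R) : tpoly c (x + 1) = tpoly c x.
Proof. by apply: eq_bigr => j _; rewrite trigD1. Qed.

Lemma sqint_tpoly c : sqint 1 (tpoly c) = (\sum_j c j ^+ 2)%:E.
Proof.
have cc j j' : continuous (fun x : R => trig j.2 (j.1 : 'I_N).+1 x * trig j'.2 (j'.1 : 'I_N).+1 x).
  by move=> x; apply: cvgM; exact: continuous_trig.
have ct2 : continuous (fun x => tpoly c x ^+ 2).
  by move=> x; apply: cvgM; exact: continuous_tpoly.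
rewrite /sqint; transitivity (\int[mu]_(x in `[0, 1]) (tpoly c x ^+ 2))%:E.
  rewrite /Rintegral fineK//; apply: integrable_fin_num => //.
  exact: continuous_itv_integrable.
congr EFin; transitivity (\int[mu]_(x in `[0, 1])
  (\sum_i \sum_j c i * c j * (trig i.2 i.1.+1 x * trig j.2 j.1.+1 x))).
  apply: eq_Rintegral => x _; rewrite expr2 /tpoly mulr_suml.
  by apply: eq_bigr => i _; rewrite mulr_sumr; apply: eq_bigr => j _; ring.
have int1 i j : mu.-integrable `[0, 1]
    (EFin \o (fun x => c i * c j * (trig i.2 i.1.+1 x * trig j.2 j.1.+1 x))).
  by apply: continuous_itv_integrable => x; apply: cvgM; [exact: cvg_cst|exact: cc].
rewrite Rintegral_sum//; last first.
  move=> i; rewrite (_ : EFin \o _ = (fun x => \sum_j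
    (c i * c j * (trig i.2 i.1.+1 x * trig j.2 j.1.+1 x))%:E)%E); last first.
    by apply/funext => x /=; rewrite sumEFin.
  have := @integrable_sum _ (measurableTypeR R) R mu `[0, 1]%classic (measurable_itv _) _
    (index_enum ('I_N * bool)%type) xpredT
    (fun j => EFin \o (fun x => c i * c j * (trig i.2 i.1.+1 x * trig j.2 j.1.+1 x))).
  by apply.
apply: eq_bigr => i _; rewrite Rintegral_sum//.
rewrite (bigD1 i)//= big1 ?addr0.
  rewrite RintegralZl//; last exact: continuous_itv_integrable.
  by rewrite (trig_orthonormal _ _ 1)// !eqxx/= !mulr1 expr2.
move=> j ji; rewrite RintegralZl//; last exact: continuous_itv_integrable.
rewrite (trig_orthonormal _ _ 1)// eqSS mul1r.
case: eqP => [b2|]; last by rewrite mulr0.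
case: eqP => [b1|]; last by rewrite mulr0.
case/eqP: ji; case: i j b1 b2 {int1} => [i b] [j b'] /= /val_inj -> -> //.
Qed.

(** A derivative swaps the cosine and the sine of a frequency, so a multiplier exists only for the
    energy of the pair. *)
Lemma iter_dcoef c (m : 'I_N) i :
  iter i dcoef c (m, true) ^+ 2 + iter i dcoef c (m, false) ^+ 2 =
  freq m.+1 ^+ (2 * i) * (c (m, true) ^+ 2 + c (m, false) ^+ 2).
Proof.
elim: i => [|i IH]; first by rewrite muln0 expr0 mul1r.
rewrite mulnS exprD -[RHS]mulrA -IH /= {1 3}/dcoef /= /dsign; ring.
Qed.

Lemma sobolev_tpoly (k : nat) (r : R) c :
  \sum_(j : 'I_N * bool) (\sum_(i < k.+1) freq j.1.+1 ^+ (2 * i)) * c j ^+ 2 <= r ->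
  sobolev_ball k r (tpoly c).
Proof.
move=> cr; split; first exact: tpolyD1.
exists (fun i => tpoly (iter i dcoef c)); split => //.
- move=> i x _ _; apply: (cvg_trans (G := (tpoly (iter i dcoef c) y - tpoly (iter i dcoef c) x) / (y - x) @[y --> x^'])).
    apply: cvg_app; exact: cvg_within.
  move: (is_derive_tpoly (iter i dcoef c) x) => [+ <-]; set f := tpoly _ => df.
  have sub0 : (y - x) @[y --> x^'] --> 0^'.
    move=> A /nbhs_ballP[e /= e0 eA]; apply/nbhs_ballP; exists e => // y.
    rewrite /ball /= => xy yx; apply: eA; last by rewrite subr_eq0.
    by rewrite /ball /= sub0r normrN distrC.
  have := cvg_comp _ _ sub0 df; apply: cvg_trans; apply: near_eq_cvg.
  near=> y; rewrite /= /GRing.scale /= mulr1 subrK mulrC//.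
- by move=> i _; apply: continuous_subspaceT; exact: continuous_tpoly.
- by move=> i _; rewrite -[1 in RHS](add0r 1) tpolyD1.
under eq_bigr do rewrite sqint_tpoly.
rewrite sumEFin lee_fin (le_trans _ cr)// le_eqVlt; apply/orP; left; apply/eqP.
under eq_bigr do rewrite sum_pair_bool.
rewrite sum_pair_bool exchange_big/=; apply: eq_bigr => m _.
rewrite -mulrDr mulr_suml; apply: eq_bigr => i _.
exact: iter_dcoef.
Unshelve. all: by end_near. Qed.

End trigonometric_polynomials.

(** * Fourier coefficients of an estimator: measurability and Bessel's inequality *)

Section section_integrals.
Context d (T : measurableType d) {R : realType}.
Local Notation mu := (@lebesgue_measure R).
Local Notation U := (measurableTypeR R).
Variables (a b : R).
Let D : set (T * U) := setT `*` `[a, b].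

Let mD : measurable D.
Proof. by apply: measurableX. Qed.

(** Joint measurability is given on [D] only, hence the extension by 0 before Tonelli's theorem. *)
Lemma measurable_section_integral (F : T -> R -> \bar R) :
  measurable_fun D (fun p => F p.1 p.2) -> (forall y u, (0 <= F y u)%E) ->
  measurable_fun setT (fun y => \int[mu]_(u in `[a, b]) F y u)%E.
Proof.
move=> mF F0; pose G := (fun p : T * U => F p.1 p.2) \_ D.
have mG : measurable_fun setT G.
  by have [h _] := measurable_restrictT (fun p : T * U => F p.1 p.2) mD; exact: h.
have G0 p : (0 <= G p)%E by apply: erestrict_ge0 => q _; exact: F0.
have := @measurable_fun_fubini_tonelli_F _ _ T U R mu G mG G0; congr measurable_fun.
apply/funext => y; rewrite /fubini_F [RHS]integral_mkcond.
apply: eq_integral => u _; rewrite /G !patchE.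
have -> : ((y, u) \in D) = (u \in `[a, b]%classic).
  by apply/idP/idP => /set_mem h; apply/mem_set; [case: h|split].
by [].
Qed.

Lemma measurable_section_Rintegral (f : T -> R -> R) :
  measurable_fun D (fun p => f p.1 p.2) ->
  measurable_fun setT (fun y => \int[mu]_(u in `[a, b]) f y u).
Proof.
move=> mf; pose F (y : T) (u : R) := (f y u)%:E.
have mF : measurable_fun D (fun p => F p.1 p.2) by exact/measurable_EFinP.
have mpos : measurable_fun setT (fun y => \int[mu]_(u in `[a, b]) ((F y)^\+ u)%E)%E.
  apply: (measurable_section_integral (F := fun y => ((F y)^\+)%E)) => //.
  by have := measurable_funepos mF; congr measurable_fun; apply/funext => p; rewrite ?funeposE ?funenegE.
have mneg : measurable_fun setT (fun y => \int[mu]_(u in `[a, b]) ((F y)^\- u)%E)%E.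
  apply: (measurable_section_integral (F := fun y => ((F y)^\-)%E)) => //.
  by have := measurable_funeneg mF; congr measurable_fun; apply/funext => p; rewrite ?funeposE ?funenegE.
apply: (measurableT_comp (f := fine)) => //.
under eq_fun do rewrite integralE.
exact: emeasurable_funB.
Qed.

Lemma measurable_section (f : T -> R -> R) (y : T) :
  measurable_fun D (fun p => f p.1 p.2) -> measurable_fun `[a, b] (f y).
Proof.
move=> mf; apply: (measurable_comp mD _ mf (g := fun u : U => (y, u))).
  by move=> _ [u uab <-]; split.
by apply: measurable_funTS; exact: pair1_measurable.
Qed.

End section_integrals.

Section bessel.
Context {R : realType} (N : nat).
Local Notation mu := (@lebesgue_measure R).

Definition fourier_coef (f : R -> R) (j : 'I_N * bool) : R :=
  \int[mu]_(u in `[0, 1]) (f u * trig j.2 j.1.+1 u).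

Lemma integrable_mul_continuous (f g : R -> R) :
  mu.-integrable `[0, 1] (EFin \o f) -> continuous g ->
  mu.-integrable `[0, 1] (EFin \o (fun x => f x * g x)).
Proof.
move=> intf cg; have cg' : {within `[0, 1], continuous g} by exact: continuous_subspaceT.
have mg : measurable_fun `[0 : R, 1] g.
  exact: subspace_continuous_measurable_fun.
have mf : measurable_fun `[0 : R, 1] f by apply/measurable_EFinP; exact: measurable_int intf.
have [M gM] : exists M, forall x, x \in `[0, 1] -> `|g x| <= M.
  have cng : {within `[0, 1], continuous (fun x => `|g x|)}.
    by apply: continuous_subspaceT => x; apply: cvg_norm; exact: cg.
  have [c _ h] := EVT_max ler01 cng; exists `|g c| => x x01; exact: h.
apply: (@le_integrable _ _ _ mu _ _ _ (fun x => (M%:E * (EFin \o f) x)%E)) => //.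
- by apply/measurable_EFinP; apply: measurable_funM.
- move=> x x01; rewrite /= lee_fin !normrM mulrC ler_wpM2r//.
  by rewrite (le_trans (gM _ x01))// ler_norm.
- exact: integrableZl.
Qed.

Lemma integrable_scale (k : R) (f : R -> R) :
  mu.-integrable `[0, 1] (EFin \o f) ->
  mu.-integrable `[0, 1] (EFin \o (fun x => k * f x)).
Proof.
move=> intf; have -> : EFin \o (fun x => k * f x) = (fun x => k%:E * (EFin \o f) x)%E by [].
exact: integrableZl.
Qed.

Lemma integrable_add (f g : R -> R) :
  mu.-integrable `[0, 1] (EFin \o f) -> mu.-integrable `[0, 1] (EFin \o g) ->
  mu.-integrable `[0, 1] (EFin \o (fun x => f x + g x)).
Proof.
move=> intf intg.
have -> : EFin \o (fun x => f x + g x) =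
  (fun x => (EFin \o f) x + (EFin \o g) x)%E by [].
exact: (@integrableD _ _ R mu _ _ (EFin \o f) (EFin \o g)).
Qed.

Lemma sqint_integrable (g : R -> R) : measurable_fun `[0 : R, 1] g ->
  (sqint 1 g < +oo)%E ->
  mu.-integrable `[0, 1] (EFin \o (fun x => g x ^+ 2)) /\ mu.-integrable `[0, 1] (EFin \o g).
Proof.
move=> mg goo.
have int2 : mu.-integrable `[0, 1] (EFin \o (fun x => g x ^+ 2)).
  apply/integrableP; split; first by apply/measurable_EFinP; exact: measurable_funX.
  by under eq_integral do rewrite /= ger0_norm ?sqr_ge0//.
split => //.
have i1 : mu.-integrable `[0, 1] (EFin \o (fun x => 1 + g x ^+ 2)).
  apply: integrable_add => //.
  by apply: continuous_itv_integrable => x; exact: cvg_cst.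
apply: (@le_integrable _ _ _ mu _ _ _ (EFin \o (fun x => 1 + g x ^+ 2))) => //.
  exact/measurable_EFinP.
move=> x _; rewrite /= lee_fin [leRHS]ger0_norm; last by rewrite addr_ge0// sqr_ge0.
by rewrite -[g x ^+ 2]real_normK ?num_real//; nra.
Qed.

Lemma bessel_inequality (g : R -> R) : measurable_fun `[0 : R, 1] g ->
  ((\sum_j fourier_coef g j ^+ 2)%:E <= sqint 1 g)%E.
Proof.
move=> mg; have [goo|] := ltP (sqint 1 g) +oo%E; last first.
  by rewrite leye_eq => /eqP ->; exact: leey.
have [ig2 ig] := sqint_integrable mg goo.
pose c := fourier_coef g.
have igj j : mu.-integrable `[0, 1] (EFin \o (fun x => g x * trig j.2 (j.1 : 'I_N).+1 x)).
  by apply: integrable_mul_continuous => //; exact: continuous_trig.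
have igt : mu.-integrable `[0, 1] (EFin \o (fun x => g x * tpoly c x)).
  by apply: integrable_mul_continuous => //; exact: continuous_tpoly.
have it2 : mu.-integrable `[0, 1] (EFin \o (fun x => tpoly c x ^+ 2)).
  by apply: continuous_itv_integrable => x; apply: cvgM; exact: continuous_tpoly.
have gt : \int[mu]_(x in `[0, 1]) (g x * tpoly c x) = \sum_j c j ^+ 2.
  transitivity (\int[mu]_(x in `[0, 1]) (\sum_j c j * (g x * trig j.2 j.1.+1 x))).
    by apply: eq_Rintegral => x _; rewrite /tpoly mulr_sumr; apply: eq_bigr => j _; ring.
  rewrite Rintegral_sum//; last first.
    by move=> j; apply: integrable_scale; exact: igj.
  by apply: eq_bigr => j _; rewrite RintegralZl.
have tt : \int[mu]_(x in `[0, 1]) (tpoly c x ^+ 2) = \sum_j c j ^+ 2.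
  by have := sqint_tpoly c; rewrite /sqint /Rintegral => ->.
have g2 : sqint 1 g = (\int[mu]_(x in `[0, 1]) (g x ^+ 2))%:E.
  by rewrite /Rintegral fineK//; apply: integrable_fin_num.
rewrite g2 lee_fin.
have : 0 <= \int[mu]_(x in `[0, 1]) (g x ^+ 2 + (- 2 * (g x * tpoly c x) + tpoly c x ^+ 2)).
  apply: Rintegral_ge0 => x _.
  by rewrite (_ : _ + _ = (g x - tpoly c x) ^+ 2) ?sqr_ge0//; ring.
have igt2 : mu.-integrable `[0, 1] (EFin \o (fun x => - 2 * (g x * tpoly c x))).
  exact: integrable_scale.
rewrite RintegralD//; last exact: integrable_add.
rewrite RintegralD// RintegralZl// gt tt => h.
by rewrite -subr_ge0; move: h; set A := \sum_j _; set B := \int[mu]_(x in _) _; lra.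
Qed.

Lemma fourier_coefB (f : R -> R) (c : 'I_N * bool -> R) j :
  mu.-integrable `[0, 1] (EFin \o f) ->
  fourier_coef (fun x => f x - tpoly c x) j = fourier_coef f j - c j.
Proof.
move=> intf; rewrite /fourier_coef.
have it : continuous (fun x => tpoly c x * trig j.2 j.1.+1 x).
  by move=> x; apply: cvgM; [exact: continuous_tpoly|exact: continuous_trig].
have cj i : continuous (fun x : R => trig i.2 (i.1 : 'I_N).+1 x * trig j.2 j.1.+1 x).
  by move=> x; apply: cvgM; exact: continuous_trig.
transitivity (\int[mu]_(u in `[0, 1]) (f u * trig j.2 j.1.+1 u - tpoly c u * trig j.2 j.1.+1 u)).
  by apply: eq_Rintegral => x _; rewrite mulrBl.
rewrite RintegralB//; last 2 first.
- by apply: integrable_mul_continuous => //; exact: continuous_trig.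
- exact: continuous_itv_integrable.
congr (_ - _).
transitivity (\int[mu]_(x in `[0, 1]) (\sum_i c i * (trig i.2 i.1.+1 x * trig j.2 j.1.+1 x))).
  by apply: eq_Rintegral => x _; rewrite /tpoly mulr_suml; apply: eq_bigr => i _; ring.
rewrite Rintegral_sum//; last first.
  by move=> i; apply: continuous_itv_integrable => x; apply: cvgM; [exact: cvg_cst|exact: cj].
rewrite (bigD1 j)//= big1 ?addr0.
  rewrite RintegralZl//; last exact: continuous_itv_integrable.
  by rewrite (trig_orthonormal _ _ 1)// !eqxx/= !mulr1.
move=> i ij; rewrite RintegralZl//; last exact: continuous_itv_integrable.
rewrite (trig_orthonormal _ _ 1)// eqSS mul1r.
case: eqP => [b2|]; last by rewrite mulr0.
case: eqP => [b1|]; last by rewrite mulr0.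
by case/eqP: ij; move: i j b1 b2 {cj it} => [i b] [j' b'] /= /val_inj -> ->.
Qed.

(* If [f - tpoly c] is not in [L2[0, 1]] the right-hand side is infinite. *)
Lemma coefficient_distance (f : R -> R) (c : 'I_N * bool -> R) :
  measurable_fun `[0 : R, 1] f ->
  ((\sum_j (fourier_coef f j - c j) ^+ 2)%:E <= sqint 1 (fun u => f u - tpoly c u)%R)%E.
Proof.
move=> mf; set g : R -> R := (fun u => f u - tpoly c u).
have mt : measurable_fun `[0 : R, 1] (tpoly c).
  by apply: subspace_continuous_measurable_fun => //; apply: continuous_subspaceT; exact: continuous_tpoly.
have mg : measurable_fun `[0 : R, 1] g by exact: measurable_funB.
have [goo|] := ltP (sqint 1 g) +oo%E; last first.
  by rewrite leye_eq => /eqP ->; exact: leey.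
have [_ ig] := sqint_integrable mg goo.
have intf : mu.-integrable `[0, 1] (EFin \o f).
  rewrite (_ : f = (fun x => g x + tpoly c x)); last first.
    by apply/funext => x; rewrite /g subrK.
  apply: integrable_add => //; apply: continuous_itv_integrable; exact: continuous_tpoly.
apply: le_trans (bessel_inequality mg); rewrite lee_fin le_eqVlt; apply/orP; left; apply/eqP.
by apply: eq_bigr => j _; rewrite fourier_coefB.
Qed.

End bessel.

(** * The product prior *)

Section product_prior.
Context {R : realType} (J : finType) (L : nat).
Local Notation cube := {ffun 'I_L -> bool}.
Implicit Types (w : {ffun J -> cube}) (j : J).

Definition resample w j (v : cube) : {ffun J -> cube} :=
  [ffun i => if i == j then v else w i].

(** Redrawing one coordinate preserves the uniform law, because exchanging [w j] with the fresh [v]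
    is an involution on pairs. This is how one conditions on the other coordinates. *)
Lemma sum_resample (V : nmodType) (F : {ffun J -> cube} -> V) j :
  \sum_w \sum_v F (resample w j v) = \sum_w F w *+ (2 ^ L).
Proof.
rewrite pair_bigA/=.
pose swap (p : {ffun J -> cube} * cube) := (resample p.1 j p.2, p.1 j).
have swapK : involutive swap.
  move=> [w v]; rewrite /swap /= ffunE eqxx; congr pair.
  by apply/ffunP => i; rewrite !ffunE; case: eqP => [->|].
rewrite (reindex_inj (inv_inj swapK))/=.
rewrite (eq_bigr (fun p => F p.1)) => [|[w v] _]; last first.
  by congr F; apply/ffunP => i; rewrite !ffunE /=; case: eqP => [->|].
rewrite -(pair_bigA _ (fun w _ => F w))/=; apply: eq_bigr => w _.
by rewrite sumr_const card_cube.
Qed.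

Lemma walk_bound (v : cube) : `|walk v : R| <= L%:R.
Proof.
rewrite -[L in leRHS]card_ord -sumr_const (le_trans (ler_norm_sum _ _ _))//.
by apply: ler_sum => i _; rewrite normrX normrN1 expr1n.
Qed.

Let centered (a : J -> R) w j : R := a j * (walk (w j) ^+ 2 - L%:R).

Let sum_centered (a : J -> R) j (G : {ffun J -> cube} -> R) :
  (forall w v, G (resample w j v) = G w) ->
  \sum_w centered a w j * G w = 0.
Proof.
move=> GE; have h := sum_resample (fun w => centered a w j * G w) j.
have h0 : \sum_w \sum_v centered a (resample w j v) j * G (resample w j v) = 0.
  apply: big1 => w _; rewrite (eq_bigr (fun v : cube => G w * a j * (walk v ^+ 2 - L%:R))).
    rewrite -mulr_sumr sumrB sum_walk_sqr sumr_const card_cube.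
    by rewrite -[L%:R *+ (2 ^ L)]mulr_natl subrr mulr0.
  by move=> v _; rewrite GE /centered ffunE eqxx; ring.
move: h; rewrite h0 sumrMnl => /esym/eqP; rewrite mulrn_eq0 expn_eq0/=.
by move=> /eqP.
Qed.

(** Variance of the Sobolev energy, for Chebyshev's inequality: the terms are independent and
    centred, so cross products vanish, and squares are bounded through [|walk| <= L]. *)
Lemma sum_centered_sqr (a : J -> R) : (0 < L)%N ->
  \sum_(w : {ffun J -> cube}) (\sum_j a j * (walk (w j) ^+ 2 - L%:R)) ^+ 2 <=
  #|{ffun J -> cube}|%:R * (L%:R ^+ 4 * \sum_j a j ^+ 2).
Proof.
move=> L0.
rewrite (eq_bigr (fun w => \sum_j \sum_i centered a w j * centered a w i)); last first.
  by move=> w _; rewrite expr2 mulr_suml; apply: eq_bigr => j _; rewrite mulr_sumr.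
rewrite exchange_big/= mulr_sumr mulr_sumr; apply: ler_sum => j _.
rewrite exchange_big/= (bigD1 j)//= [X in _ + X]big1 ?addr0; last first.
  by move=> i ij; apply: sum_centered => w v; rewrite /centered ffunE (negbTE ij).
apply: (@le_trans _ _ (\sum_(w : {ffun J -> cube}) L%:R ^+ 4 * a j ^+ 2)).
  apply: ler_sum => w _; rewrite /centered.
  have /ler_normlP[b1 b2] := walk_bound (w j).
  have L1 : 1 <= L%:R :> R by rewrite ler1n.
  have w2 : walk (w j) ^+ 2 <= L%:R ^+ 2 :> R by nra.
  have w0 : 0 <= walk (w j) ^+ 2 :> R by exact: sqr_ge0.
  set W := walk (w j) ^+ 2 in w2 w0 *.
  have W2 : (W - L%:R) ^+ 2 <= L%:R ^+ 4.
    have : W - L%:R <= L%:R ^+ 2 by lra.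
    have : - (L%:R ^+ 2) <= W - L%:R by nra.
    rewrite (_ : L%:R ^+ 4 = (L%:R ^+ 2) ^+ 2 :> R); last by rewrite -exprM.
    by move: (L%:R ^+ 2) (W - _) => l2 d *; nra.
  rewrite mulrC -expr2 exprMn mulrC; rewrite ler_wpM2r//; exact: sqr_ge0.
by rewrite sumr_const mulr_natl.
Qed.

End product_prior.

Section clipping.
Context {R : realType}.
Implicit Types (M x t : R).

(** Projection onto [[-M, M]]: it makes a coefficient estimate bounded without increasing its error
    for a parameter in that interval. *)
Definition clip M x : R := Num.max (- M) (Num.min M x).

Lemma clip_norm M x : 0 <= M -> `|clip M x| <= M.
Proof.
by move=> M0; rewrite ler_norml /clip le_max lexx/= ge_max ge_min lexx/= andbT; lra.
Qed.

Lemma clip_closer M x t : `|t| <= M -> (clip M x - t) ^+ 2 <= (x - t) ^+ 2.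
Proof.
rewrite ler_norml => /andP[t1 t2]; rewrite /clip.
have [xM|xM] := leP M x.
  have [M0|M0] := leP (- M) M; last by lra.
  nra.
have [Mx|Mx] := leP (- M) x; first by [].
nra.
Qed.

End clipping.

(** * From the risk of an estimator to the one-dimensional bounds *)

Section fixed_sample_size.
Context {R : realType} (Q : noise_law R) (s : R) (n : nat).
Variables (Shat : (R -> R) -> R -> R) (N L : nat) (h : 'I_N -> R).
Hypothesis s0 : 0 < s.
Hypothesis QB : brownian_law s Q.
Hypothesis mShat : estimators n Shat.
Hypothesis L0 : (0 < L)%N.
Hypothesis h0 : forall m, 0 <= h m.
Local Notation mu := (@lebesgue_measure R).
Local Notation cube := {ffun 'I_L -> bool}.
Local Notation J := ('I_N * bool)%type.
Local Notation W := {ffun J -> cube}.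
Local Notation obsType := (g_sigma_algebraType (observation_cylinders n)).

Definition prior_coef (w : W) (j : J) : R := h j.1 * walk (w j).

Let theta := prior_coef.
Let obs w (x : path_space R) : R -> R := observation (tpoly (theta w)) x.
Let T (j : J) (y : R -> R) : R := clip (h j.1 * L%:R) (fourier_coef (Shat y) j).

Let Phi (j : J) (t : R) : R := \int[mu]_(u in `[0, t]) trig j.2 j.1.+1 u.

Lemma primitive_tpoly (c : J -> R) (t : R) :
  \int[mu]_(u in `[0, t]) tpoly c u = \sum_j c j * Phi j t.
Proof.
rewrite /tpoly Rintegral_sum//; last first.
  move=> j; apply: continuous_itv_integrable => x.
  by apply: cvgM; [exact: cvg_cst|exact: continuous_trig].
apply: eq_bigr => j _; rewrite RintegralZl//.
by apply: continuous_itv_integrable; exact: continuous_trig.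
Qed.

Let M_ge0 (j : J) : 0 <= h j.1 * L%:R. Proof. by rewrite mulr_ge0. Qed.

Let theta_bound w j : `|theta w j| <= h j.1 * L%:R.
Proof. by rewrite normrM ger0_norm// ler_wpM2l// walk_bound. Qed.

Let mT j : measurable_fun setT (T j : obsType -> R).
Proof.
have mc : measurable_fun setT ((fun y => fourier_coef (Shat y) j) : obsType -> R).
  apply: (measurable_section_Rintegral (T := obsType)
    (f := fun y u => Shat y u * trig j.2 j.1.+1 u)).
  apply: measurable_funM => //.
  apply: (measurable_comp (F := setT)) => //.
    apply: continuous_measurable_fun; exact: continuous_trig.
  exact: measurable_funTS.
by apply: measurable_maxr => //; apply: measurable_minr.
Qed.

Let mobs w : measurable_fun setT (obs w : path_space R -> obsType).
Proof.
have D0 u : [set u : R | 0 <= u <= n%:R] u -> 0 <= u by move=> /andP[].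
exact: (measurable_shifted_path (D := [set u : R | 0 <= u <= n%:R]) _ D0).
Qed.

Let err w j x : \bar R := ((T j (obs w x) - theta w j) ^+ 2)%:E.

Let merr w j : measurable_fun setT (err w j).
Proof.
apply/measurable_EFinP; apply: measurable_funX; apply: measurable_funB => //.
exact: (measurableT_comp (mT j) (mobs w)).
Qed.

Let err0 w j x : (0 <= err w j x)%E.
Proof. by rewrite lee_fin sqr_ge0. Qed.

(** With the other coefficients fixed the problem is one-dimensional. The information is [n / s]
    because a normalised trigonometric function has energy [n] over [n] periods. *)
Lemma coordinate_bound (j : J) :
  ((#|W|%:R * bayes_level L (h j.1) (n%:R / s))%:E <= \sum_w \int[Q]_x err w j x)%E.
Proof.
have core w : (((2 ^ L)%:R * bayes_level L (h j.1) (n%:R / s))%:E <=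
    \sum_(v : cube) \int[Q]_x err (resample w j v) j x)%E.
  pose g t := \sum_(i | i != j) theta w i * Phi i t.
  have ct := @continuous_trig R j.2 j.1.+1.
  have P0 : Phi j 0 = 0 by rewrite /Phi set_itv1 Rintegral_set1.
  have PV a b : 0 <= a -> a <= b -> b <= n%:R ->
      (Phi j b - Phi j a) ^+ 2 <= (b - a) *
        (\int[mu]_(u in `[0, b]) (trig j.2 j.1.+1 u * trig j.2 j.1.+1 u) -
         \int[mu]_(u in `[0, a]) (trig j.2 j.1.+1 u * trig j.2 j.1.+1 u)).
    by move=> a0 ab _; exact: Rintegral_cauchy_schwarz.
  have VK : \int[mu]_(u in `[0, n%:R]) (trig j.2 j.1.+1 u * trig j.2 j.1.+1 u) -
      \int[mu]_(u in `[0, 0]) (trig j.2 j.1.+1 u * trig j.2 j.1.+1 u) <= n%:R.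
    by rewrite trig_orthonormal// !eqxx mulr1 set_itv1 Rintegral_set1 subr0.
  have := bayes_lower_bound (V := fun b => \int[mu]_(u in `[0, b]) (trig j.2 j.1.+1 u * trig j.2 j.1.+1 u))
     s0 QB P0 PV VK (h j.1) g L0 (mT j) (fun y => clip_norm _ (M_ge0 j)).
  move=> /le_trans; apply; apply: lee_sum => v _.
  rewrite (eq_integral (err (resample w j v) j))// => x _.
  rewrite /err /obs /theta /prior_coef ffunE eqxx; congr ((_ - _) ^+ 2)%:E; congr (T j _).
  apply/funext => t; rewrite /shifted_path /observation; congr (_ + _).
  rewrite primitive_tpoly (bigD1 j)//= addrC; congr (_ + _); last by rewrite ffunE eqxx.
  by apply: eq_bigr => i ij; rewrite ffunE (negbTE ij).
have : (\sum_(w : W) ((2 ^ L)%:R * bayes_level L (h j.1) (n%:R / s))%:E <=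
    \sum_(w : W) \sum_(v : cube) \int[Q]_x err (resample w j v) j x)%E.
  by apply: lee_sum => w _; exact: core.
rewrite (sum_resample (fun w => \int[Q]_x err w j x)%E j) sumEFin sumr_const => H.
have L20 : 0 < (2 ^ L)%:R :> R by rewrite ltr0n expn_gt0.
rewrite -(@lee_pmul2l _ (2 ^ L)%:R%:E)//.
apply: le_trans (le_trans _ H) _.
  by rewrite -EFinM lee_fin -mulr_natl; rewrite le_eqVlt; apply/orP; left; apply/eqP; ring.
rewrite ge0_sume_distrr; last by move=> w _; apply: integral_ge0.
by apply: lee_sum => w _; rewrite mule_natl.
Qed.

(** Bessel's inequality bounds the loss below by the coefficient errors, which clipping does not
    increase. *)
Lemma risk_coefficients (w : W) :
  (\sum_j \int[Q]_x err w j x <= risk Q Shat (tpoly (theta w)))%E.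
Proof.
rewrite -ge0_integral_sum//; apply: ge0_le_integral => //.
- by move=> x _; apply: sume_ge0.
- by apply: emeasurable_sum.
- have mS : measurable_fun setT ((fun y => sqint 1 (fun u => Shat y u - tpoly (theta w) u)%R) : obsType -> \bar R).
    apply: (measurable_section_integral (T := obsType)
      (F := fun y u => ((Shat y u - tpoly (theta w) u) ^+ 2)%:E)).
      apply/measurable_EFinP; apply: measurable_funX; apply: measurable_funB => //.
      apply: (measurable_comp (F := setT)) => //.
        apply: continuous_measurable_fun; exact: continuous_tpoly.
      exact: measurable_funTS.
    by move=> y u; rewrite lee_fin sqr_ge0.
  exact: (measurableT_comp mS (mobs w)).
- move=> x _; rewrite sumEFin.
  have my : measurable_fun `[0 : R, 1] (Shat (obs w x)).
    exact: (measurable_section (T := obsType) (f := Shat)).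
  apply: le_trans (coefficient_distance (theta w) my).
  by rewrite lee_fin; apply: ler_sum => j _; apply: clip_closer; exact: theta_bound.
Qed.

(** Used for draws outside the ball, where the risk is not controlled: two points of [[-M, M]] are
    at distance at most [2 M]. *)
Lemma error_bound (w : W) :
  (\sum_j \int[Q]_x err w j x <= (4 * \sum_(j : J) (h j.1 * L%:R) ^+ 2)%:E)%E.
Proof.
rewrite mulr_sumr -sumEFin; apply: lee_sum => j _.
apply: (@le_trans _ _ (\int[Q]_x (4 * (h j.1 * L%:R) ^+ 2)%:E)%E).
  apply: ge0_le_integral => //.
  move=> x _; rewrite lee_fin.
  have := clip_norm (fourier_coef (Shat (obs w x)) j) (M_ge0 j).
  have := theta_bound w j; rewrite -/(T j _) !ler_norml => /andP[? ?] /andP[? ?].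
  nra.
by rewrite integral_cst// (_ : (_ * _)%E = (4 * (h j.1 * L%:R) ^+ 2)%:E)// [X in (_ * X)%E](_ : _ = 1%E) ?mule1//; exact: probability_setT.
Qed.

Lemma prior_risk_bound (good : pred W) (rho : R) : 0 <= rho ->
  (forall w, good w -> (risk Q Shat (tpoly (prior_coef w)) <= rho%:E)%E) ->
  \sum_(j : J) bayes_level L (h j.1) (n%:R / s) <=
  rho + (#|[pred w | ~~ good w]|%:R / #|W|%:R) * (4 * \sum_(j : J) (h j.1 * L%:R) ^+ 2).
Proof.
move=> rho0 hgood; set B := 4 * _.
have B0 : 0 <= B by rewrite mulr_ge0// sumr_ge0// => j _; exact: sqr_ge0.
have W0 : 0 < #|W|%:R :> R.
  by rewrite ltr0n card_ffun expn_gt0 card_cube expn_gt0.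
have H1 : ((#|W|%:R * \sum_(j : J) bayes_level L (h j.1) (n%:R / s))%:E <=
          \sum_(w : W) \sum_j \int[Q]_x err w j x)%E.
  rewrite exchange_big/= mulr_sumr -sumEFin; apply: lee_sum => j _.
  exact: coordinate_bound.
have H2 : (\sum_(w : W) \sum_j \int[Q]_x err w j x <=
    (#|W|%:R * rho + #|[pred w | ~~ good w]|%:R * B)%:E)%E.
  apply: (@le_trans _ _ (\sum_(w : W) (rho + (~~ good w)%:R * B)%:E)%E).
    apply: lee_sum => w _; have [gw|bw] := boolP (good w).
      rewrite mul0r addr0; apply: le_trans (hgood w gw); exact: risk_coefficients.
    by rewrite mul1r; apply: le_trans (error_bound w) _; rewrite lee_fin lerDr.
  rewrite sumEFin lee_fin big_split/= sumr_const mulr_natl lerD2l -mulr_suml.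
  rewrite ler_wpM2r// -sum1_card natr_sum big_mkcond/= le_eqVlt; apply/orP; left; apply/eqP.
  by rewrite [RHS]big_mkcond/=; apply: eq_bigr => w _; rewrite inE; case: (good w).
have := le_trans H1 H2; rewrite lee_fin => H.
rewrite -(ler_pM2l W0) (le_trans H)// mulrDr lerD2l le_eqVlt; apply/orP; left; apply/eqP.
by field; rewrite gt_eqF.
Qed.

End fixed_sample_size.

(** * Pinsker's weights *)

Section power_sums.
Context {R : realType}.

(** Discrete form of the derivative of [x^(k+1)]; it telescopes into both power sum estimates. *)
Lemma pow_step (k : nat) (x : R) : 0 <= x ->
  k.+1%:R * x ^+ k <= (x + 1) ^+ k.+1 - x ^+ k.+1 <= k.+1%:R * (x + 1) ^+ k.
Proof.
move=> x0; rewrite subrXX addrAC subrr add0r mul1r /=.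
have x1 : x <= x + 1 by rewrite lerDl.
have x10 : 0 <= x + 1 by rewrite addr_ge0.
have ik (i : 'I_k.+1) : (i <= k)%N by rewrite -ltnS.
apply/andP; split.
  rewrite -[k.+1 in leLHS]card_ord mulr_natl -sumr_const; apply: ler_sum => i _.
  rewrite (_ : x ^+ k = x ^+ (k - i) * x ^+ i); last by rewrite -exprD subnK.
  by rewrite ler_wpM2r ?exprn_ge0// lerXn2r// ?nnegrE.
rewrite -[k.+1 in leRHS]card_ord mulr_natl -sumr_const; apply: ler_sum => i _.
rewrite [leRHS](_ : _ = (x + 1) ^+ (k - i) * (x + 1) ^+ i); last by rewrite -exprD subnK.
by rewrite ler_wpM2l ?exprn_ge0// lerXn2r// ?nnegrE.
Qed.

Lemma sum_pow_le (k N : nat) :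
  \sum_(i < N) (i.+1%:R : R) ^+ k <= N%:R ^+ k.+1 / k.+1%:R + N%:R ^+ k.
Proof.
have k0 : 0 < k.+1%:R :> R by [].
elim: N => [|N IH]; first by rewrite big_ord0 addr_ge0// ?divr_ge0 ?exprn_ge0.
rewrite big_ord_recr/= lerD2r (le_trans IH)// ler_pdivlMr// mulrDl divfK ?gt_eqF//.
have /andP[+ _] := @pow_step k N%:R (ler0n _ _).
by rewrite natr1 mulrC; lra.
Qed.

Lemma sum_pow_ge (k N : nat) :
  N%:R ^+ k.+1 / k.+1%:R <= \sum_(i < N) (i.+1%:R : R) ^+ k.
Proof.
have k0 : 0 < k.+1%:R :> R by [].
elim: N => [|N IH]; first by rewrite big_ord0 expr0n/= mul0r.
rewrite big_ord_recr/= (le_trans _ (lerD IH (lexx _)))// ler_pdivrMr// mulrDl divfK ?gt_eqF//.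
have /andP[_] := @pow_step k N%:R (ler0n _ _).
by rewrite natr1 [_ ^+ k * _]mulrC; lra.
Qed.

End power_sums.

Section pinsker_weights.
Context {R : realType} (k N q L : nat) (eta c0 : R).
Hypothesis k1 : (1 <= k)%N.
Hypothesis N1 : (1 <= N)%N.
Hypothesis q1 : (1 <= q)%N.
Hypothesis L1 : (1 <= L)%N.
Hypothesis eta01 : 0 < eta < 1.
Hypothesis c00 : 0 < c0.
Implicit Types (i : 'I_N).

(* The factor [1 - eta] leaves room for the fluctuations of the Sobolev energy, and
   dropping the frequencies below [N / q] keeps the variances below [c0 q^k]
   whatever [N] is. *)
Definition pinsker_var i : R :=
  if (N %/ q < i.+1)%N then (1 - eta) * c0 * ((N%:R / i.+1%:R) ^+ k - 1) else 0.

Definition pinsker_amp i : R := Num.sqrt (pinsker_var i / L%:R).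

Let N0 : 0 < N%:R :> R. Proof. by rewrite ltr0n. Qed.
Let L0 : 0 < L%:R :> R. Proof. by rewrite ltr0n. Qed.

Let ratio_ge1 i : 1 <= (N%:R / i.+1%:R : R) ^+ k.
Proof. by rewrite exprn_ege1// ler_pdivlMr// mul1r ler_nat ltn_ord. Qed.

Let ratio_le i : (N %/ q < i.+1)%N -> (N%:R / i.+1%:R : R) ^+ k <= q%:R ^+ k.
Proof.
move=> Nq; rewrite ler_pXn2r ?nnegrE ?divr_ge0//.
rewrite ler_pdivrMr// -natrM ler_nat mulnC ltnW//.
by rewrite -ltn_divLR.
Qed.

Lemma pinsker_var_ge0 i : 0 <= pinsker_var i.
Proof.
rewrite /pinsker_var; case: ifP => // _; have := ratio_ge1 i.
case/andP: eta01 => e0 e1 h.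
by apply: mulr_ge0; [apply: mulr_ge0; [lra|exact: ltW]|rewrite subr_ge0].
Qed.

Lemma pinsker_var_le i : pinsker_var i <= c0 * q%:R ^+ k.
Proof.
rewrite /pinsker_var; case: ifP => [Nq|_]; last by rewrite mulr_ge0// ltW.
have r1 := ratio_ge1 i; have rq := ratio_le Nq; case/andP: eta01 => e0 e1.
move: r1 rq; move: (_ ^+ k) (q%:R ^+ k) => t u r1 rq.
have t0 : 0 <= c0 * (t - 1) by apply: mulr_ge0; [exact: ltW|rewrite subr_ge0].
have : (1 - eta) * (c0 * (t - 1)) <= 1 * (c0 * (t - 1)) by apply: ler_wpM2r => //; lra.
have : c0 * (t - 1) <= c0 * u by rewrite ler_pM2l//; lra.
by rewrite mul1r mulrA => *; lra.
Qed.

Lemma pinsker_amp_ge0 i : 0 <= pinsker_amp i.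
Proof. exact: sqrtr_ge0. Qed.

Lemma pinsker_amp_sqr i : pinsker_amp i ^+ 2 * L%:R = pinsker_var i.
Proof.
rewrite sqr_sqrtr; last by rewrite divr_ge0// pinsker_var_ge0.
by rewrite divfK// gt_eqF.
Qed.

(** With [t = (N / m)^k] and variance [u = (1 - eta) c0 (t - 1)], one has [1 + u / c0 <= t], so [u /
    (1 + u / c0) >= (1 - eta) c0 (1 - 1/t)]. The exponential is at least [1 - 4 q^k / L] since
    [u <= c0 q^k]. For a dropped frequency the left-hand side is non-positive. *)
Lemma pinsker_level i : 0 <= 1 - 4 * q%:R ^+ k / L%:R :> R ->
  (1 - eta) * c0 * (1 - 4 * q%:R ^+ k / L%:R) *
    ((1 - (i.+1%:R / N%:R : R) ^+ k) - (i.+1 <= N %/ q)%N%:R)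
  <= bayes_level L (pinsker_amp i) c0^-1.
Proof.
set beta := (X in 0 <= X) => b0; case/andP: eta01 => e0 e1.
have xk0 : 0 <= (i.+1%:R / N%:R : R) ^+ k by rewrite exprn_ge0// divr_ge0.
have cb : 0 <= (1 - eta) * c0 * beta by rewrite !mulr_ge0// ?(ltW c00)//; lra.
rewrite /bayes_level pinsker_amp_sqr (mulrC L%:R) pinsker_amp_sqr.
rewrite [(i.+1 <= _)%N]leqNgt.
have [Nq|Nq] := boolP (N %/ q < i.+1)%N; last first.
  rewrite /pinsker_var (negbTE Nq) !mul0r.
  by rewrite mulr_ge0_le0//= ; lra.
rewrite /= subr0.
have v0 := pinsker_var_ge0 i; have vq := pinsker_var_le i.
have E : beta <= expR (- (4 * pinsker_amp i ^+ 2 * c0^-1)).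
  apply: le_trans (expR_ge1Dx _); rewrite lerD2l lerN2.
  rewrite ler_pdivlMr// (_ : 4 * _ * c0^-1 * _ = 4 * (pinsker_amp i ^+ 2 * L%:R) * c0^-1); last by ring.
  by rewrite pinsker_amp_sqr ler_pdivrMr// -mulrA ler_pM2l// mulrC.
set e := expR _ in E *; set u := pinsker_var i in v0 vq *.
have u0 : 0 < 1 + u * c0^-1 by rewrite ltr_pwDl// mulr_ge0// invr_ge0 ltW.
apply: (@le_trans _ _ (u * beta / (1 + u * c0^-1))); last first.
  by rewrite ler_wpM2r ?invr_ge0 ?(ltW u0)// ler_wpM2l.
rewrite ler_pdivlMr//.
have r1 := ratio_ge1 i.
have tx : (N%:R / i.+1%:R : R) ^+ k * (i.+1%:R / N%:R) ^+ k = 1.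
  by rewrite -exprMn mulrA divfK ?divff ?expr1n// pnatr_eq0 -lt0n.
move: r1 tx xk0; rewrite /u /pinsker_var Nq; move: ((N%:R / i.+1%:R) ^+ k) ((i.+1%:R / N%:R) ^+ k) => t y.
move=> r1 tx xk0.
rewrite (_ : (1 - eta) * c0 * (t - 1) * c0^-1 = (1 - eta) * (t - 1)); last first.
  by field; rewrite gt_eqF.
rewrite (_ : (1 - eta) * c0 * (t - 1) * beta = (1 - eta) * c0 * beta * (t - 1)); last by ring.
rewrite -[leLHS]mulrA; apply: ler_wpM2l => //.
have y1 : y <= 1 by nra.
apply: (@le_trans _ _ ((1 - y) * t)); last by rewrite mulrBl mul1r mulrC tx.
apply: ler_wpM2l; first by rewrite subr_ge0.
have : (1 - eta) * (t - 1) <= 1 * (t - 1) by apply: ler_wpM2r; lra.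
lra.
Qed.

End pinsker_weights.

Section pinsker_sums.
Context {R : realType} (k N q L : nat) (eta c0 r : R).
Hypothesis k1 : (1 <= k)%N.
Hypothesis N1 : (1 <= N)%N.
Hypothesis q1 : (1 <= q)%N.
Hypothesis L1 : (1 <= L)%N.
Hypothesis eta01 : 0 < eta < 1.
Hypothesis c00 : 0 < c0.
Implicit Types (i : 'I_N).
Local Notation var := (@pinsker_var R k N q eta c0).
Local Notation amp := (@pinsker_amp R k N q L eta c0).

Let N0 : 0 < N%:R :> R. Proof. by rewrite ltr0n. Qed.
Let k0 : 0 < k%:R :> R. Proof. by rewrite ltr0n. Qed.
Let q0 : 0 < q%:R :> R. Proof. by rewrite ltr0n. Qed.

Lemma sum_leq_indicator (M n : nat) : \sum_(i < n) (i.+1 <= M)%N%:R <= M%:R :> R.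
Proof.
suff : (\sum_(i < n) (i.+1 <= M)%N <= minn n M)%N.
  by rewrite -natr_sum ler_nat => /leq_trans -> //; exact: geq_minr.
elim: n => [|n IH]; first by rewrite big_ord0.
rewrite big_ord_recr/=; case: (leqP n.+1 M) => h.
  by rewrite addn1 ltnS (leq_trans IH)// geq_minl.
by rewrite addn0 (leq_trans IH)// geq_minr.
Qed.

(** The 2 counts cosine and sine, [k / (k + 1)] is the limiting mean of [1 - (m / N)^k], [1 / q] the
    share of dropped frequencies, and the final 1 the error of the power sum. *)
Lemma level_sum : 0 <= 1 - 4 * q%:R ^+ k / L%:R :> R ->
  2 * ((1 - eta) * c0 * (1 - 4 * q%:R ^+ k / L%:R) *
    (N%:R * (k%:R / k.+1%:R - q%:R^-1) - 1)) <=
  \sum_(j : 'I_N * bool) bayes_level L (amp j.1) c0^-1.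
Proof.
set beta := (X in 0 <= X) => b0; case/andP: (eta01) => e0 e1.
rewrite sum_pair_bool (eq_bigr (fun i => 2 * bayes_level L (amp i) c0^-1)); last first.
  by move=> i _; rewrite /= mulr_natl.
rewrite -mulr_sumr ler_pM2l//.
have cb : 0 <= (1 - eta) * c0 * beta.
  by apply: mulr_ge0 => //; apply: mulr_ge0; [rewrite subr_ge0 ltW|exact: ltW].
apply: (@le_trans _ _ (\sum_(i < N) (1 - eta) * c0 * beta *
    ((1 - (i.+1%:R / N%:R : R) ^+ k) - (i.+1 <= N %/ q)%N%:R))); last first.
  by apply: ler_sum => i _; exact: pinsker_level.
rewrite -mulr_sumr; apply: ler_wpM2l => //.
rewrite !sumrB sumr_const card_ord.
have S1 : \sum_(i < N) (i.+1%:R / N%:R : R) ^+ k <= N%:R / k.+1%:R + 1.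
  under eq_bigr do rewrite expr_div_n.
  rewrite -mulr_suml ler_pdivrMr ?exprn_gt0// (le_trans (sum_pow_le k N))//.
  rewrite mulrDl mul1r lerD2r le_eqVlt; apply/orP; left; apply/eqP.
  by rewrite exprS; field; rewrite nat1r pnatr_eq0.
have S2 := sum_leq_indicator (N %/ q) N.
have S3 : (N %/ q)%:R <= N%:R / q%:R :> R.
  by rewrite ler_pdivlMr// -natrM ler_nat leq_divM.
have -> : N%:R * (k%:R / k.+1%:R - q%:R^-1) - 1 = N%:R - (N%:R / k.+1%:R + 1) - N%:R / q%:R :> R.
  by rewrite -(natr1 k); field; rewrite natr1 !pnatr_eq0 -lt0n q1.
exact: lerB (lerB (lexx _) S1) (le_trans S2 S3).
Qed.

(** The top derivative dominates: each of the [k] other terms is at most [freq m ^+ (2 * k) / m], as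
    [freq m ^+ 2 >= m]. *)
Lemma sobolev_weight_le (m : nat) : (0 < m)%N ->
  \sum_(l < k.+1) freq m ^+ (2 * l) <= freq m ^+ (2 * k) * (1 + k%:R / m%:R) :> R.
Proof.
move=> m0; have m0' : 0 < m%:R :> R by rewrite ltr0n.
have m1 : 1 <= m%:R :> R by rewrite ler1n.
have fm : m%:R <= freq m :> R.
  by rewrite /freq ler_peMl// ?ler0n//; have := @pi_ge2 R; lra.
have f1 : 1 <= freq m :> R by exact: le_trans fm.
have f0 : 0 < freq m :> R by exact: lt_le_trans f1.
rewrite big_ord_recr/= mulrDr mulr1 addrC lerD2l.
case: (k) k1 => // k' _.
apply: (@le_trans _ _ (\sum_(l < k'.+1) freq m ^+ (2 * k'))).
  by apply: ler_sum => l _; rewrite ler_weXn2l// leq_mul2l/= -ltnS.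
rewrite sumr_const card_ord -[leLHS]mulr_natl mulnS exprD.
rewrite (_ : _ * (_ / _) = k'.+1%:R * freq m ^+ (2 * k') * (freq m ^+ 2 / m%:R)); last by ring.
rewrite ler_peMr//; first by rewrite mulr_ge0// exprn_ge0// ltW.
by rewrite ler_pdivlMr// mul1r (le_trans fm)// expr2 ler_peMl// ltW.
Qed.

(** The third factor bounds [1 + k / m] from [sobolev_weight_le] for the frequencies kept,
    [m > N / q]. *)
Let scale : R := (1 - eta) * c0 * (1 + k%:R * q%:R / N%:R) * (2 * pi) ^+ (2 * k).

Let scale0 : 0 <= scale.
Proof.
case/andP: eta01 => e0 e1; rewrite /scale; apply: mulr_ge0; last first.
  by rewrite exprn_ge0// mulr_ge0// pi_ge0.
apply: mulr_ge0; last by rewrite addr_ge0// divr_ge0// mulr_ge0.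
by apply: mulr_ge0; [rewrite subr_ge0 ltW|exact: ltW].
Qed.

Let weight i : R := \sum_(l < k.+1) freq i.+1 ^+ (2 * l).

Lemma weighted_var_le i :
  weight i * var i <= scale * (N%:R ^+ k * i.+1%:R ^+ k - i.+1%:R ^+ (2 * k)).
Proof.
have i0 : 0 < i.+1%:R :> R by [].
have iN : i.+1%:R <= N%:R :> R by rewrite ler_nat ltn_ord.
have iNk : 0 <= N%:R ^+ k * i.+1%:R ^+ k - i.+1%:R ^+ (2 * k) :> R.
  rewrite mul2n -addnn exprD subr_ge0 ler_wpM2r ?exprn_ge0//.
  by rewrite lerXn2r// ?nnegrE.
rewrite /pinsker_var; case: ifP => [Nq|_]; last by rewrite mulr0 mulr_ge0.
have v0 : 0 <= (1 - eta) * c0 * ((N%:R / i.+1%:R) ^+ k - 1).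
  have : 0 <= var i by apply: pinsker_var_ge0.
  by rewrite /pinsker_var Nq.
apply: (le_trans (ler_wpM2r v0 (sobolev_weight_le (ltn0Sn i)))).
have iq : k%:R / i.+1%:R <= k%:R * q%:R / N%:R :> R.
  rewrite -mulrA ler_pM2l// ler_pdivlMr// mulrC ler_pdivrMr// -natrM ler_nat mulnC.
  by rewrite ltnW// -ltn_divLR.
apply: (@le_trans _ _ (freq i.+1 ^+ (2 * k) * (1 + k%:R * q%:R / N%:R) *
   ((1 - eta) * c0 * ((N%:R / i.+1%:R) ^+ k - 1)))).
  rewrite ler_wpM2r// ler_wpM2l ?lerD2l// exprn_ge0//.
  exact/ltW/freq_gt0.
rewrite le_eqVlt; apply/orP; left; apply/eqP.
have E : i.+1%:R ^+ (2 * k) = i.+1%:R ^+ k * i.+1%:R ^+ k :> R.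
  by rewrite mul2n -addnn exprD.
rewrite /scale /freq exprMn expr_div_n E.
have : i.+1%:R ^+ k != 0 :> R by rewrite expf_neq0// pnatr_eq0.
move: (i.+1%:R ^+ k) ((2 * pi) ^+ (2 * k)) (N%:R ^+ k) => y p z y0.
by field; rewrite y0 gt_eqF.
Qed.

Hypothesis r0 : 0 < r.
(** [1 / G = 1 / (k + 1) - 1 / (2 k + 1)] is the leading coefficient of the sum of
    [N^k m^k - m^(2 k)]. Hence [c0N] says that the main part of the energy, without the factor
    [1 - eta], is at most [r]. *)
Let G : R := k.+1%:R * (2 * k).+1%:R / k%:R.
Hypothesis c0N : 2 * c0 * (2 * pi) ^+ (2 * k) * N%:R ^+ (2 * k).+1 <= G * r.

Let scaleN : 2 * scale * N%:R ^+ (2 * k).+1 <=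
  (1 - eta) * (1 + k%:R * q%:R / N%:R) * (G * r).
Proof.
case/andP: eta01 => e0 e1; rewrite /scale.
rewrite (_ : 2 * _ * _ = (1 - eta) * (1 + k%:R * q%:R / N%:R) *
  (2 * c0 * (2 * pi) ^+ (2 * k) * N%:R ^+ (2 * k).+1)); last by ring.
apply: ler_wpM2l => //; apply: mulr_ge0; first by rewrite subr_ge0 ltW.
by rewrite addr_ge0// divr_ge0// mulr_ge0.
Qed.

Let G0 : 0 < G. Proof. by rewrite /G divr_gt0// mulr_gt0. Qed.

Lemma prior_energy_mean :
  \sum_(j : 'I_N * bool) weight j.1 * var j.1 <=
  (1 - eta) * (1 + k%:R * q%:R / N%:R) * (1 + G / N%:R) * r.
Proof.
rewrite sum_pair_bool (eq_bigr (fun i => 2 * (weight i * var i))); last first.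
  by move=> i _; rewrite /= mulr_natl.
rewrite -mulr_sumr.
have S : \sum_(i < N) weight i * var i <= scale * (N%:R ^+ (2 * k).+1 * (G^-1 + N%:R^-1)).
  apply: le_trans; first by apply: ler_sum => i _; exact: weighted_var_le.
  rewrite -mulr_sumr; apply: ler_wpM2l => //; rewrite sumrB -mulr_sumr.
  have u := sum_pow_le k N; have l := sum_pow_ge (2 * k) N.
  have Nk0 : 0 <= N%:R ^+ k :> R by rewrite exprn_ge0.
  apply: le_trans; first by apply: lerB; [apply: ler_wpM2l; [exact: Nk0|exact: u]|exact: l].
  rewrite le_eqVlt; apply/orP; left; apply/eqP.
  rewrite /G -(natr1 k) -(natr1 (2 * k)) natrM !exprS mul2n -addnn exprD.
  have h1 : k%:R + 1 != 0 :> R by rewrite natr1 pnatr_eq0.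
  have h2 : 2 * k%:R + 1 != 0 :> R by rewrite -natrM natr1 pnatr_eq0.
  have h3 : N%:R != 0 :> R by rewrite gt_eqF.
  have h4 : k%:R != 0 :> R by rewrite gt_eqF.
  move: (N%:R ^+ k) => y; field; rewrite ?h1 ?h2 ?h3 ?h4//.
apply: (@le_trans _ _ (2 * (scale * (N%:R ^+ (2 * k).+1 * (G^-1 + N%:R^-1))))).
  by rewrite ler_pM2l.
rewrite (_ : 2 * _ = 2 * scale * N%:R ^+ (2 * k).+1 * (G^-1 + N%:R^-1)); last by ring.
have p : 0 <= G^-1 + N%:R^-1 by rewrite addr_ge0// invr_ge0// ltW.
apply: (le_trans (ler_wpM2r p scaleN)); rewrite le_eqVlt; apply/orP; left; apply/eqP.
field.
by rewrite !gt_eqF.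
Qed.

(** No frequency carries more than a share [O(1 / N)] of the energy, so the sum of squares in
    Chebyshev's inequality is [O(1 / N)]. *)
Lemma prior_energy_max i :
  weight i * var i <= (1 + k%:R * q%:R) * G * r / (2 * N%:R).
Proof.
apply: (le_trans (weighted_var_le i)).
have iN : i.+1%:R <= N%:R :> R by rewrite ler_nat ltn_ord.
have Nk : N%:R ^+ k * i.+1%:R ^+ k - i.+1%:R ^+ (2 * k) <= N%:R ^+ (2 * k) :> R.
  rewrite mul2n -addnn !exprD lerBlDr (@le_trans _ _ (N%:R ^+ k * N%:R ^+ k))//.
    by rewrite ler_wpM2l ?exprn_ge0// lerXn2r// ?nnegrE.
  by rewrite lerDl mulr_ge0 ?exprn_ge0.
apply: (le_trans (ler_wpM2l scale0 Nk)); rewrite ler_pdivlMr ?mulr_gt0//.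
rewrite (_ : _ * (2 * _) = 2 * scale * N%:R ^+ (2 * k).+1); last by rewrite exprS; ring.
apply: (le_trans scaleN); case/andP: eta01 => e0 e1.
have N1' : 1 <= N%:R :> R by rewrite ler1n.
rewrite -mulrA -[leRHS]mulrA; have Gr : 0 <= G * r by rewrite mulr_ge0// ltW.
have kq : 0 <= k%:R * q%:R :> R by rewrite mulr_ge0.
have kqN : k%:R * q%:R / N%:R <= k%:R * q%:R :> R by rewrite ler_pdivrMr// ler_peMr.
have kq1 : 0 <= 1 + k%:R * q%:R / N%:R :> R by rewrite addr_ge0// divr_ge0.
apply: (@le_trans _ _ (1 * ((1 + k%:R * q%:R / N%:R) * (G * r)))).
  by apply: ler_wpM2r; [rewrite mulr_ge0|lra].
by rewrite mul1r; apply: ler_wpM2r => //; rewrite lerD2l.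
Qed.

End pinsker_sums.

(** * Leaving the Sobolev ball, and the bound for a given cut-off *)

Section minimax_lower_bound.
Context {R : realType} (Q : noise_law R) (s : R) (n : nat).
Variables (Shat : (R -> R) -> R -> R) (k N q L : nat) (eta r rho : R).
Hypothesis s0 : 0 < s.
Hypothesis n1 : (1 <= n)%N.
Hypothesis QB : brownian_law s Q.
Hypothesis mShat : estimators n Shat.
Hypothesis k1 : (1 <= k)%N.
Hypothesis N1 : (1 <= N)%N.
Hypothesis q1 : (1 <= q)%N.
Hypothesis L1 : (1 <= L)%N.
Hypothesis eta01 : 0 < eta < 1.
Hypothesis r0 : 0 < r.
Hypothesis rho0 : 0 <= rho.
Hypothesis riskle : forall S, sobolev_ball k r S -> (risk Q Shat S <= rho%:E)%E.

Local Notation c0 := (s / n%:R).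
Local Notation G := (k.+1%:R * (2 * k).+1%:R / k%:R : R).
Local Notation h := (@pinsker_amp R k N q L eta c0).
Local Notation var := (@pinsker_var R k N q eta c0).
Local Notation J := ('I_N * bool)%type.
Local Notation W := {ffun J -> {ffun 'I_L -> bool}}.

Hypothesis c0N : 2 * c0 * (2 * pi) ^+ (2 * k) * N%:R ^+ (2 * k).+1 <= G * r.
Hypothesis etaN :
  (1 - eta) * (1 + k%:R * q%:R / N%:R) * (1 + G / N%:R) <= 1 - eta / 2.
Hypothesis beta0 : 0 <= 1 - 4 * q%:R ^+ k / L%:R :> R.

(* The error made by bounding the risk trivially outside the Sobolev ball is at most
   [c0] times this constant, which depends neither on [n] nor on [N]. *)
Definition remainder_constant : R :=
  2 * L%:R ^+ 2 * ((1 + k%:R * q%:R) * G * r / 2) ^+ 2 / (r * eta / 2) ^+ 2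
  * (8 * L%:R * q%:R ^+ k).

Let c00 : 0 < c0. Proof. by rewrite divr_gt0// ltr0n. Qed.
Let N0 : 0 < N%:R :> R. Proof. by rewrite ltr0n. Qed.
Let L0 : 0 < L%:R :> R. Proof. by rewrite ltr0n. Qed.

Let weight (j : J) : R := \sum_(l < k.+1) freq j.1.+1 ^+ (2 * l).
Let good : pred W := fun w => \sum_j weight j * prior_coef h w j ^+ 2 <= r.

Let weight0 j : 0 <= weight j.
Proof. by apply: sumr_ge0 => l _; rewrite exprn_ge0// ltW// freq_gt0. Qed.

Let weight_var j : L%:R * (weight j * h j.1 ^+ 2) = weight j * var j.1.
Proof.
have <- : h j.1 ^+ 2 * L%:R = var j.1 by apply: pinsker_amp_sqr.
by rewrite mulrCA [h j.1 ^+ 2 * _]mulrC.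
Qed.

(** Chebyshev's inequality: by [etaN] the mean energy is at most [r - r * eta / 2], so a bad draw
    deviates by at least [r * eta / 2]. *)
Let card_bad : #|[pred w : W | ~~ good w]|%:R * (r * eta / 2) ^+ 2 <=
  #|W|%:R * (2 * L%:R ^+ 2 * ((1 + k%:R * q%:R) * G * r / 2) ^+ 2 / N%:R).
Proof.
pose a (j : J) := weight j * h j.1 ^+ 2.
have gap0 : 0 <= r * eta / 2 by case/andP: eta01 => e0 _; rewrite !mulr_ge0// ltW.
have a_mean : \sum_j L%:R * a j <= r - r * eta / 2.
  under eq_bigr do rewrite /a weight_var.
  have E := prior_energy_mean k1 N1 q1 eta01 c00 c0N.
  apply: (le_trans E).
  apply: (le_trans (ler_wpM2r (ltW r0) etaN)).
  by rewrite le_eqVlt; apply/orP; left; apply/eqP; field.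
have bad_dev w : (~~ good w)%:R * (r * eta / 2) ^+ 2 <=
    (\sum_j a j * (walk (w j) ^+ 2 - L%:R)) ^+ 2.
  case: (boolP (good w)) => [_|bw]; first by rewrite mul0r sqr_ge0.
  have dev : r * eta / 2 <= \sum_j a j * (walk (w j) ^+ 2 - L%:R).
    rewrite (eq_bigr (fun j => weight j * prior_coef h w j ^+ 2 - L%:R * a j)); last first.
      by move=> j _; rewrite /a /prior_coef; ring.
    rewrite sumrB; move: bw; rewrite /good -ltNge => bw; lra.
  by rewrite mul1r lerXn2r// nnegrE// (le_trans gap0).
apply: (@le_trans _ _ (\sum_(w : W) (\sum_j a j * (walk (w j) ^+ 2 - L%:R)) ^+ 2)).
  apply: le_trans; last by apply: ler_sum => w _; exact: bad_dev.
  rewrite -mulr_suml ler_wpM2r ?sqr_ge0// -sum1_card natr_sum big_mkcond/=.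
  by apply: ler_sum => w _; rewrite inE; case: (good w).
apply: (le_trans (sum_centered_sqr a L1)); apply: ler_wpM2l => //.
apply: (@le_trans _ _ (\sum_(j : J) L%:R ^+ 2 * ((1 + k%:R * q%:R) * G * r / (2 * N%:R)) ^+ 2)).
  rewrite mulr_sumr; apply: ler_sum => j _.
  rewrite (_ : _ * a j ^+ 2 = L%:R ^+ 2 * (L%:R * a j) ^+ 2); last by ring.
  apply: ler_wpM2l; first by rewrite sqr_ge0.
  have am : L%:R * a j <= (1 + k%:R * q%:R) * G * r / (2 * N%:R).
    rewrite /a weight_var.
    exact: (@prior_energy_max R k N q eta c0 r k1 N1 q1 eta01 c00 r0 c0N j.1).
  have a0 : 0 <= L%:R * a j by rewrite mulr_ge0// mulr_ge0// sqr_ge0.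
  by rewrite lerXn2r// nnegrE// (le_trans a0).
rewrite sumr_const card_prod card_ord card_bool -[leLHS]mulr_natr natrM.
rewrite le_eqVlt; apply/orP; left; apply/eqP; field.
by rewrite !gt_eqF// ltr0n.
Qed.

Lemma minimax_lower_bound :
  2 * ((1 - eta) * c0 * (1 - 4 * q%:R ^+ k / L%:R) *
    (N%:R * (k%:R / k.+1%:R - q%:R^-1) - 1)) <= rho + c0 * remainder_constant.
Proof.
have hgood (w : W) : good w -> (risk Q Shat (tpoly (prior_coef h w)) <= rho%:E)%E.
  by move=> gw; apply: riskle; apply: sobolev_tpoly.
have := prior_risk_bound s0 QB mShat L1 (@pinsker_amp_ge0 R k N q L eta c0) rho0 hgood.
rewrite -[n%:R / s]invf_div => H.
apply: (@le_trans _ _ (\sum_(j : J) bayes_level L (h j.1) c0^-1)); first exact: level_sum.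
apply: (le_trans H); rewrite lerD2l.
have gap0 : 0 < r * eta / 2 by case/andP: eta01 => e0 _; rewrite !mulr_gt0.
have W0 : 0 < #|W|%:R :> R.
  by rewrite ltr0n card_ffun expn_gt0 card_cube expn_gt0.
have S : 4 * (\sum_(j : J) (h j.1 * L%:R) ^+ 2) <= N%:R * (c0 * (8 * L%:R * q%:R ^+ k)).
  apply: (@le_trans _ _ (4 * \sum_(j : J) L%:R * (c0 * q%:R ^+ k))).
    rewrite ler_pM2l//; apply: ler_sum => j _.
    rewrite (_ : (h j.1 * L%:R) ^+ 2 = L%:R * (h j.1 ^+ 2 * L%:R)); last by ring.
    have -> : h j.1 ^+ 2 * L%:R = var j.1 by apply: pinsker_amp_sqr.
    by rewrite ler_pM2l//; apply: pinsker_var_le.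
  rewrite sumr_const card_prod card_ord card_bool -[X in _ * X <= _]mulr_natr natrM.
  rewrite le_eqVlt; apply/orP; left; apply/eqP; ring.
have B : #|[pred w : W | ~~ good w]|%:R / #|W|%:R <=
    2 * L%:R ^+ 2 * ((1 + k%:R * q%:R) * G * r / 2) ^+ 2 / (r * eta / 2) ^+ 2 / N%:R.
  move: card_bad; move: (2 * _ ^+ 2 * _ ^+ 2) (exprn_gt0 2 gap0) W0.
  move: (_ ^+ 2) (#|{: W}|%:R) (#|[pred w : W | ~~ good w]|%:R) => g w b K g0 w0 bK.
  (* The [1 / N] here will cancel the [N] in [S], which counts coefficients. *)
  rewrite ler_pdivrMr// (_ : K / g / N%:R * w = w * (K / N%:R) / g); last by ring.
  by rewrite ler_pdivlMr.
apply: (@le_trans _ _ (2 * L%:R ^+ 2 * ((1 + k%:R * q%:R) * G * r / 2) ^+ 2 /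
    (r * eta / 2) ^+ 2 / N%:R * (N%:R * (c0 * (8 * L%:R * q%:R ^+ k))))).
  apply: ler_pM => //.
    by rewrite mulr_ge0// sumr_ge0// => j _; exact: sqr_ge0.
rewrite /remainder_constant le_eqVlt; apply/orP; left; apply/eqP.
move: (_ / (r * eta / 2) ^+ 2) => t; rewrite -mulrA mulKf ?gt_eqF//.
by rewrite [RHS]mulrCA.
Qed.

End minimax_lower_bound.

(** * Asymptotics *)

Lemma limn_einf_ge {R : realType} (u : nat -> \bar R) (l : \bar R) :
  (\forall n \near \oo, (l <= u n)%E) -> (l <= limn_einf u)%E.
Proof.
move=> [m _ lu]; rewrite limn_einf_lim; apply: lime_ge; first exact: is_cvg_einfs.
exists m => // p /= mp; apply: le_ereal_inf_tmp => _ [i /= pi <-].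
exact/lu/(leq_trans mp).
Qed.

Lemma limn_esup_ubound {R : realType} (u : nat -> R) :
  (limn_esup (EFin \o u) < +oo)%E ->
  exists2 M : R, 0 < M & \forall n \near \oo, u n <= M.
Proof.
move=> /ereal_inf_lt[_ [V Voo <-]] supV.
have [M supM] : exists M : R, (ereal_sup ((EFin \o u) @` V) <= M%:E)%E.
  move: supV; case: (ereal_sup _) => [x|//|] _; first by exists x.
  by exists 0; exact: leNye.
exists (Num.max M 1); first by rewrite lt_max ltr01 orbT.
apply: filterS Voo => n Vn; rewrite le_max; apply/orP; left.
rewrite -lee_fin (le_trans _ supM)//; apply: ereal_sup_ubound.
by exists n.
Qed.

Section asymptotics.
Context {R : realType} (k : nat) (r : R).
Hypothesis k1 : (1 <= k)%N.
Hypothesis r0 : 0 < r.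

Local Notation G := (k.+1%:R * (2 * k).+1%:R / k%:R : R).

Let k0 : 0 < k%:R :> R. Proof. by rewrite ltr0n. Qed.

Lemma exists_nat_gt (x : R) : exists2 m : nat, (1 <= m)%N & x < m%:R.
Proof. by exists (Num.truncn x).+1 => //; exact: Num.Theory.truncnS_gt. Qed.

(** [q] is chosen first, then [L] against [q^k], and [N0] last because the remainder depends on [q],
    [L] and [eta]. [N.+1] appears because [N] will be a rounded-down cut-off. *)
Lemma minimax_parameters (eps : R) : 0 < eps < 1 ->
  exists (q L : nat) (eta : R), [/\ (1 <= q)%N, (1 <= L)%N, 0 < eta < 1,
    0 <= 1 - 4 * q%:R ^+ k / L%:R :> R &
    exists2 N0 : nat, (1 <= N0)%N & forall N : nat, (N0 <= N)%N ->
      (1 - eta) * (1 + k%:R * q%:R / N%:R) * (1 + G / N%:R) <= 1 - eta / 2 /\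
      (1 - eps) * (2 * (k%:R / k.+1%:R) * N.+1%:R) <=
        2 * ((1 - eta) * (1 - 4 * q%:R ^+ k / L%:R) *
          (N%:R * (k%:R / k.+1%:R - q%:R^-1) - 1))
        - remainder_constant k q L eta r].
Proof.
move=> /andP[e0 e1]; set kap : R := k%:R / k.+1%:R.
have kap0 : 0 < kap by rewrite divr_gt0.
have kap1 : kap <= 1 by rewrite ler_pdivrMr// mul1r ler_nat.
move: kap kap0 kap1 => kap kap0 kap1.
have [q q1 qe] := exists_nat_gt (4 / (kap * eps)).
have [L L1 Le] := exists_nat_gt (16 * q%:R ^+ k / eps).
have q0 : 0 < q%:R :> R by rewrite ltr0n.
have L0 : 0 < L%:R :> R by rewrite ltr0n.
have qe' : q%:R^-1 <= kap * (eps / 4).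
  move: qe; rewrite ltr_pdivrMr ?mulr_gt0// => qe.
  by rewrite -[leLHS]mul1r ler_pdivrMr//; lra.
have Le' : 4 * q%:R ^+ k / L%:R <= eps / 4.
  move: Le; rewrite ltr_pdivrMr// ler_pdivrMr//.
  by move: (q%:R ^+ k) => t; lra.
have g0 : 0 <= 4 * q%:R ^+ k / L%:R :> R by rewrite divr_ge0// mulr_ge0// exprn_ge0// ltW.
exists q, L, (eps / 4); split => //; [lra|lra|].
move: (4 * q%:R ^+ k / L%:R) Le' g0 => g Le' g0.
move: (remainder_constant _ _ _ _ _) => C3.
set a : R := k%:R * q%:R.
have a0 : 0 <= a by rewrite mulr_ge0// ltW.
have G0 : 0 <= G by rewrite divr_ge0// ltW.
(* With [eta = eps / 4], the first threshold makes [(1 + a / N) (1 + G / N) <= 1 + eta / 2], and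
   [(1 - eta) (1 + eta / 2) <= 1 - eta / 2]. For the second, three factors [1 - eps / 4] lose at
   most [3 eps / 4]; the remaining [eps / 4] of [2 kap N] absorbs the additive loss [4 + C3]. *)
have [N0 N01 N0e] := exists_nat_gt
  (Num.max (2 * (a + G + a * G) / (eps / 4)) ((4 + C3) * 2 / (kap * eps))).
exists N0 => // N N0N.
have N1 : 1 <= N%:R :> R by rewrite ler1n (leq_trans N01).
have NP : 0 < N%:R :> R by lra.
have {N0e} : Num.max (2 * (a + G + a * G) / (eps / 4)) ((4 + C3) * 2 / (kap * eps)) < N%:R.
  by apply: lt_le_trans N0e _; rewrite ler_nat.
rewrite gt_max !ltr_pdivrMr ?mulr_gt0 ?divr_gt0// => /andP[Na NC].
split.
  have H : (1 + a / N%:R) * (1 + G / N%:R) <= 1 + (eps / 4) / 2.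
    apply: (@le_trans _ _ (1 + (a + G + a * G) / N%:R)).
      have aG : a * G / N%:R / N%:R <= a * G / N%:R.
        by rewrite ler_pdivrMr// ler_peMr// divr_ge0// ?mulr_ge0// ltW.
      have -> : (1 + a / N%:R) * (1 + G / N%:R) =
        1 + (a + G) / N%:R + a * G / N%:R / N%:R by field; rewrite !gt_eqF.
      by rewrite [(a + G + _) / _]mulrDl addrA lerD2l.
    by rewrite lerD2l ler_pdivrMr//; lra.
  rewrite -mulrA; apply: (@le_trans _ _ ((1 - eps / 4) * (1 + (eps / 4) / 2))).
    by apply: ler_wpM2l => //; lra.
  nra.
rewrite -(natr1 N); move: NC; move: (N%:R : R) N1 => x N1 NC.
have kq : kap * (1 - eps / 4) <= kap - q%:R^-1 by lra.
have gg : (1 - eps / 4) * (1 - eps / 4) <= (1 - eps / 4) * (1 - g).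
  by apply: ler_wpM2l; lra.
have gg1 : (1 - eps / 4) * (1 - g) <= 1 by nra.
move: kq gg gg1; move: (kap - q%:R^-1) ((1 - eps / 4) * (1 - g)) => u v uk vg v1.
have kx : 0 <= kap * x by rewrite mulr_ge0// ltW//; lra.
have e4 : 0 <= 1 - eps / 4 by lra.
have b : (1 - 3 * eps / 4) * (kap * x) <= v * (x * u).
  apply: (@le_trans _ _ ((1 - eps / 4) ^+ 2 * (x * (kap * (1 - eps / 4))))).
    rewrite (_ : (1 - eps / 4) ^+ 2 * _ = (1 - eps / 4) ^+ 3 * (kap * x)); last by ring.
    apply: ler_wpM2r => //.
    have : 0 <= eps ^+ 2 * (3 - eps / 4) by apply: mulr_ge0; [exact: sqr_ge0|lra].
    nra.
  apply: ler_pM => //.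
  - exact: sqr_ge0.
  - by rewrite mulr_ge0// ?mulr_ge0//; lra.
  - by apply: ler_wpM2l => //; lra.
have k2 : kap * eps >= 0 by rewrite mulr_ge0// ltW.
lra.
Qed.

(* [Y / (2 pi)] is Pinsker's cut-off frequency. *)
Lemma pinsker_constant_cutoff (s : R) (n : nat) : (1 <= n)%N -> 0 < s ->
  exists Y : R, [/\ 0 < Y,
    Y ^+ (2 * k).+1 = (2 * k).+1%:R * r * (k.+1%:R * pi) / (s / n%:R * k%:R) &
    n%:R `^ ((2 * k)%:R / (2 * k + 1)%:R) * (pinsker_constant k r s)^-1 =
      (s / n%:R * k%:R / (k.+1%:R * pi) * Y)^-1].
Proof.
move=> n1 s0; have n0 : 0 < n%:R :> R by rewrite ltr0n.
rewrite /pinsker_constant; move: (pi : R) (@pi_gt0 R) => p p0.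
set A := s / n%:R * k%:R / (k.+1%:R * p).
have A0 : 0 < A by rewrite !(divr_gt0, mulr_gt0).
set B := (2 * k).+1%:R * r; have B0 : 0 < B by rewrite mulr_gt0.
have m0 : (2 * k).+1%:R != 0 :> R by rewrite pnatr_eq0.
pose m := (2 * k).+1%:R : R.
exists ((B / A) `^ m^-1); split.
- by rewrite powR_gt0// divr_gt0.
- rewrite -powR_mulrn ?powR_ge0// -powRrM mulVf// powRr1; last by rewrite divr_ge0// ltW.
  by rewrite /A /B; field; rewrite nat1r !gt_eqF.
rewrite !addn1 -/m -/B.
have -> : s * k%:R / (k.+1%:R * p) = n%:R * A by rewrite /A; field; rewrite nat1r !gt_eqF.
have mE : (2 * k)%:R / m = 1 - m^-1 by rewrite /m -[X in X - _](divff m0) -[X in _ - X]mul1r -mulrBl -(natr1 (2 * k)) addrK.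
rewrite mE powRM ?(ltW A0)//.
have np : 0 < n%:R `^ (1 - m^-1) by rewrite powR_gt0.
have Ap : 0 < A `^ (1 - m^-1) by rewrite powR_gt0.
have Bp : 0 < B `^ m^-1 by rewrite powR_gt0.
(* Pinsker's constant divided by the rate is thus linear in the cut-off, namely [A * Y]. *)
have -> : A * (B / A) `^ m^-1 = B `^ m^-1 * A `^ (1 - m^-1).
  rewrite powRM ?(ltW B0) ?invr_ge0 ?(ltW A0)// powRB ?(gt_eqF A0) ?implybT//.
  rewrite powRr1 ?(ltW A0)// -[A^-1]powR_inv1 ?(ltW A0)// -powRrM mulN1r powRN.
  by rewrite mulrCA.
by field; rewrite !gt_eqF.
Qed.

(** The conclusion would be an equality for [N = Y / (2 pi)]: the cut-off is where the leading part
    of the energy exhausts the radius. *)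
Lemma cutoff_energy (c0 Y : R) (N : nat) : 0 < c0 -> 0 <= Y ->
  Y ^+ (2 * k).+1 = (2 * k).+1%:R * r * (k.+1%:R * pi) / (c0 * k%:R) ->
  2 * pi * N%:R <= Y ->
  2 * c0 * (2 * pi) ^+ (2 * k) * N%:R ^+ (2 * k).+1 <= G * r.
Proof.
move=> c00 Y0 YE NY; have pi0 := @pi_gt0 R.
have : (2 * pi * N%:R) ^+ (2 * k).+1 <= Y ^+ (2 * k).+1.
  by rewrite lerXn2r// nnegrE// mulr_ge0// mulr_ge0// ltW.
rewrite YE exprMn (exprS (2 * pi) (2 * k)).
rewrite ler_pdivlMr ?mulr_gt0// => H.
rewrite [leRHS]mulrAC ler_pdivlMr// -(ler_pM2r pi0).
move: H; move: ((2 * pi) ^+ (2 * k)) (N%:R ^+ (2 * k).+1) => u v H.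
rewrite (_ : _ * pi = 2 * pi * u * v * (c0 * k%:R)); last by ring.
by apply: (le_trans H); rewrite le_eqVlt; apply/orP; left; apply/eqP; ring.
Qed.

End asymptotics.

Section lower_bound.
Context {R : realType} (k : nat) (r : R).
Hypothesis k1 : (1 <= k)%N.
Hypothesis r0 : 0 < r.

(** The ball is not empty, so the supremum of the risks is non-negative. *)
Lemma sobolev_ball_tpoly0 : sobolev_ball k r (tpoly (fun _ : 'I_0 * bool => 0 : R)).
Proof.
apply: sobolev_tpoly; rewrite big1 ?ltW// => -[[]//].
Qed.

(** The threshold concerns [n / s] only, since the noise level varies with [n]. *)
Lemma normalized_minimax_risk_ge (eps : R) : 0 < eps < 1 ->
  exists D : R, forall (s : R) (n : nat) (Q : noise_law R) (Qs : set (noise_law R)),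
    (1 <= n)%N -> 0 < s -> D * s <= n%:R -> brownian_law s Q -> Qs Q ->
    ((1 - eps)%:E <=
     (n%:R `^ ((2 * k)%:R / (2 * k + 1)%:R) * (pinsker_constant k r s)^-1)%:E
     * minimax_risk n Qs (sobolev_ball k r))%E.
Proof.
move=> eps01; have k0 : 0 < k%:R :> R by rewrite ltr0n.
have [q [L [eta [q1 L1 eta01 beta0 [N0 N01 params]]]]] := minimax_parameters r k1 eps01.
have pi0 := @pi_gt0 R.
set B := (2 * k).+1%:R * r * (k.+1%:R * pi).
have B0 : 0 < B by rewrite !mulr_gt0.
(* With this [D], the condition [D * s <= n] says that the cut-off [Y / (2 * pi)] is at least
   [N0]. *)
exists ((2 * pi * N0%:R) ^+ (2 * k).+1 * k%:R / B) => s n Q Qs n1 s0 Dn QB QsQ.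
have n0 : 0 < n%:R :> R by rewrite ltr0n.
have [Y [Y0 YE ->]] := pinsker_constant_cutoff k1 r0 n1 s0.
set c0 := s / n%:R in YE *; have c00 : 0 < c0 by rewrite divr_gt0.
pose N := Num.truncn (Y / (2 * pi)).
have tp0 : 0 < 2 * pi :> R by rewrite mulr_gt0.
have /andP[NY YN] : N%:R <= Y / (2 * pi) < N.+1%:R.
  by rewrite Num.Theory.truncn_itv// divr_ge0// ltW.
have N0N : (N0 <= N)%N.
  rewrite Num.Theory.truncn_ge_nat ?(divr_ge0 (ltW Y0) (ltW tp0))// ler_pdivlMr// mulrC.
  rewrite -(@ler_pXn2r _ (2 * k).+1)// ?nnegrE ?(ltW Y0) ?(mulr_ge0 (ltW tp0))// YE -/B.
  rewrite ler_pdivlMr ?(mulr_gt0 c00 k0)// /c0.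
  move: Dn; move: (_ ^+ _) => t; rewrite mulrAC ler_pdivrMr// => Dn.
  by rewrite mulrCA mulrAC mulrA ler_pdivrMr//; move: Dn; lra.
have [etaN main] := params _ N0N.
have N1 : (1 <= N)%N by exact: leq_trans N0N.
have c0N : 2 * c0 * (2 * pi) ^+ (2 * k) * N%:R ^+ (2 * k).+1 <=
    (k.+1%:R * (2 * k).+1%:R / k%:R) * r.
  by apply: cutoff_energy YE _ => //; [exact: ltW|rewrite mulrC -ler_pdivlMr].
set V := c0 * k%:R / (k.+1%:R * pi) * Y.
have V0 : 0 < V by rewrite mulr_gt0// divr_gt0// mulr_gt0.
have Vle : V <= c0 * (2 * (k%:R / k.+1%:R) * N.+1%:R).
  have -> : V = c0 * (2 * (k%:R / k.+1%:R) * (Y / (2 * pi))).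
    by rewrite /V; move: (pi : R) pi0 => p p0; field; rewrite nat1r !gt_eqF.
  by rewrite ler_pM2l// ler_pM2l ?ltW// !mulr_gt0// invr_gt0.
have lower : (((1 - eps) * V)%:E <= minimax_risk n Qs (sobolev_ball k r))%E.
  apply: le_ereal_inf_tmp => _ [Shat mShat <-].
  set M := ereal_sup _.
  have riskM S : sobolev_ball k r S -> (risk Q Shat S <= M)%E.
    move=> bS; apply: (@le_trans _ _ (robust_risk Qs Shat S)).
      by apply: ereal_sup_ubound; exists Q.
    by apply: ereal_sup_ubound; exists S.
  have M0 : (0 <= M)%E.
    apply: le_trans (riskM _ sobolev_ball_tpoly0).
    apply: integral_ge0 => x _; apply: integral_ge0 => u _.
    by rewrite lee_fin sqr_ge0.
  move: riskM M0; case: M => [rho riskM rho0|_ _|//]; last exact: leey.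
  rewrite lee_fin; rewrite lee_fin in rho0.
  have := minimax_lower_bound s0 n1 QB mShat k1 N1 q1 L1 eta01 r0 rho0 riskM c0N etaN beta0.
  rewrite -/c0; set b := remainder_constant _ _ _ _ _ in main *.
  move=> H; have : c0 * ((1 - eps) * (2 * (k%:R / k.+1%:R) * N.+1%:R)) <= rho.
    apply: le_trans (ler_wpM2l (ltW c00) main) _.
    rewrite mulrBr lerBlDr; apply: le_trans _ H; rewrite le_eqVlt; apply/orP; left; apply/eqP.
    by rewrite mulrCA [(1 - eta) * c0]mulrC -!mulrA.
  apply: le_trans; rewrite [leRHS]mulrCA; apply: ler_wpM2l => //.
  by case/andP: eps01 => *; lra.
apply: (@le_trans _ _ ((V^-1)%:E * ((1 - eps) * V)%:E)%E).
  by rewrite -EFinM lee_fin mulrC mulfK// gt_eqF.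
by rewrite lee_pmul2l ?lte_fin ?invr_gt0.
Qed.

End lower_bound.

Theorem theorem3p2 (R : realType) (k : nat) (r : R) (sigma l : nat -> R)
    (Qstar : nat -> set (noise_law R)) (Q0 : nat -> noise_law R)
    (hk : (1 <= k)%N) (hr : 0 < r)
    (hsigma_pos : forall n, (1 <= n)%N -> 0 < sigma n)
    (hsigma_inf : (0 < limn_einf (EFin \o sigma))%E)
    (hsigma_sup : (limn_esup (EFin \o sigma) < +oo)%E)
    (hl_pos : forall n, (1 <= n)%N -> 0 < l n)
    (hl_incr : forall m n, (1 <= m)%N -> (m <= n)%N -> l m <= l n)
    (hl_infty : l n @[n --> \oo] --> +oo)
    (hl_small : forall delta : R, 0 < delta ->
       l n / (n%:R `^ delta) @[n --> \oo] --> (0 : R))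
    (hQstar : forall n, (1 <= n)%N -> Qstar n `<=` noise_class_star sigma l n)
    (hQ0 : forall n, (1 <= n)%N -> brownian_law (sigma n) (Q0 n))
    (hQ0star : forall n, (1 <= n)%N -> Qstar n (Q0 n)) :
  (1 <= limn_einf (fun n =>
     (n%:R `^ ((2 * k)%:R / (2 * k + 1)%:R)
        * (pinsker_constant k r (sigma n))^-1)%:E
     * minimax_risk n (Qstar n) (sobolev_ball k r)))%E.
Proof.
have [M M0 sigmaM] := limn_esup_ubound hsigma_sup.
apply/lee_addgt0Pr => e e0.
pose eps := Num.min e (1 / 2).
have eps01 : 0 < eps < 1.
  by rewrite /eps lt_min gt_min e0/=; apply/andP; split; [lra|apply/orP; right; lra].
have [D bound] := normalized_minimax_risk_ge hk hr eps01.
apply: (@le_trans _ _ ((1 - eps)%:E + e%:E)%E).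
  by rewrite -EFinD lee_fin -lerBlDr lerD2l lerN2 /eps ge_min lexx.
apply: leeD => //; apply: limn_einf_ge; near=> n.
have n1 : (1 <= n)%N by near: n; exists 1%N.
apply: (bound _ _ (Q0 n)) => //; [exact: hsigma_pos| |exact: hQ0|exact: hQ0star].
(* [sigma] is eventually bounded by [M], so the threshold [D * sigma n <= n] is eventually met. *)
apply: (@le_trans _ _ (`|D| * M)); last by near: n; exact: nbhs_infty_ger.
apply: (@le_trans _ _ (`|D| * sigma n)).
  by rewrite ler_wpM2r ?ler_norm// ltW// hsigma_pos.
by rewrite ler_wpM2l//; near: n.
Unshelve. all: by end_near.
Qed.
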